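(* The association $\Gamma^{\sigma}_{\max}$ (respectively $\Gamma^{\sigma}_{\min}$), which assigns to each object $(G,\sigma)$ of $\mathcal{G}_\sigma$ its maximal (respectively minimal) twisted groupoid $C^*$-algebra $C^*(G,\sigma)$ (respectively $C^*_r(G,\sigma)$) and to each partial morphism its induced map, is a contravariant functor from $\mathcal{G}_\sigma$ to the category $\mathcal{C}$ of $C^*$-algebras with $*$-morphisms. Moreover, both $\Gamma^{\sigma}_{\max}$ and $\Gamma^{\sigma}_{\min}$ are extensions of the Gelfand duality functor.
   Context: A topological groupoid is a groupoid $G$ (identified with its set of arrows; unit space $G^{(0)}$, composable pairs $G^{(2)}$, range and source $r,s$, $G^u=r^{-1}(u)$, $G_u=s^{-1}(u)$) with a locally compact Hausdorff topology making composition and inversion continuous, together with a fixed Haar system: positive Radon measures $\{\mu^u\}_{u\in G^{(0)}}$ on $G$ with $\mu^u$ supported on $G^u$, $u\mapsto\int f\,d\mu^u$ continuous for $f\in C_c(G)$, and $\int f(y)\,d\mu^{r(x)}(y)=\int f(xy)\,d\mu^{s(x)}(y)$. A 2-cocycle on $G$ is a continuous map $\sigma:G^{(2)}\to\mathbb{T}$ with $\sigma(g,h)\sigma(gh,k)=\sigma(g,hk)\sigma(h,k)$ whenever $(g,h),(h,k)\in G^{(2)}$. $C_c(G,\sigma)$ is the space of compactly supported continuous complex functions on $G$ with $(f*g)(x)=\int f(xy)g(y^{-1})\sigma(xy,y^{-1})\,d\mu^{s(x)}(y)$, $f^*(x)=\overline{f(x^{-1})\sigma(x,x^{-1})}$,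 and $\|f\|_I=\max\{\sup_u\int|f(x)|d\mu^u(x),\sup_u\int|f(x^{-1})|d\mu^u(x)\}$. $C^*(G,\sigma)$ is the completion for $\|f\|_{\max}=\sup_\pi\|\pi(f)\|$ over all $\|\cdot\|_I$-continuous $*$-representations. $C^*_r(G,\sigma)$ is the completion for $\|f\|_r=\sup_u\|\mathrm{Ind}(\delta_u)(f)\|$, where $\mathrm{Ind}(\delta_u)$ acts on $L^2(G_u,\mu_u)$ ($\mu_u$ the image of $\mu^u$ under inversion) by $(\mathrm{Ind}(\delta_u)(f)\xi)(x)=\int f(xy)\xi(y^{-1})\sigma(xy,y^{-1})\,d\mu^u(y)$. A groupoid morphism is a proper continuous functor; $\phi:G\to H$ is Haar system preserving if $\phi_*\mu^u=\nu^{\phi(u)}$ for all $u\in G^{(0)}$, and cocycle preserving if $\sigma_G(g,h)=\sigma_H(\phi(g),\phi(h))$. A Haar subgroupoid of $(G,\sigma)$ is a pair $(K,\sigma|_K)$ with $K\subset G$ an open subgroupoid with the restricted Haar system. A partial morphism $(G,\sigma_G)\to(H,\sigma_H)$ is a pair $(\phi,K)$ with $(K,\tau)$ a Haar subgroupoid of $(G,\sigma_G)$ and $\phi:(K,\tau)\to(H,\sigma_H)$ a cocycle preserving and Haar system preserving morphism. Its induced map is the composition $C_c(H,\sigma_H)\xrightarrow{\phi^*}C_c(K,\tau)\hookrightarrow C_c(G,\sigma_G)$ (pullback, then extension by zero), extended to the completions. Partial morphisms compose on the preimage of the second domain. $\mathcal{G}_\sigma$ is the category of pairs $(G,\sigma)$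 ($G$ a topological groupoid with fixed Haar system, $\sigma$ a 2-cocycle) with partial morphisms. The Gelfand duality functor sends a locally compact Hausdorff space $X$ to $C_0(X)$ and a proper continuous map $f:X\to Y$ to $f^*:C_0(Y)\to C_0(X)$; spaces are regarded as groupoids with only units, Haar system of point masses, and trivial cocycle.
   Formalization: For cocycles not normalised on units the stated f^* is not an involution on C*_r(G,σ) (one point, σ≠1); there the involution is the operator adjoint, x ↦ conj(σ(r(x),r(x)))·f^*(x), which equals f^* whenever σ(u,u)=1 on units. *)

(* Defs.v *)
From HB Require Import structures.
From mathcomp Require Import all_boot all_order all_algebra complex.
From mathcomp Require Import all_classical all_reals all_analysis measurable_realfun lra.

Set Implicit Arguments.
Unset Strict Implicit.
Unset Printing Implicit Defensive.

Import Order.TTheory GRing.Theory Num.Theory.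
Import numFieldNormedType.Exports.

Local Open Scope classical_set_scope.
Local Open Scope ring_scope.
Local Open Scope complex_scope.

(* R[i] carries its topology only through its regular module. *)
Notation CC R := (R[i]^o).

(* Norms of complex normed spaces take their values in R[i] in the library;
   this is the same norm as an element of R. *)
Definition nrm (R : realType) (V : normedModType R[i]) (x : V) : R :=
  complex.Re `|x|.

Record category := Category {
  ob :> Type;
  hom : ob -> ob -> Type;
  idm : forall a, hom a a;
  compm : forall a b c, hom b c -> hom a b -> hom a c;
  compm_id : forall a b (f : hom a b), compm f (idm a) = f;
  id_compm : forall a b (f : hom a b), compm (idm b) f = f;
  compmA : forall a b c d (h : hom c d) (g : hom b c) (f : hom a b),
    compm h (compm g f) = compm (compm h g) f }.
Arguments hom {c0} : rename.
Arguments idm {c} a : rename.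
Arguments compm {c a b c0} : rename.

Record functor_on (C D : category) (F0 : C -> D) := Functor {
  fmap : forall a b : C, hom a b -> hom (F0 a) (F0 b);
  fmap_id : forall a, fmap (idm a) = idm (F0 a);
  fmap_comp : forall (a b c : C) (g : hom b c) (f : hom a b),
    fmap (compm g f) = compm (fmap g) (fmap f) }.
Arguments fmap {C D F0} _ {a b}.

Record contrafunctor_on (C D : category) (F0 : C -> D) := Contrafunctor {
  cmap : forall a b : C, hom a b -> hom (F0 b) (F0 a);
  cmap_id : forall a, cmap (idm a) = idm (F0 a);
  cmap_comp : forall (a b c : C) (g : hom b c) (f : hom a b),
    cmap (compm g f) = compm (cmap f) (cmap g) }.
Arguments cmap {C D F0} _ {a b}.

Definition isomorphism (C : category) (a b : C) (f : hom a b) : Prop :=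
  exists g : hom b a, compm g f = idm a /\ compm f g = idm b.

(* theta is a natural isomorphism from the contravariant functor F \o J to G. *)
Definition extends_along (B C D : category) (J0 : B -> C) (J : functor_on J0)
    (F0 : C -> D) (F : contrafunctor_on F0) (G0 : B -> D)
    (G : contrafunctor_on G0) (theta : forall a, hom (F0 (J0 a)) (G0 a)) : Prop :=
  (forall a, isomorphism (theta a)) /\
  (forall (a b : B) (f : hom a b),
     compm (theta a) (cmap F (fmap J f)) = compm (cmap G f) (theta b)).

(* Not necessarily unital; the zero algebra is allowed. *)
Record cstar_algebra (R : realType) := CstarAlgebra {
  cstar_car :> completeNormedModType R[i];
  cmul : cstar_car -> cstar_car -> cstar_car;
  cadj : cstar_car -> cstar_car;
  cmulA : forall x y z, cmul x (cmul y z) = cmul (cmul x y) z;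
  cmulDl : forall a x y z, cmul (a *: x + y) z = a *: cmul x z + cmul y z;
  cmulDr : forall a x y z, cmul z (a *: x + y) = a *: cmul z x + cmul z y;
  cadjD : forall (a : R[i]) x y, cadj (a *: x + y) = a^* *: cadj x + cadj y;
  cadjM : forall x y, cadj (cmul x y) = cmul (cadj y) (cadj x);
  cadjK : forall x, cadj (cadj x) = x;
  cnorm_mul : forall x y, `|cmul x y| <= `|x| * `|y|;
  cnorm_adj : forall x, `|cmul (cadj x) x| = `|x| ^+ 2 }.

Record is_star_morphism (R : realType) (A B : cstar_algebra R) (f : A -> B) :
    Prop := IsStarMorphism {
  smor_linear : forall (a : R[i]) x y, f (a *: x + y) = a *: f x + f y;
  smor_mul : forall x y, f (cmul x y) = cmul (f x) (f y);
  smor_adj : forall x, f (cadj x) = cadj (f x) }.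

Record star_morphism (R : realType) (A B : cstar_algebra R) := StarMorphism {
  smor_fun :> A -> B;
  smorP : is_star_morphism smor_fun }.

Section CstarCategory.
Variable R : realType.
Implicit Types A B D E : cstar_algebra R.

Lemma star_morphism_eq A B (f g : star_morphism A B) :
  f =1 g -> f = g.
Proof.
case: f g => [f fP] [g gP] /= /funext fg; subst g.
by congr StarMorphism; exact: Prop_irrelevance.
Qed.

Lemma star_id_subproof A : is_star_morphism (@id A).
Proof. by []. Qed.

Lemma star_comp_subproof A B D (g : star_morphism B D)
  (f : star_morphism A B) : is_star_morphism (g \o f).
Proof.
case: f g => [f [f1 f2 f3]] [g [g1 g2 g3]]; split => /= *.
- by rewrite f1 g1.
- by rewrite f2 g2.
- by rewrite f3 g3.
Qed.

Definition star_id A : star_morphism A A := StarMorphism (star_id_subproof A).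

Definition star_comp A B D (g : star_morphism B D) (f : star_morphism A B) :
  star_morphism A D := StarMorphism (star_comp_subproof g f).

Lemma star_comp_id A B (f : star_morphism A B) : star_comp f (star_id A) = f.
Proof. exact: star_morphism_eq. Qed.

Lemma star_id_comp A B (f : star_morphism A B) : star_comp (star_id B) f = f.
Proof. exact: star_morphism_eq. Qed.

Lemma star_compA A B D E (h : star_morphism D E) (g : star_morphism B D)
  (f : star_morphism A B) : star_comp h (star_comp g f) = star_comp (star_comp h g) f.
Proof. exact: star_morphism_eq. Qed.

Definition Cstar : category := @Category (cstar_algebra R) (@star_morphism R)
  star_id star_comp star_comp_id star_id_comp star_compA.

End CstarCategory.

Record hilbert (R : realType) := Hilbert {
  hilbert_car :> completeNormedModType R[i];
  hdot : {dot hilbert_car for Num.Def.conjC};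
  hdotE : forall x, hdot x x = `|x| ^+ 2 }.

Definition opnorm (R : realType) (H : hilbert R) (T : H -> H) : \bar R :=
  ereal_sup [set (nrm (T x))%:E | x in [set x : H | nrm x <= 1]].

Definition Cc (R : realType) (T : topologicalType) : set (T -> CC R) :=
  [set f | continuous f /\ compact (closure [set x | f x != 0])].

Definition C0 (R : realType) (T : topologicalType) : set (T -> CC R) :=
  [set f | continuous f /\ forall e : R, 0 < e -> compact [set x | e <= nrm (f x)]].

(* Measurable types are pointed in the library, topological spaces may be
   empty: the Borel space of T is pointed at a given x : T. Its measurable sets
   do not depend on x. *)
Definition pointed_at (T : topologicalType) (x : T) : Type := T.
HB.instance Definition _ (T : topologicalType) (x : T) :=
  Choice.on (pointed_at x).
HB.instance Definition _ (T : topologicalType) (x : T) :=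
  isPointed.Build (pointed_at x) x.
Notation borel x := (g_sigma_algebraType (open : set (set (pointed_at x)))).

Definition borel_set (T : topologicalType) : set (set T) := <<s open >>.

Record is_radon (R : realType) (T : topologicalType) (x : T)
    (m : {measure set borel x -> \bar R}) : Prop := IsRadon {
  radon_compact : forall K : set T, compact K -> (m K < +oo)%E;
  radon_outer : forall B : set T, borel_set B ->
    m B = ereal_inf [set m U | U in [set U : set T | open U /\ B `<=` U]];
  radon_inner : forall U : set T, open U ->
    m U = ereal_sup [set m K | K in [set K : set T | compact K /\ K `<=` U]] }.

Definition cintegral (R : realType) d (T : measurableType d)
    (m : {measure set T -> \bar R}) (D : set T) (f : T -> CC R) : CC R :=
  (\int[m]_(x in D) complex.Re (f x))%R +i* (\int[m]_(x in D) complex.Im (f x))%R.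

(* A groupoid is given by its set of arrows, units being arrows. The values of
   mul outside the composable pairs are irrelevant. *)
Record topgroupoid := TopGroupoid {
  arrow :> topologicalType;
  rng : arrow -> arrow;
  src : arrow -> arrow;
  inv : arrow -> arrow;
  mul : arrow -> arrow -> arrow;
  rng_rng : forall x, rng (rng x) = rng x;
  src_rng : forall x, src (rng x) = rng x;
  rng_src : forall x, rng (src x) = src x;
  src_src : forall x, src (src x) = src x;
  rng_mul : forall x y, src x = rng y -> rng (mul x y) = rng x;
  src_mul : forall x y, src x = rng y -> src (mul x y) = src y;
  mul_assoc : forall x y z, src x = rng y -> src y = rng z ->
    mul x (mul y z) = mul (mul x y) z;
  mul_rng : forall x, mul (rng x) x = x;
  mul_src : forall x, mul x (src x) = x;
  rng_inv : forall x, rng (inv x) = src x;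
  src_inv : forall x, src (inv x) = rng x;
  mul_inv : forall x, mul x (inv x) = rng x;
  inv_mul : forall x, mul (inv x) x = src x;
  arrow_lc : locally_compact [set: arrow];
  arrow_hausdorff : hausdorff_space arrow;
  inv_continuous : continuous inv;
  mul_continuous : {within [set z : arrow * arrow | src z.1 = rng z.2],
    continuous (fun z : arrow * arrow => mul z.1 z.2)} }.
Arguments rng {t}. Arguments src {t}. Arguments inv {t}. Arguments mul {t}.

Definition composable (G : topgroupoid) : set (G * G) :=
  [set z | src z.1 = rng z.2].
Definition units (G : topgroupoid) : set G := [set u | rng u = u].
(* G^u and G_u *)
Definition rfiber (G : topgroupoid) (u : G) : set G := [set x | rng x = u].
Definition sfiber (G : topgroupoid) (u : G) : set G := [set x | src x = u].

(* The values of mu outside the unit space are irrelevant. *)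
Record is_haar_system (R : realType) (G : topgroupoid)
    (mu : forall u : G, {measure set borel u -> \bar R}) : Prop := IsHaar {
  haar_radon : forall u, units u -> is_radon (mu u);
  haar_support : forall u, units u -> mu u (~` rfiber u) = 0%E;
  haar_continuous : forall f, Cc f ->
    {within @units G, continuous (fun u : G => cintegral (mu u) setT f)};
  haar_invariant : forall f (x : G), Cc f ->
    cintegral (mu (rng x)) setT f =
    cintegral (mu (src x)) (rfiber (src x)) (fun y : G => f (mul x y)) }.

Record is_cocycle (R : realType) (G : topgroupoid) (sigma : G -> G -> CC R) :
    Prop := IsCocycle {
  cocycle_norm : forall g h : G, src g = rng h -> `|sigma g h| = 1;
  cocycle_continuous : {within @composable G,
    continuous (fun z : G * G => sigma z.1 z.2)};
  cocycleP : forall g h k : G, src g = rng h -> src h = rng k ->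
    sigma g h * sigma (mul g h) k = sigma g (mul h k) * sigma h k }.

Record twisted_groupoid (R : realType) := TwistedGroupoid {
  tgpd :> topgroupoid;
  haar : forall u : tgpd, {measure set borel u -> \bar R};
  haarP : is_haar_system haar;
  twist : tgpd -> tgpd -> CC R;
  twistP : is_cocycle twist }.
Arguments haar {R t}. Arguments twist {R t}.

Section Algebra.
Variables (R : realType) (G : twisted_groupoid R).
Implicit Types (f g xi : G -> CC R) (u x y : G).

Definition conv f g : G -> CC R := fun x =>
  cintegral (haar (src x)) (rfiber (src x))
    (fun y : G => f (mul x y) * g (inv y) * twist (mul x y) (inv y)).

Definition star f : G -> CC R := fun x =>
  ((f (inv x) * twist x (inv x) : R[i])^*)%C.

(* 0 is added to the sets of which suprema are taken, for the case of an empty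
   unit space. *)
Definition normI f : \bar R :=
  maxe (ereal_sup (0%E |` [set (\int[haar u]_x (nrm (f x))%:E)%E | u in @units G]))
       (ereal_sup (0%E |` [set (\int[haar u]_x (nrm (f (inv x)))%:E)%E
                              | u in @units G])).

Record is_representation (H : hilbert R) (pi : (G -> CC R) -> {linear H -> H}) :
    Prop := IsRepresentation {
  rep_bounded : forall f, Cc f -> continuous (pi f);
  rep_linear : forall (a : R[i]) f g v, Cc f -> Cc g ->
    pi (a *: f + g) v = a *: pi f v + pi g v;
  rep_conv : forall f g v, Cc f -> Cc g -> pi (conv f g) v = pi f (pi g v);
  rep_star : forall f v w, Cc f ->
    hdot H (pi (star f) v) w = hdot H v (pi f w);
  rep_normI : exists M : R, forall f, Cc f ->
    (opnorm (pi f) <= M%:E * normI f)%E }.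

Definition norm_max f : \bar R :=
  ereal_sup [set z | exists (H : hilbert R) (pi : (G -> CC R) -> {linear H -> H}),
                       is_representation pi /\ z = opnorm (pi f)].

(* mu_u, the image of mu^u under inversion *)
Definition haar_inv u : set (borel u) -> \bar R :=
  pushforward (haar u) (inv : borel u -> borel u).

Definition l2norm u xi : \bar R :=
  ((\int[@haar_inv u]_(x in sfiber u) ((nrm (xi x)) ^+ 2)%:E) `^ 2^-1)%E.

(* The elements of L^2(G_u, mu_u) are represented by functions on G, whose
   values outside G_u are irrelevant. *)
Definition L2 u : set (G -> CC R) :=
  [set xi | [/\ measurable_fun (sfiber u : set (borel u))
                  (fun x : borel u => complex.Re (xi x)),
                measurable_fun (sfiber u : set (borel u))
                  (fun x : borel u => complex.Im (xi x))
              & (l2norm u xi < +oo)%E]].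

Definition Ind u f xi : G -> CC R := fun x =>
  cintegral (haar u) (rfiber u)
    (fun y : G => f (mul x y) * xi (inv y) * twist (mul x y) (inv y)).

Definition Ind_norm u f : \bar R :=
  ereal_sup [set l2norm u (Ind u f xi) | xi in [set xi | L2 u xi /\
                                                  (l2norm u xi <= 1)%E]].

Definition norm_red f : \bar R :=
  ereal_sup (0%E |` [set Ind_norm u f | u in @units G]).

(* The involution of the C*-algebra completion for norm_red is the one for which
   the Ind u are *-preserving. A cocycle is not required to be normalised, and
   the adjoint of Ind u f is Ind u (star_red f) : star_red f is star f if
   twist u u = 1 for every unit u (star_redE), but in general Ind u (star f) is
   the adjoint of Ind u f followed by multiplication by
   x |-> twist (rng x) (rng x). *)
Definition star_red f : G -> CC R := fun x =>
  ((twist (rng x) (rng x) : R[i])^*)%C * star f x.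

Lemma star_redE f : (forall u, units u -> twist u u = 1 :> CC R) ->
  star_red f = star f.
Proof.
move=> t1; apply/funext => x; rewrite /star_red t1 ?conjc1 ?mul1r//.
by rewrite /units /= rng_rng.
Qed.

(* Only the values of j on C_c(G) matter. *)
Record is_completion (N : (G -> CC R) -> \bar R)
    (adj : (G -> CC R) -> (G -> CC R)) (A : cstar_algebra R)
    (j : (G -> CC R) -> A) : Prop := IsCompletion {
  compl_linear : forall (a : R[i]) f g, Cc f -> Cc g ->
    j (a *: f + g) = a *: j f + j g;
  compl_conv : forall f g, Cc f -> Cc g ->
    Cc (conv f g) /\ j (conv f g) = cmul (j f) (j g);
  compl_adj : forall f, Cc f -> Cc (adj f) /\ j (adj f) = cadj (j f);
  compl_norm : forall f, Cc f -> (nrm (j f))%:E = N f;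
  compl_dense : dense (j @` @Cc R G) }.

End Algebra.

(* A partial morphism (phi, K) is encoded by the map p : G -> option H equal to
   Some (phi x) on K and to None outside K. *)
Section PartialMaps.
Variables (G H : Type) (p : G -> option H).
Definition pdom : set G := [set x | exists y, p x = Some y].
Definition ppreimage (B : set H) : set G := [set x | exists2 y, p x = Some y & B y].
End PartialMaps.

Definition open_subgroupoid (G : topgroupoid) (K : set G) : Prop :=
  [/\ open K,
      forall x, K x -> K (inv x)
    & forall x y, K x -> K y -> src x = rng y -> K (mul x y)].

Record is_partial_morphism (R : realType) (G H : twisted_groupoid R)
    (p : G -> option H) : Prop := IsPartialMorphism {
  pmor_dom : open_subgroupoid (pdom p);
  pmor_inv : forall x x', p x = Some x' -> p (inv x) = Some (inv x');
  pmor_mul : forall x y x' y', p x = Some x' -> p y = Some y' ->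
    src x = rng y -> src x' = rng y' /\ p (mul x y) = Some (mul x' y');
  (* continuity on the open set K *)
  pmor_continuous : forall V, open V -> open (ppreimage p V);
  pmor_proper : forall D, compact D -> compact (ppreimage p D);
  (* the image of the restriction of mu^u to K is nu^phi(u) *)
  pmor_haar : forall u v, units u -> p u = Some v ->
    forall B, borel_set B -> haar u (ppreimage p B) = haar v B;
  pmor_twist : forall x y x' y', p x = Some x' -> p y = Some y' ->
    src x = rng y -> twist x y = twist x' y' }.

Record partial_morphism (R : realType) (G H : twisted_groupoid R) :=
  PartialMorphism {
    pmor_fun :> G -> option H;
    pmorP : is_partial_morphism pmor_fun }.

Definition induced (R : realType) (G H : twisted_groupoid R)
    (p : partial_morphism G H) (f : H -> CC R) : G -> CC R :=
  fun x => if p x is Some y then f y else 0.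

Section TwistedGroupoidCategory.
Variable R : realType.
Implicit Types G H K L : twisted_groupoid R.

Lemma partial_morphism_eq G H (p q : partial_morphism G H) : p =1 q -> p = q.
Proof.
case: p q => [p pP] [q qP] /= /funext pq; subst q.
by congr PartialMorphism; exact: Prop_irrelevance.
Qed.

Lemma ppreimage_Some (T : Type) (B : set T) : ppreimage Some B = B.
Proof. by apply/seteqP; split=> [x [y [->]]|x Bx] //; exists x. Qed.

Lemma ppreimage_obind (T U V : Type) (p : T -> option U) (q : U -> option V) B :
  ppreimage (fun x => obind q (p x)) B = ppreimage p (ppreimage q B).
Proof.
apply/seteqP; split=> x.
- by case=> z /=; case E : (p x) => [y|] //= qy Bz; exists y => //; exists z.
- by case=> y /= py [z qz Bz]; exists z => //=; rewrite py.
Qed.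

Lemma pdomE (T U : Type) (p : T -> option U) : pdom p = ppreimage p setT.
Proof. by apply/seteqP; split=> x [y py]; exists y. Qed.

Lemma pid_subproof G : is_partial_morphism (@Some G).
Proof.
split.
- by rewrite pdomE ppreimage_Some; split => //; exact: openT.
- by move=> x _ [<-].
- by move=> x y _ _ [<-] [<-].
- by move=> V; rewrite ppreimage_Some.
- by move=> V; rewrite ppreimage_Some.
- by move=> u _ _ [<-] B _; rewrite ppreimage_Some.
- by move=> x y _ _ [<-] [<-].
Qed.

Lemma pmor_units G H (p : partial_morphism G H) u v :
  units u -> p u = Some v -> units v.
Proof.
case: p => /= p [_ pinv pmul _ _ _ _] uu pu.
have su : src u = u by rewrite -uu src_rng.
have [|e] := pmul _ _ _ _ pu (pinv _ _ pu); first by rewrite rng_inv.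
by rewrite mul_inv uu pu mul_inv => -[/esym].
Qed.

Lemma borel_ppreimage G H (p : partial_morphism G H) B :
  borel_set B -> borel_set (ppreimage p B).
Proof.
case: p => /= p [[dom_open _ _] _ _ p_open _ _ _] mB.
have oo (U : set G) : open U -> borel_set U by exact: sub_sigma_algebra.
suff: <<s open >> `<=` [set B | borel_set (ppreimage p B)] by exact.
apply: smallest_sub; last by move=> V oV; apply: oo; exact: p_open.
split.
- rewrite /= (_ : ppreimage _ _ = set0); first exact: sigma_algebra0.
  by apply/seteqP; split=> // x [].
- move=> D /= mD.
  rewrite (_ : ppreimage _ _ = ~` (~` pdom p `|` ppreimage p D)); last first.
    apply/seteqP; split=> [x [y py [_ nDy]] [[]|[z]]|x /not_orP[/contrapT[y py] nD]].
    + by exists y.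
    + by rewrite py => -[<-].
    + by exists y => //; split=> // Dy; apply: nD; exists y.
  rewrite -setTD; apply: sigma_algebraCD.
  rewrite -bigcup2E; apply: sigma_algebra_bigcup => -[|[|n]] //=.
  + rewrite -setTD; apply: sigma_algebraCD; exact: oo.
  + exact: sigma_algebra0.
- move=> F /= mF; rewrite (_ : ppreimage _ _ = \bigcup_n ppreimage p (F n)).
    exact: sigma_algebra_bigcup.
  apply/seteqP; split=> x.
  + by case=> y py [n _ Fny]; exists n => //; exists y.
  + by case=> n _ [y py Fny]; exists y => //; exists n.
Qed.

Lemma pcomp_subproof G H K (q : partial_morphism H K) (p : partial_morphism G H) :
  is_partial_morphism (fun x => obind q (p x)).
Proof.
have pU := @pmor_units _ _ p; have qB := @borel_ppreimage _ _ q.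
case: p pU => p [[pd1 pd2 pd3] p1 p2 p3 p4 p5 p6] /= pU.
case: q qB => q [[qd1 qd2 qd3] q1 q2 q3 q4 q5 q6] /= qB.
have ob x z : obind q (p x) = Some z -> exists2 y, p x = Some y & q y = Some z.
  by case: (p x) => [y|] //=; exists y.
have i2 x x' : obind q (p x) = Some x' -> obind q (p (inv x)) = Some (inv x').
  by move=> /ob[y py qy]; rewrite (p1 _ _ py) /= (q1 _ _ qy).
have m2 x y x' y' : obind q (p x) = Some x' -> obind q (p y) = Some y' ->
    src x = rng y -> src x' = rng y' /\ obind q (p (mul x y)) = Some (mul x' y').
  move=> /ob[x1 px qx] /ob[y1 py qy] xy.
  have [xy1 ->] := p2 _ _ _ _ px py xy.
  exact: q2.
split.
- split.
  + by rewrite pdomE ppreimage_obind; apply: p3; apply: q3; exact: openT.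
  + by move=> x [x' /i2 ?]; exists (inv x').
  + by move=> x y [x' xx'] [y' yy'] /(m2 _ _ _ _ xx' yy')[_ ?]; exists (mul x' y').
- exact: i2.
- exact: m2.
- by move=> V oV; rewrite ppreimage_obind; apply: p3; exact: q3.
- by move=> V oV; rewrite ppreimage_obind; apply: p4; exact: q4.
- move=> u w uu /ob[v pv qv] B mB; rewrite ppreimage_obind.
  by rewrite (p5 _ _ uu pv) ?(q5 _ _ (pU _ _ uu pv) qv)//; exact: qB.
- move=> x y x' y' /ob[x1 px qx] /ob[y1 py qy] xy.
  rewrite (p6 _ _ _ _ px py xy) (q6 _ _ _ _ qx qy)//.
  by have [] := p2 _ _ _ _ px py xy.
Qed.

Definition pid G : partial_morphism G G := PartialMorphism (@pid_subproof G).

Definition pcomp G H K (q : partial_morphism H K) (p : partial_morphism G H) :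
  partial_morphism G K := PartialMorphism (pcomp_subproof q p).

Lemma pcomp_id G H (p : partial_morphism G H) : pcomp p (pid G) = p.
Proof. exact: partial_morphism_eq. Qed.

Lemma id_pcomp G H (p : partial_morphism G H) : pcomp (pid H) p = p.
Proof. by apply: partial_morphism_eq => x /=; case: (p x). Qed.

Lemma pcompA G H K L (r : partial_morphism K L) (q : partial_morphism H K)
  (p : partial_morphism G H) : pcomp r (pcomp q p) = pcomp (pcomp r q) p.
Proof. by apply: partial_morphism_eq => x /=; case: (p x). Qed.

Definition Gsigma : category := @Category (twisted_groupoid R)
  (@partial_morphism R) pid pcomp pcomp_id id_pcomp pcompA.

End TwistedGroupoidCategory.

Section ComplexNorm.
Variable R : realType.

Lemma nrmE (V : normedModType R[i]) (x : V) : `|x| = (nrm x)%:C.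
Proof.
rewrite /nrm; have := normr_ge0 x; case: `|x| => a b /=.
by rewrite lecE /= => /andP[/eqP -> _].
Qed.

Lemma nrm_ge0 (V : normedModType R[i]) (x : V) : 0 <= nrm x.
Proof. by have := normr_ge0 x; rewrite nrmE lecR. Qed.

Lemma pos_complexE (e : R[i]) : 0 < e -> 0 < complex.Re e /\ e = (complex.Re e)%:C.
Proof. by case: e => a b; rewrite ltcE /= => /andP[/eqP -> ?]. Qed.

Lemma nrmD (V : normedModType R[i]) (x y : V) : nrm (x + y) <= nrm x + nrm y.
Proof. by have := ler_normD x y; rewrite !nrmE -rmorphD lecR. Qed.

Lemma nrmZ (V : normedModType R[i]) a (x : V) :
  nrm (a *: x) = nrm (a : CC R) * nrm x.
Proof. by apply: complexI; rewrite rmorphM /= -!nrmE normrZ. Qed.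

Lemma nrmN (V : normedModType R[i]) (x : V) : nrm (- x) = nrm x.
Proof. by apply: complexI; rewrite -!nrmE normrN. Qed.

Lemma nrmB (V : normedModType R[i]) (x y : V) : nrm (x - y) = nrm (y - x).
Proof. by rewrite -nrmN opprB. Qed.

Lemma nrm_Re (z : CC R) : `|complex.Re z| <= nrm z.
Proof.
case: z => a b; rewrite /nrm normc_def /= -sqrtr_sqr ler_wsqrtr//.
by rewrite lerDl sqr_ge0.
Qed.

Lemma nrm_Im (z : CC R) : `|complex.Im z| <= nrm z.
Proof.
case: z => a b; rewrite /nrm normc_def /= -sqrtr_sqr ler_wsqrtr//.
by rewrite lerDr sqr_ge0.
Qed.

Lemma nrm_le_ReIm (z : CC R) : nrm z <= `|complex.Re z| + `|complex.Im z|.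
Proof.
have nE (t : CC R) : nrm t = Num.sqrt (complex.Re t ^+ 2 + complex.Im t ^+ 2).
  by case: t => a b; rewrite /nrm normc_def.
case: z => a b; rewrite nE /= -[leRHS]ger0_norm ?addr_ge0// -sqrtr_sqr.
rewrite ler_wsqrtr// sqrrD !real_normK ?num_real//.
by rewrite -addrA lerD2l lerDr addr_ge0// mulrn_wge0// mulr_ge0.
Qed.

Lemma cvg_nrmP (V : normedModType R[i]) T (F : set_system T) {FF : Filter F}
  (f : T -> V) (y : V) :
  f @ F --> y <-> forall e : R, 0 < e -> \forall x \near F, nrm (y - f x) < e.
Proof.
split => [/cvgrPdist_lt fy e e0|fy]; last apply/cvgrPdist_lt => e.
- have e0' : (0 : R[i]) < e%:C by rewrite ltcR.
  by move: (fy _ e0'); apply: filterS => x; rewrite nrmE ltcR.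
- move=> /pos_complexE[e0 ->]; move: (fy _ e0); apply: filterS => x.
  by rewrite nrmE ltcR.
Qed.

Lemma Re_continuous : continuous (fun z : CC R => complex.Re z : R).
Proof.
move=> z; apply/(@cvgrPdist_lt R R (CC R) _ (@nbhs_filter (CC R) z)) => e e0.
have := (@cvg_nrmP (CC R) (CC R) _ (@nbhs_filter (CC R) z) id z).1 cvg_id _ e0.
apply: filterS => w; apply: le_lt_trans.
by rewrite -raddfB; exact: nrm_Re.
Qed.

Lemma Im_continuous : continuous (fun z : CC R => complex.Im z : R).
Proof.
move=> z; apply/(@cvgrPdist_lt R R (CC R) _ (@nbhs_filter (CC R) z)) => e e0.
have := (@cvg_nrmP (CC R) (CC R) _ (@nbhs_filter (CC R) z) id z).1 cvg_id _ e0.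
apply: filterS => w; apply: le_lt_trans.
by rewrite -raddfB; exact: nrm_Im.
Qed.

End ComplexNorm.


Record lchspace := LCHSpace {
  pt :> topologicalType;
  pt_lc : locally_compact [set: pt];
  pt_hausdorff : hausdorff_space pt }.

Record proper_map (X Y : lchspace) := ProperMap {
  proper_fun :> X -> Y;
  proper_continuous : continuous proper_fun;
  proper_compact : forall D, compact D -> compact (proper_fun @^-1` D) }.

Section SpaceCategory.
Implicit Types X Y Z W : lchspace.

Lemma proper_map_eq X Y (f g : proper_map X Y) : f =1 g -> f = g.
Proof.
case: f g => [f f1 f2] [g g1 g2] /= /funext fg; subst g.
by congr ProperMap; exact: Prop_irrelevance.
Qed.

Definition proper_id X : proper_map X X :=
  @ProperMap X X id (fun x => @cvg_id _ (nbhs x)) (fun D cD => cD).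

Lemma proper_comp_continuous X Y Z (g : proper_map Y Z) (f : proper_map X Y) :
  continuous (g \o f).
Proof.
move=> x; apply: continuous_comp; first exact: proper_continuous.
exact: proper_continuous.
Qed.

Lemma proper_comp_compact X Y Z (g : proper_map Y Z) (f : proper_map X Y) D :
  compact D -> compact ((g \o f) @^-1` D).
Proof.
by move=> cD; rewrite comp_preimage; do 2!apply: proper_compact.
Qed.

Definition proper_comp X Y Z (g : proper_map Y Z) (f : proper_map X Y) :
  proper_map X Z :=
  ProperMap (@proper_comp_continuous _ _ _ g f) (@proper_comp_compact _ _ _ g f).

Lemma proper_comp_id X Y (f : proper_map X Y) : proper_comp f (proper_id X) = f.
Proof. exact: proper_map_eq. Qed.

Lemma proper_id_comp X Y (f : proper_map X Y) : proper_comp (proper_id Y) f = f.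
Proof. exact: proper_map_eq. Qed.

Lemma proper_compA X Y Z W (h : proper_map Z W) (g : proper_map Y Z)
  (f : proper_map X Y) :
  proper_comp h (proper_comp g f) = proper_comp (proper_comp h g) f.
Proof. exact: proper_map_eq. Qed.

Definition LCH : category := @Category lchspace proper_map
  proper_id proper_comp proper_comp_id proper_id_comp proper_compA.

End SpaceCategory.

Section SpaceGroupoid.
Variables (R : realType) (X : lchspace).

Lemma space_id_continuous : continuous (@id X).
Proof. by move=> x; exact: cvg_id. Qed.

Lemma space_mul_continuous : {within [set z : X * X | z.1 = z.2],
  continuous (fun z : X * X => z.1)}.
Proof. by apply: continuous_subspaceT => z; exact: cvg_fst. Qed.

Definition space_topgroupoid : topgroupoid :=
  @TopGroupoid X id id id (fun x _ => x)
    (fun _ => erefl) (fun _ => erefl) (fun _ => erefl) (fun _ => erefl)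
    (fun _ _ _ => erefl) (fun _ _ xy => xy) (fun _ _ _ _ _ => erefl)
    (fun _ => erefl) (fun _ => erefl) (fun _ => erefl) (fun _ => erefl)
    (fun _ => erefl) (fun _ => erefl)
    (@pt_lc X) (@pt_hausdorff X) space_id_continuous space_mul_continuous.

Definition point_mass (u : space_topgroupoid) : {measure set borel u -> \bar R} :=
  \d_(u : borel u).

Lemma open_measurable_borel (T : topologicalType) (u : T) (U : set T) :
  open U -> measurable (U : set (borel u)).
Proof. by move=> oU; exact: sub_sigma_algebra. Qed.

Lemma closed_measurable_borel (T : topologicalType) (u : T) (U : set T) :
  closed U -> measurable (U : set (borel u)).
Proof.
move=> cU; rewrite -[U]setCK; apply: (@measurableC _ (borel u)).
by apply: open_measurable_borel; rewrite openC.
Qed.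

Lemma continuous_measurable_borel (T : topologicalType) (u : T) (f : T -> R) :
  continuous f -> measurable_fun [set: borel u] (f : borel u -> R).
Proof.
move=> /continuousP cf; apply: (measurability _ (RGenOpens.measurableE R)).
move=> _ [_ [a [b ->] <-]]; rewrite setTI.
by apply: open_measurable_borel; exact/cf/interval_open.
Qed.

Lemma Rintegral_point_mass (u : X) (D : set X) (f : X -> R) :
  D u -> closed D -> continuous f ->
  \int[point_mass u]_(x in D) (f : borel u -> R) x = f u.
Proof.
move=> Du cD cf; rewrite /Rintegral integral_dirac//=.
- by rewrite indicE mem_set// mul1r.
- exact: closed_measurable_borel.
- apply/measurable_EFinP; apply: (@measurable_funS _ _ (borel u) _ setT) => //.
  exact: continuous_measurable_borel.
Qed.

Lemma cintegral_point_mass (u : X) (D : set X) (f : X -> CC R) :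
  D u -> closed D -> continuous f -> cintegral (point_mass u) D f = f u.
Proof.
move=> Du cD cf; rewrite /cintegral !Rintegral_point_mass//.
- by case: (f u).
- by move=> x; apply: (continuous_comp (cf x)); exact: Im_continuous.
- by move=> x; apply: (continuous_comp (cf x)); exact: Re_continuous.
Qed.

Lemma closed_point (u : X) : closed [set u].
Proof. exact/accessible_closed_set1/hausdorff_accessible/pt_hausdorff. Qed.

Lemma point_massE (u : X) (B : set X) : point_mass u B = (\1_B u)%:E.
Proof. by []. Qed.

Lemma point_mass_radon (u : X) : is_radon (point_mass u).
Proof.
have mE := point_massE u.
split.
- by move=> K _; rewrite mE ltry.
- move=> B _; rewrite mE; apply/eqP; rewrite eq_le; apply/andP; split.
  + apply: le_ereal_inf_tmp => _ [U [_ BU] <-]; rewrite mE lee_fin !indicE.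
    have [/set_mem/BU/mem_set ->//|_] := boolP (u \in B).
    by rewrite ler0n.
  + apply: ereal_inf_lbound; have [Bu|nBu] := pselect (B u).
    * exists setT; first by split => //; exact: openT.
      by rewrite mE !indicE !mem_set.
    * exists (~` [set u]).
        split; first by rewrite openC; exact: closed_point.
        by move=> x Bx xu; apply: nBu; rewrite -xu.
      by rewrite mE !indicE !memNset// => /(_ erefl).
- move=> U _; rewrite mE; apply/eqP; rewrite eq_le; apply/andP; split.
  + apply: ereal_sup_ubound; have [Uu|nUu] := pselect (U u).
    * exists [set u]; first by split; [exact: compact_set1|move=> _ ->].
      by rewrite mE !indicE !mem_set.
    * exists set0; first by split; [exact: compact0|].
      by rewrite mE !indicE !memNset.
  + apply: ge_ereal_sup => _ [K [_ KU] <-]; rewrite mE lee_fin !indicE.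
    have [/set_mem/KU/mem_set ->//|_] := boolP (u \in K).
    by rewrite ler0n.
Qed.

Lemma point_mass_haar : is_haar_system point_mass.
Proof.
have fE f (u : X) : continuous f -> cintegral (point_mass u) setT f = f u.
  by move=> cf; rewrite cintegral_point_mass//; exact: closedT.
split.
- by move=> u _; exact: point_mass_radon.
- by move=> u _; rewrite point_massE indicE memNset// => /(_ erefl).
- move=> f [cf _]; apply: continuous_subspaceT.
  rewrite (_ : (fun u : X => _) = f); last by apply/funext => u; exact: fE.
  exact: cf.
- move=> f x [cf _]; cbn [rng src mul space_topgroupoid].
  transitivity (f x).
    by apply: (@cintegral_point_mass x setT f) => //; exact: closedT.
  symmetry; change (cintegral (point_mass x) [set x] (fun=> f x) = f x).
  have cx : continuous (fun _ : X => f x : CC R) by move=> y; exact: cvg_cst.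
  exact: (@cintegral_point_mass x [set x] _ erefl (@closed_point x) cx).
Qed.

Lemma trivial_cocycle :
  is_cocycle (fun _ _ : space_topgroupoid => 1 : CC R).
Proof.
by split=> // *; [rewrite normr1|apply: continuous_subspaceT => z; exact: cvg_cst].
Qed.

Definition space_groupoid : twisted_groupoid R := {|
  tgpd := space_topgroupoid;
  haar := point_mass;
  haarP := point_mass_haar;
  twist := fun _ _ => 1;
  twistP := trivial_cocycle |}.

End SpaceGroupoid.

Section SpaceFunctor.
Variable R : realType.

Lemma space_mor_subproof (X Y : lchspace) (f : proper_map X Y) :
  @is_partial_morphism R (space_groupoid R X) (space_groupoid R Y)
    (fun x => Some (f x)).
Proof.
have fE V : ppreimage (fun x => Some (f x)) V = f @^-1` V.
  by apply/seteqP; split=> x /=; [case=> _ [<-]|exists (f x)].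
split=> /=.
- by rewrite pdomE fE preimage_setT; split => //; exact: openT.
- by move=> x _ [<-].
- by move=> x y _ _ [<-] [<-] ->.
- by move=> V oV; rewrite fE; move/continuousP: (@proper_continuous _ _ f); exact.
- by move=> V oV; rewrite fE; exact: proper_compact.
- by move=> u _ _ [<-] B _; rewrite fE.
- by [].
Qed.

Definition space_mor (X Y : LCH) (f : hom X Y) :
  hom (space_groupoid R X : Gsigma R) (space_groupoid R Y) :=
  PartialMorphism (space_mor_subproof f).

Lemma space_mor_id (X : LCH) : space_mor (idm X) = idm (space_groupoid R X : Gsigma R).
Proof. exact: partial_morphism_eq. Qed.

Lemma space_mor_comp (X Y Z : LCH) (g : hom Y Z) (f : hom X Y) :
  space_mor (compm g f) = compm (space_mor g) (space_mor f).
Proof. exact: partial_morphism_eq. Qed.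

Definition space_functor : functor_on (space_groupoid R : LCH -> Gsigma R) :=
  @Functor LCH (Gsigma R) _ space_mor space_mor_id space_mor_comp.

End SpaceFunctor.

Record C0fun (R : realType) (X : topologicalType) := C0Fun {
  C0val :> X -> CC R;
  C0P : @C0 R X C0val }.

Section C0Closed.
Variables (R : realType) (X : topologicalType).
Implicit Types (f g : X -> CC R).

Lemma nrm_continuous : continuous (fun z : CC R => nrm z : R).
Proof.
move=> z; apply: (continuous_comp (@norm_continuous _ (CC R) z)).
exact: Re_continuous.
Qed.

Lemma nrmM (a b : CC R) : nrm (a * b) = nrm a * nrm b.
Proof. exact: nrmZ. Qed.

Lemma nrm_conj (a : R[i]) : nrm (a^*%C : CC R) = nrm (a : CC R).
Proof. by case: a => a b; rewrite /nrm !normc_def /= sqrrN. Qed.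

Lemma conj_continuous : continuous (fun z : CC R => z^*%C : CC R).
Proof.
move=> z; apply/(@cvg_nrmP R (CC R) (CC R) _ (@nbhs_filter (CC R) z)) => e e0.
have := (@cvg_nrmP R (CC R) (CC R) _ (@nbhs_filter (CC R) z) id z).1 cvg_id _ e0.
by apply: filterS => w; rewrite -rmorphB nrm_conj.
Qed.

Lemma C0_intro f : continuous f ->
  (forall e : R, 0 < e ->
     exists2 K, compact K & forall x, ~ K x -> nrm (f x) < e) -> C0 f.
Proof.
move=> cf vf; split=> // e e0; have [K cK Kf] := vf e e0.
apply: (subclosed_compact _ cK).
- have cnf : continuous (fun x => nrm (f x)).
    by move=> x; apply: (continuous_comp (cf x)); exact: nrm_continuous.
  by apply: (closed_comp _ (@closed_ge R e)) => x _; exact: cnf.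
- by move=> x /= ex; apply: contrapT => /Kf; rewrite ltNge ex.
Qed.

Lemma C0_out f e : C0 f -> 0 < e ->
  exists2 K, compact K & forall x, ~ K x -> nrm (f x) < e.
Proof.
case=> cf vf e0; exists [set x | e <= nrm (f x)]; first exact: vf.
by move=> x /= /negP; rewrite -ltNge.
Qed.

Lemma C0_0 : C0 (fun _ : X => 0 : CC R).
Proof.
apply: C0_intro; first by move=> x; exact: cvg_cst.
by move=> e e0; exists set0; [exact: compact0|move=> x _; rewrite /nrm normr0].
Qed.

Lemma C0_D f g : C0 f -> C0 g -> C0 (fun x => f x + g x).
Proof.
move=> f0 g0; apply: C0_intro.
  by move=> x; apply: cvgD; [exact: f0.1|exact: g0.1].
move=> e e0; have e2 : 0 < e / 2 by rewrite divr_gt0.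
have [K cK Kf] := C0_out f0 e2; have [L cL Lg] := C0_out g0 e2.
exists (K `|` L); first exact: compactU.
move=> x /not_orP[/Kf fx /Lg gx]; apply: le_lt_trans (nrmD _ _) _.
by rewrite (splitr e) ltrD.
Qed.

Lemma C0_Z (a : CC R) f : C0 f -> C0 (fun x => a * f x).
Proof.
move=> f0; apply: C0_intro.
  by move=> x; apply: cvgM; [exact: cvg_cst|exact: f0.1].
move=> e e0; have a1 : 0 < nrm a + 1 by rewrite ltr_wpDl// nrm_ge0.
have [K cK Kf] := C0_out f0 (divr_gt0 e0 a1).
exists K => // x /Kf; rewrite ltr_pdivlMr// nrmM mulrC; apply: le_lt_trans.
by rewrite ler_wpM2r ?nrm_ge0// lerDl.
Qed.

Lemma C0_N f : C0 f -> C0 (fun x => - f x).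
Proof.
move=> f0; rewrite (_ : (fun x => - f x) = (fun x => -1 * f x)); first exact: C0_Z.
by apply/funext => x; rewrite mulN1r.
Qed.

Lemma C0_M f g : C0 f -> C0 g -> C0 (fun x => f x * g x).
Proof.
move=> f0 g0; apply: C0_intro.
  by move=> x; apply: cvgM; [exact: f0.1|exact: g0.1].
move=> e e0.
have [K cK Kf] := C0_out f0 e0; have [L cL Lg] := C0_out g0 (@ltr01 R).
exists (K `|` L); first exact: compactU.
move=> x /not_orP[/Kf fx /Lg gx]; rewrite nrmM; apply: le_lt_trans fx.
by rewrite -[leRHS]mulr1 ler_wpM2l ?nrm_ge0// ltW.
Qed.

Lemma C0_conj f : C0 f -> C0 (fun x => (f x)^*%C : CC R).
Proof.
move=> f0; apply: C0_intro.
  by move=> x; apply: (continuous_comp (f0.1 x)); exact: conj_continuous.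
move=> e e0; have [K cK Kf] := C0_out f0 e0.
by exists K => // x /Kf; rewrite nrm_conj.
Qed.

Lemma C0_bounded f : C0 f -> exists2 M : R, 0 <= M & forall x, nrm (f x) <= M.
Proof.
move=> [cf vf]; have cK := vf 1 ltr01.
have cnf : continuous (fun x => nrm (f x)).
  by move=> x; apply: (continuous_comp (cf x)); exact: nrm_continuous.
have /compact_bounded[M [_ MK]] := continuous_compact (continuous_subspaceT cnf) cK.
have M1 : M < `|M| + 1 by rewrite (le_lt_trans (ler_norm _))// ltrDl.
exists (`|M| + 1); first by rewrite addr_ge0.
move=> x; have [fx|/ltW fx] := lerP 1 (nrm (f x)).
  apply: le_trans (ler_norm _) _; apply: (MK _ M1).
  by exists x.
by apply: le_trans fx _; rewrite lerDr.
Qed.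

Lemma C0_comp (Y : topologicalType) (h : Y -> X) f : continuous h ->
  (forall D, compact D -> compact (h @^-1` D)) -> C0 f -> C0 (f \o h).
Proof.
move=> ch ph [cf vf]; split.
  by move=> x; apply: continuous_comp; [exact: ch|exact: cf].
by move=> e e0; exact: (ph _ (vf e e0)).
Qed.

End C0Closed.

HB.instance Definition _ (R : realType) (X : topologicalType) :=
  gen_eqMixin (C0fun R X).
HB.instance Definition _ (R : realType) (X : topologicalType) :=
  gen_choiceMixin (C0fun R X).

Section C0Module.
Variables (R : realType) (X : topologicalType).
Implicit Types (f g h : C0fun R X).

Lemma C0fun_eq f g : f =1 g -> f = g.
Proof.
case: f g => [f f0] [g g0] /= /funext fg; subst g.
by congr C0Fun; exact: Prop_irrelevance.
Qed.

Definition C0zero : C0fun R X := C0Fun (@C0_0 R X).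
Definition C0add f g : C0fun R X := C0Fun (C0_D (C0P f) (C0P g)).
Definition C0scale (a : R[i]) f : C0fun R X := C0Fun (C0_Z a (C0P f)).
Definition C0opp f : C0fun R X := C0Fun (C0_N (C0P f)).
Definition C0mul f g : C0fun R X := C0Fun (C0_M (C0P f) (C0P g)).
Definition C0adj f : C0fun R X := C0Fun (C0_conj (C0P f)).

Lemma C0addA : associative C0add.
Proof. by move=> f g h; apply: C0fun_eq => x /=; rewrite addrA. Qed.
Lemma C0addC : commutative C0add.
Proof. by move=> f g; apply: C0fun_eq => x /=; rewrite addrC. Qed.
Lemma C0add0 : left_id C0zero C0add.
Proof. by move=> f; apply: C0fun_eq => x /=; rewrite add0r. Qed.
Lemma C0addN : left_inverse C0zero C0opp C0add.
Proof. by move=> f; apply: C0fun_eq => x /=; rewrite addNr. Qed.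

HB.instance Definition _ :=
  GRing.isZmodule.Build (C0fun R X) C0addA C0addC C0add0 C0addN.

Lemma C0scaleA a b f : C0scale a (C0scale b f) = C0scale (a * b) f.
Proof. by apply: C0fun_eq => x /=; rewrite mulrA. Qed.
Lemma C0scale1 : left_id 1 C0scale.
Proof. by move=> f; apply: C0fun_eq => x /=; rewrite mul1r. Qed.
Lemma C0scaleDr : right_distributive C0scale +%R.
Proof. by move=> a f g; apply: C0fun_eq => x /=; rewrite mulrDr. Qed.
Lemma C0scaleDl f : {morph C0scale^~ f : a b / a + b}.
Proof. by move=> a b; apply: C0fun_eq => x /=; rewrite mulrDl. Qed.

HB.instance Definition _ := GRing.Zmodule_isLmodule.Build R[i] (C0fun R X)
  C0scaleA C0scale1 C0scaleDr C0scaleDl.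

Definition supnorm f : R := sup [set nrm (f x) | x in [set: X]].

Lemma supnorm_ub f x : nrm (f x) <= supnorm f.
Proof.
apply: ub_le_sup; last by exists x.
by have [M _ fM] := C0_bounded (C0P f); exists M => _ [y _ <-].
Qed.

Lemma supnorm_le f M : 0 <= M -> (forall x, nrm (f x) <= M) -> supnorm f <= M.
Proof.
move=> M0 fM; have [[x _]|X0] := pselect (exists x : X, True).
  apply: ge_sup; first by exists (nrm (f x)), x.
  by move=> _ [y _ <-].
rewrite /supnorm (_ : [set _ | _ in _] = set0) ?sup0//.
by apply/seteqP; split=> // r [x _ _]; apply: X0; exists x.
Qed.

Lemma supnorm_ge0 f : 0 <= supnorm f.
Proof.
have [[x _]|X0] := pselect (exists x : X, True).
  exact: le_trans (nrm_ge0 (f x)) (supnorm_ub f x).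
rewrite /supnorm (_ : [set _ | _ in _] = set0) ?sup0//.
by apply/seteqP; split=> // r [x _ _]; apply: X0; exists x.
Qed.

Lemma supnormD f g : supnorm (f + g) <= supnorm f + supnorm g.
Proof.
apply: supnorm_le; first by rewrite addr_ge0// supnorm_ge0.
by move=> x; apply: le_trans (nrmD _ _) _; rewrite lerD// supnorm_ub.
Qed.

Lemma supnormZ (a : CC R) f : supnorm (a *: f) = nrm a * supnorm f.
Proof.
have le b h : supnorm (b *: h) <= nrm (b : CC R) * supnorm h.
  apply: supnorm_le; first by rewrite mulr_ge0 ?nrm_ge0 ?supnorm_ge0.
  by move=> x; rewrite nrmM ler_wpM2l ?nrm_ge0// supnorm_ub.
apply/eqP; rewrite eq_le le /=; have [->|a0] := eqVneq a 0.
  by rewrite /nrm normr0 mul0r supnorm_ge0.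
have -> : supnorm f = supnorm (a^-1 *: (a *: f)) by rewrite scalerA mulVf// scale1r.
apply: le_trans (ler_wpM2l (nrm_ge0 _) (le _ _)) _.
by rewrite mulrA -nrmM divff// {1}/nrm normr1 mul1r.
Qed.

Definition C0norm f : R[i] := (supnorm f)%:C.

Lemma C0normD f g : C0norm (f + g) <= C0norm f + C0norm g.
Proof. by rewrite /C0norm -rmorphD lecR supnormD. Qed.

Lemma C0normZ (a : R[i]) f : C0norm (a *: f) = `|a| * C0norm f.
Proof. by rewrite /C0norm supnormZ rmorphM /= -(nrmE (a : CC R)). Qed.

Lemma C0norm_eq0 f : C0norm f = 0 -> f = 0.
Proof.
move=> /complexI f0; apply: C0fun_eq => x; apply: (@normr0_eq0 _ (CC R)).
rewrite nrmE; congr (_%:C); apply/eqP; rewrite eq_le nrm_ge0 andbT -f0.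
exact: supnorm_ub.
Qed.

HB.instance Definition _ := Lmodule_isNormed.Build R[i] (C0fun R X)
  C0normD C0normZ C0norm_eq0.

Lemma C0nrmE f : nrm f = supnorm f. Proof. by []. Qed.

End C0Module.

Section C0Complete.
Variables (R : realType) (X : topologicalType).

Lemma C0_complete (F : set_system (C0fun R X)) :
  ProperFilter F -> cauchy F -> cvg F.
Proof.
move=> FF Fc.
have Fex (e : R) : 0 < e -> exists f0, F [set f | supnorm (f0 - f) < e].
  move=> e0; have e0' : (0 : R[i]) < e%:C by rewrite ltcR.
  have [f0 Ff0] := (cauchyP F).1 Fc _ e0'.
  exists f0; move: Ff0; apply: filterS => f.
  by rewrite -ball_normE /= nrmE ltcR C0nrmE.
have lim_part (p : CC R -> R) :
    (forall z w, `|p z - p w| <= nrm (z - w)) ->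
    forall x, exists l : R, (fun f : C0fun R X => p (f x)) @ F --> l.
  move=> lip x; apply/(@cvg_ex R).
  apply/(@cauchy_cvgP R)/(@cauchyP R R) => e e0.
  have [f0 Ff0] := Fex e e0; exists (p (f0 x)); move: Ff0; apply: (@filterS _ F) => f /=.
  apply: le_lt_trans; apply: le_trans (lip _ _) _; exact: (supnorm_ub (f0 - f) x).
have /choice[re reP] := lim_part (fun z : CC R => complex.Re z)
  (fun z w => ltac:(by rewrite -raddfB; exact: nrm_Re)).
have /choice[im imP] := lim_part (fun z : CC R => complex.Im z)
  (fun z w => ltac:(by rewrite -raddfB; exact: nrm_Im)).
pose g x : CC R := re x +i* im x.
have gP x (e : R) : 0 < e -> F [set f : C0fun R X | nrm (g x - f x) < e].
  move=> e0; have e2 : 0 < e / 2 by rewrite divr_gt0.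
  have /cvgrPdist_lt/(_ _ e2) r := reP x; have /cvgrPdist_lt/(_ _ e2) i := imP x.
  apply: (@filterS2 _ F _ _ _ _ _ r i) => f {}r {}i /=; apply: le_lt_trans (nrm_le_ReIm _) _.
  by rewrite !raddfB (splitr e) ltrD.
have gU (e : R) : 0 < e -> exists f0 : C0fun R X,
    F [set f | supnorm (f0 - f) < e] /\ forall x, nrm (g x - f0 x) < e + e.
  move=> e0; have [f0 Ff0] := Fex e e0; exists f0; split=> // x.
  have [f [/= gf f0f]] := filter_ex (filterI (gP x e e0) Ff0).
  rewrite -(subrKA (f x)); apply: le_lt_trans (nrmD _ _) _; rewrite ltrD//.
  by rewrite nrmB; apply: le_lt_trans f0f; exact: (supnorm_ub (f0 - f) x).
have e30 (e : R) : 0 < e -> 0 < e / 6 by move=> e0; rewrite divr_gt0.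
have gC0 : C0 g.
  apply: C0_intro.
    move=> x; apply/(@cvg_nrmP R (CC R) X _ (nbhs_filter x)) => e e0.
    have [f0 [_ gf0]] := gU _ (e30 _ e0).
    have e60 := e30 _ e0.
    have := (@cvg_nrmP R (CC R) X _ (nbhs_filter x) f0 (f0 x)).1 ((C0P f0).1 x) _ e60.
    apply: filterS => y f0xy.
    have -> : g x - g y = (g x - f0 x) + (f0 x - f0 y) + (f0 y - g y).
      by rewrite !subrKA.
    apply: le_lt_trans (nrmD _ _) _; rewrite [nrm (_ - g y)]nrmB.
    have := nrmD (g x - f0 x) (f0 x - f0 y); have := gf0 x; have := gf0 y.
    lra.
  move=> e e0; have e60 := e30 _ e0; have [f0 [_ gf0]] := gU _ e60.
  have [K cK Kf] := C0_out (C0P f0) e60.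
  exists K => // x /Kf f0x; rewrite -(subrK (f0 x) (g x)).
  by apply: le_lt_trans (nrmD _ _) _; have := gf0 x; lra.
apply/cvg_ex; exists (C0Fun gC0); apply/cvg_nrmP => e e0.
have e60 := e30 _ e0; have [f0 [Ff0 gf0]] := gU _ e60.
move: Ff0; apply: filterS => f /= f0f; rewrite C0nrmE.
apply: (@le_lt_trans _ _ (e / 6 + e / 6 + e / 6)); last by lra.
apply: supnorm_le; first by lra.
move=> x /=; rewrite -[X in nrm X](subrKA (f0 x)).
apply: le_trans (nrmD _ _) _; rewrite lerD// ?ltW//.
by apply: le_lt_trans f0f; exact: (supnorm_ub (f0 - f) x).
Qed.

HB.instance Definition _ := Uniform_isComplete.Build (C0fun R X) C0_complete.

End C0Complete.

Section GelfandFunctor.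
Variable R : realType.

Section Object.
Variable X : topologicalType.
Implicit Types f g h : C0fun R X.

Lemma C0mulA f g h : C0mul f (C0mul g h) = C0mul (C0mul f g) h.
Proof. by apply: C0fun_eq => x /=; rewrite mulrA. Qed.
Lemma C0mulDl (a : R[i]) f g h :
  C0mul (a *: f + g) h = a *: C0mul f h + C0mul g h.
Proof. by apply: C0fun_eq => x /=; rewrite mulrDl mulrA. Qed.
Lemma C0mulDr (a : R[i]) f g h :
  C0mul h (a *: f + g) = a *: C0mul h f + C0mul h g.
Proof. by apply: C0fun_eq => x /=; rewrite mulrDr mulrCA. Qed.
Lemma C0adjD (a : R[i]) f g :
  C0adj (a *: f + g) = a^*%C *: C0adj f + C0adj g.
Proof. by apply: C0fun_eq => x /=; rewrite rmorphD rmorphM. Qed.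
Lemma C0adjM f g : C0adj (C0mul f g) = C0mul (C0adj g) (C0adj f).
Proof. by apply: C0fun_eq => x /=; rewrite rmorphM mulrC. Qed.
Lemma C0adjK f : C0adj (C0adj f) = f.
Proof. by apply: C0fun_eq => x /=; exact: conjcK. Qed.

Lemma C0norm_mul f g : `|C0mul f g| <= `|f| * `|g|.
Proof.
rewrite !nrmE -rmorphM lecR !C0nrmE; apply: supnorm_le.
  by rewrite mulr_ge0// supnorm_ge0.
by move=> x; rewrite nrmM ler_pM ?nrm_ge0// supnorm_ub.
Qed.

Lemma C0norm_adj f : `|C0mul (C0adj f) f| = `|f| ^+ 2.
Proof.
rewrite !nrmE -rmorphXn; congr (_%:C); rewrite !C0nrmE.
have E x : nrm (C0mul (C0adj f) f x) = nrm (f x) ^+ 2.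
  by rewrite nrmM nrm_conj expr2.
apply/eqP; rewrite eq_le; apply/andP; split.
  apply: supnorm_le; first exact: sqr_ge0.
  by move=> x; rewrite E ler_sqr ?nnegrE ?nrm_ge0 ?supnorm_ge0// supnorm_ub.
rewrite -[leRHS]sqr_sqrtr ?supnorm_ge0// ler_sqr ?nnegrE ?supnorm_ge0 ?sqrtr_ge0//.
apply: supnorm_le; first exact: sqrtr_ge0.
move=> x; rewrite -[leLHS]ger0_norm ?nrm_ge0// -sqrtr_sqr -E ler_wsqrtr//.
exact: supnorm_ub.
Qed.

Definition C0_algebra : cstar_algebra R := @CstarAlgebra R (C0fun R X)
  (@C0mul R X) (@C0adj R X) C0mulA C0mulDl C0mulDr C0adjD C0adjM C0adjK
  C0norm_mul C0norm_adj.

End Object.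

Definition C0_pullback (X Y : lchspace) (h : proper_map X Y) (f : C0fun R Y) :
  C0fun R X :=
  C0Fun (C0_comp (@proper_continuous _ _ h) (@proper_compact _ _ h) (C0P f)).

Lemma gelfand_subproof (X Y : lchspace) (h : proper_map X Y) :
  @is_star_morphism R (C0_algebra Y) (C0_algebra X) (C0_pullback h).
Proof. by split=> *; apply: C0fun_eq. Qed.

Definition gelfand_ob (X : LCH) : Cstar R := C0_algebra X.

Definition gelfand_mor (X Y : LCH) (h : hom X Y) :
  hom (gelfand_ob Y) (gelfand_ob X) := StarMorphism (gelfand_subproof h).

Lemma gelfand_id (X : LCH) : gelfand_mor (idm X) = idm (gelfand_ob X).
Proof. by apply: star_morphism_eq => f; exact: C0fun_eq. Qed.

Lemma gelfand_comp (X Y Z : LCH) (g : hom Y Z) (f : hom X Y) :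
  gelfand_mor (compm g f) = compm (gelfand_mor f) (gelfand_mor g).
Proof. by apply: star_morphism_eq => h; exact: C0fun_eq. Qed.

Definition gelfand : contrafunctor_on gelfand_ob :=
  Contrafunctor gelfand_id gelfand_comp.

End GelfandFunctor.

(* Completions are determined up to unique isomorphism: an association consists
   of a choice of completions together with the continuous extensions to them of
   the induced maps. *)
Record association (R : realType)
    (N : forall G : twisted_groupoid R, (G -> CC R) -> \bar R)
    (adj : forall G : twisted_groupoid R, (G -> CC R) -> (G -> CC R)) :=
  Association {
    assoc_ob : twisted_groupoid R -> cstar_algebra R;
    assoc_emb : forall G : twisted_groupoid R, (G -> CC R) -> assoc_ob G;
    assoc_completion : forall G : twisted_groupoid R,
      is_completion (@N G) (@adj G) (@assoc_emb G);
    assoc_map : forall G H : twisted_groupoid R,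
      partial_morphism G H -> assoc_ob H -> assoc_ob G;
    assoc_continuous : forall (G H : twisted_groupoid R)
      (p : partial_morphism G H), continuous (assoc_map p);
    assoc_induced : forall (G H : twisted_groupoid R)
      (p : partial_morphism G H) (f : H -> CC R), Cc f ->
      Cc (induced p f) /\
      assoc_map p (assoc_emb f) = assoc_emb (induced p f) }.

Arguments assoc_ob {R N adj} a G : rename.
Arguments assoc_emb {R N adj} a {G} f : rename.
Arguments assoc_map {R N adj} a {G H} p _ : rename.

Definition Gamma_max (R : realType) := association (@norm_max R) (@star R).
Definition Gamma_min (R : realType) := association (@norm_red R) (@star_red R).

(* The natural isomorphism is moreover required to be the identity on C_c(X). *)
Definition is_functor_extending_gelfand (R : realType)
    (N : forall G : twisted_groupoid R, (G -> CC R) -> \bar R)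
    (adj : forall G : twisted_groupoid R, (G -> CC R) -> (G -> CC R))
    (Gam : association N adj) : Prop :=
  exists F : @contrafunctor_on (Gsigma R) (Cstar R) (assoc_ob Gam),
    (forall (G H : Gsigma R) (p : hom G H) (a : assoc_ob Gam H),
       (cmap F p : star_morphism _ _) a = assoc_map Gam p a) /\
    exists theta : forall X : LCH,
        hom (assoc_ob Gam (space_groupoid R X) : Cstar R) (gelfand_ob R X),
      extends_along (space_functor R) F (gelfand R) theta /\
      forall (X : LCH) (f : X -> CC R), @Cc R X f -> forall x : X,
        ((theta X : star_morphism _ _) (@assoc_emb R N adj Gam (space_groupoid R X) f)
          : C0fun R X) x = f x.

(* Main.v *)
(* An L^1-bound suffices for a *-representation of C_c(G, sigma) to be contractive:
   by Cauchy-Schwarz |pi(f) v|^2 <= |pi(f^* f) v| |v|, and iterating this for the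
   powers (f^* f)^(2^n) bounds |pi(f)|^2 by the growth rate of their norms. The
   same argument applies to C_c(G) inside L^2(G_u), which is dense there, so that
   both C*-norms are finite C*-seminorms and the two completions exist.

   The map induced by a partial morphism p : G -> H is a *-homomorphism of
   convolution algebras: f(p(xy)) g(p(y^-1)) vanishes unless x lies in the domain
   of p, and for such x the Haar measures correspond. It decreases the maximal
   norm, since representations of C_c(G) pull back to C_c(H). For the reduced norm
   it need not be covered by a map of regular representations; but the operator
   of h^* h on L^2(G_u) is controlled by the supremum of |h^* h| over H, hence by
   the L^2 norms of h on the fibres of H, and for h = (f^* f)^(2^n) these grow at
   most like |f|_r^(2^(n+1)). So the growth rate argument applies again.

   Extensions to the completions, functoriality and naturality follow by density.
   For a space X both norms are the supremum norm, and C_c(X) is dense in C_0(X). *)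

From HB Require Import structures.
From mathcomp Require Import all_boot all_order all_algebra complex generic_quotient.
From mathcomp Require Import all_classical all_reals all_analysis measurable_realfun ring lra.
Require Import Defs.

Set Implicit Arguments.
Unset Strict Implicit.
Unset Printing Implicit Defensive.

Import Order.TTheory GRing.Theory Num.Theory.
Import numFieldNormedType.Exports.

Local Open Scope classical_set_scope.
Local Open Scope ring_scope.
Local Open Scope complex_scope.

(** * Compactly supported functions and integrals *)

(** The algebra lives on fibres. [mul x y] is meaningful only for [y] over [src x], so translates
    and kernels are continuous on fibres and not on [G], whereas the Haar axioms speak of C_c(G).
    The bridge is an extension theorem from compact sets, obtained in the one-point
    compactification. Haar measures are Radon but possibly not sigma-finite, so Fubini's theorem is
    established directly, for continuous kernels with compact support.

    A cocycle need not be normalised. Then [star] fails to be an involution, and the algebraic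
    identities hold only modulo vectors of seminorm zero; completions are therefore formed from
    seminormed algebras, one quotient performing separation and completion at once. The value of the
    cocycle at a unit is the defect that [star_red] corrects.

    The norm of Ind(delta_u) is a supremum over all square-integrable functions, while convolution
    is controlled on C_c(G) only. Regularity of Radon measures supplies approximating sequences,
    along which Ind converges pointwise, and this is enough to recover the norm from C_c(G). *)

Section LocallyCompact.
Variables (R : realType) (X : topologicalType).
Hypothesis (lcX : locally_compact [set: X]) (hX : hausdorff_space X).
Local Notation opc := (one_point_compactification X).

Let opc_hausdorff : hausdorff_space opc.
Proof. exact: one_point_compactification_hausdorff. Qed.

Let opc_normal : normal_space opc.
Proof.
apply: compact_normal; first exact: opc_hausdorff.
exact: one_point_compactification_compact.
Qed.

Let Some_compact (K : set X) : compact K -> closed ((Some : X -> opc) @` K).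
Proof.
move=> cK; apply: (compact_closed opc_hausdorff).
apply: continuous_compact => //; apply: continuous_subspaceT.
exact: one_point_compactification_some_continuous.
Qed.

(** Cluster points exist in the compactification, and the closed set [D] does not contain the point
    at infinity. *)
Let preimage_Some_compact (D : set opc) : closed D -> ~ D None ->
  compact ((Some : X -> opc) @^-1` D).
Proof.
move=> cD DN F FF FD.
have cpD : compact D.
  apply: (subclosed_compact cD (@one_point_compactification_compact X)) => //.
have [|[x|] [Dx cx]] := cpD ((Some : X -> opc) @ F) (fmap_proper_filter _ FF).
- exact: FD.
- exists x; split => // U V FU Vx.
  have [||z [[y Uy <-] [y' Vy' [yy']]]] := cx (Some @` U) (Some @` V).
  + by apply: (@filterS _ F _ U) => [y Uy|]; [exists y|].
  + exact: one_point_compactification_some_nbhs.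
  + by exists y; split => //; rewrite -yy'.
- by [].
Qed.

(** Tietze's theorem in the one-point compactification, which is compact Hausdorff and so normal;
    the image of a compact set is closed there. *)
Lemma compact_extension (K : set X) (f : X -> R) : compact K ->
  {within K, continuous f} ->
  exists2 g : X -> R, continuous g & forall x, K x -> g x = f x.
Proof.
move=> cK cf; pose f' (o : opc) : R := if o is Some x then f x else 0.
have cf' : {within (Some : X -> opc) @` K, continuous f'}.
  apply/subspace_continuousP => _ [x Kx <-] /=.
  move/subspace_continuousP : cf => /(_ x Kx) cf U Ux.
  have := cf U Ux; rewrite /nbhs /= /within /=.
  rewrite /nbhs /= /within /= => H.
  apply: filterS H => y H [z Kz [zy]]; apply: H; by rewrite -zy.
have [M [_ fM]] := compact_bounded (continuous_compact cf cK).
(* The bound has to exceed [M] strictly for [fM], and to be positive for the extension theorem. *)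
have M1 : M < `|M| + 1 by rewrite (le_lt_trans (ler_norm _))// ltrDl.
have [|x [y Ky <-]|g [fg cg _]] := continuous_bounded_extension opc_normal (Some_compact cK)
   (M := `|M| + 1) _ cf'.
- by rewrite ltr_wpDl.
- by apply: (fM _ M1); exists y.
exists (fun x => g (Some x)).
  move=> x; apply: (@continuous_comp _ _ _ (Some : X -> opc) g); last exact: cg.
  exact: one_point_compactification_some_continuous.
by move=> x Kx; rewrite -fg//; apply/mem_set; exists x.
Qed.

(** Urysohn's function separates [K] from the complement of an open [W] contained in [V], where the
    closure of [V] already lies in [U]. So the whole support stays in [U], and it is compact because
    the closure of [V] misses the point at infinity. *)
Lemma compact_cutoff (K U : set X) : compact K -> open U -> K `<=` U ->
  exists k : X -> R, [/\ continuous k, forall x, 0 <= k x <= 1,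
    forall x, K x -> k x = 1, compact (closure [set x | k x != 0])
    & closure [set x | k x != 0] `<=` U].
Proof.
move=> cK oU KU.
have cA := Some_compact cK.
have oU' : open ((Some : X -> opc) @` U) by apply/one_point_compactification_open_some.
have [|V /set_nbhsP[W [oW KW WV]] cVU] := @opc_normal _ cA (Some @` U).
  apply/set_nbhsP; exists (Some @` U); split => //; exact: image_subset.
have : uniform_separator ((Some : X -> opc) @` K) (~` W).
  move/(@normal_separatorP R) : opc_normal; apply => //.
    exact: open_closedC.
  by apply/disjoints_subset; rewrite setCK.
move=> /(@uniform_separatorP _ R) [f [cf f01 f0 f1]].
have WN : [set x | (1 - f (Some x)) != 0] `<=` Some @^-1` (closure V).
  move=> x /=; apply: contraNP => nVx; apply/eqP.
  have -> : f (Some x) = 1.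
    apply: f1; exists (Some x) => // Wx; apply: nVx.
    by apply: subset_closure; exact: WV.
  by rewrite subrr.
have cS : continuous (Some : X -> opc) by exact: one_point_compactification_some_continuous.
have WN' : closure [set x | (1 - f (Some x)) != 0] `<=` Some @^-1` (closure V).
  have cl : closed ((Some : X -> opc) @^-1` (closure V)).
    apply: (@closed_comp _ _ (Some : X -> opc)) => [x _|]; [exact: cS|exact: closed_closure].
  by move/closure_id : cl => ->; exact: closureS.
have VU : Some @^-1` (closure V) `<=` U by move=> x /cVU [y Uy [<-]].
exists (fun x => 1 - f (Some x)); split.
- move=> x; apply: cvgB; first exact: cvg_cst.
  by apply: (@continuous_comp _ _ _ (Some : X -> opc) f); [exact: cS|exact: cf].
- move=> x; have : range f (f (Some x)) by exists (Some x).
  by move/f01; rewrite /= in_itv/= => /andP[? ?]; rewrite subr_ge0 lerBlDr lerDl; apply/andP.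
- move=> x Kx; rewrite (_ : f (Some x) = 0) ?subr0//.
  by apply: f0; exists (Some x) => //; exists x.
- apply: subclosed_compact WN'; first exact: closed_closure.
  apply: preimage_Some_compact; first exact: closed_closure.
  by move=> /cVU [].
- exact: subset_trans WN' VU.
Qed.

End LocallyCompact.

(** * Integrals of complex functions *)

Section ComplexIntegral.
Context (R : realType) d (T : measurableType d) (mu : {measure set T -> \bar R}).
Implicit Types (D : set T) (f g : T -> CC R).

Lemma ReD (z w : CC R) : complex.Re (z + w) = complex.Re z + complex.Re w.
Proof. by case: z; case: w. Qed.
Lemma ImD (z w : CC R) : complex.Im (z + w) = complex.Im z + complex.Im w.
Proof. by case: z; case: w. Qed.
Lemma ReM (z w : CC R) : complex.Re (z * w) =
  complex.Re z * complex.Re w - complex.Im z * complex.Im w.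
Proof. by case: z; case: w. Qed.
Lemma ImM (z w : CC R) : complex.Im (z * w) =
  complex.Re z * complex.Im w + complex.Im z * complex.Re w.
Proof. by case: z; case: w. Qed.
Lemma complexE (z w : CC R) :
  complex.Re z = complex.Re w -> complex.Im z = complex.Im w -> z = w.
Proof. by case: z w => [a b] [c e] /= -> ->. Qed.

Lemma nrm_sqr (z : CC R) : nrm z ^+ 2 = complex.Re z ^+ 2 + complex.Im z ^+ 2.
Proof.
by case: z => a b; rewrite /nrm normc_def /= sqr_sqrtr// addr_ge0// sqr_ge0.
Qed.

Lemma nrm_real (a : R) : nrm (a%:C : CC R) = `|a|.
Proof. by rewrite /nrm normc_def /= expr0n/= addr0 sqrtr_sqr. Qed.

Lemma nrm1 : nrm (1 : CC R) = 1.
Proof. by rewrite /nrm normr1. Qed.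

Lemma nrm0 (V : normedModType R[i]) : nrm (0 : V) = 0.
Proof. by rewrite /nrm normr0. Qed.

Lemma nrm0_eq0 (V : normedModType R[i]) (x : V) : nrm x = 0 -> x = 0.
Proof. by move=> x0; apply/eqP; rewrite -normr_eq0 nrmE x0. Qed.

Lemma mul_conjr (z : CC R) : z * (z^*)%C = ((nrm z ^+ 2)%:C : CC R).
Proof.
apply: complexE; rewrite ?ReM ?ImM nrm_sqr; case: z => a b /=; last by ring.
by rewrite -!expr2 mulrN opprK.
Qed.

Definition cintegrable D f := mu.-integrable D (EFin \o (fun x => complex.Re (f x)))
  /\ mu.-integrable D (EFin \o (fun x => complex.Im (f x))).

Lemma eq_cintegral D f g : {in D, f =1 g} -> cintegral mu D f = cintegral mu D g.
Proof.
by move=> fg; rewrite /cintegral; congr (_ +i* _); apply: eq_Rintegral => x xD;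
  rewrite fg.
Qed.

Lemma cintegral_mkcond D f : cintegral mu D f = cintegral mu setT (f \_ D).
Proof.
rewrite /cintegral; congr (_ +i* _); rewrite Rintegral_mkcond; apply: eq_Rintegral => x _;
  by rewrite !patchE; case: ifP.
Qed.

Lemma cintegral_subset D E f : D `<=` E -> (forall x, E x -> ~ D x -> f x = 0) ->
  cintegral mu E f = cintegral mu D f.
Proof.
move=> DE f0; rewrite cintegral_mkcond [RHS]cintegral_mkcond; congr cintegral.
apply/funext => x; rewrite !patchE.
have [xE|xE] := boolP (x \in E); have [xD|xD] := boolP (x \in D) => //.
  by apply: f0; [exact: set_mem|move=> /mem_set; rewrite (negbTE xD)].
by move/negP: xE; case; apply/mem_set/DE/set_mem.
Qed.

Lemma cintegrable_subset D E f : measurable D -> measurable E -> D `<=` E ->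
  (forall x, E x -> ~ D x -> f x = 0) -> cintegrable D f -> cintegrable E f.
Proof.
move=> mD mE DE f0.
have H (h : T -> R) : (forall x, E x -> ~ D x -> h x = 0) ->
    mu.-integrable D (EFin \o h) -> mu.-integrable E (EFin \o h).
  move=> h0 /(integrable_mkcond _ mD) ih; apply/(integrable_mkcond _ mE).
  apply: eq_integrable ih => // x _; rewrite !patchE.
  have [xD|nD] := boolP (x \in D); first by rewrite mem_set//; exact/DE/set_mem.
  have [/set_mem xE|//] := boolP (x \in E); rewrite /= h0// => Dx.
  by move/negP: nD; apply; exact/mem_set.
by move=> [f1 f2]; split; apply: H => // x xE nD; rewrite f0.
Qed.

Section Dom.
Variables (D : set T).
Hypothesis mD : measurable D.

Let Zl r h : mu.-integrable D (EFin \o h) -> mu.-integrable D (EFin \o (fun x => r * h x)).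
Proof. by move=> /(integrableZl mD r); apply: eq_integrable. Qed.

Let B h k : mu.-integrable D (EFin \o h) -> mu.-integrable D (EFin \o k) ->
  mu.-integrable D (EFin \o (fun x => h x - k x)).
Proof. by move=> ih ik; have := integrableB mD ih ik; apply: eq_integrable. Qed.

Let A h k : mu.-integrable D (EFin \o h) -> mu.-integrable D (EFin \o k) ->
  mu.-integrable D (EFin \o (fun x => h x + k x)).
Proof. by move=> ih ik; have := integrableD mD ih ik; apply: eq_integrable. Qed.

Lemma cintegrable_lin (a : CC R) f g : cintegrable D f -> cintegrable D g ->
  cintegrable D (fun x => a * f x + g x).
Proof.
move=> [f1 f2] [g1 g2]; split.
- rewrite (_ : (fun x => _) = (fun x => complex.Re a * complex.Re (f x) -
    complex.Im a * complex.Im (f x) + complex.Re (g x))); last first.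
    by apply/funext => x; rewrite ReD ReM.
  by apply: A => //; apply: B; exact: Zl.
- rewrite (_ : (fun x => _) = (fun x => complex.Re a * complex.Im (f x) +
    complex.Im a * complex.Re (f x) + complex.Im (g x))); last first.
    by apply/funext => x; rewrite ImD ImM.
  by apply: A => //; apply: A; exact: Zl.
Qed.

Lemma cintegral_lin (a : CC R) f g : cintegrable D f -> cintegrable D g ->
  cintegral mu D (fun x => a * f x + g x) =
  a * cintegral mu D f + cintegral mu D g.
Proof.
move=> [f1 f2] [g1 g2]; apply: complexE; rewrite ?ReD ?ImD ?ReM ?ImM /=.
- under eq_Rintegral do rewrite ReD ReM.
  rewrite RintegralD//; last by apply: B; exact: Zl.
  by rewrite RintegralB//; [rewrite !RintegralZl|exact: Zl|exact: Zl].
- under eq_Rintegral do rewrite ImD ImM.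
  rewrite RintegralD//; last by apply: A; exact: Zl.
  by rewrite RintegralD//; [rewrite !RintegralZl|exact: Zl|exact: Zl].
Qed.

Lemma cintegral_cst (c : CC R) : cintegral mu D (fun=> c) = c * (fine (mu D))%:C.
Proof.
apply: complexE; rewrite ?ReM ?ImM /= (Rintegral_cst mu mD) mulr0.
  by rewrite subr0.
by rewrite add0r.
Qed.

Lemma cintegral_setU A1 A2 f : measurable A1 -> measurable A2 -> [disjoint A1 & A2] ->
  cintegrable (A1 `|` A2) f ->
  cintegral mu (A1 `|` A2) f = cintegral mu A1 f + cintegral mu A2 f.
Proof.
by move=> m1 m2 d12 [f1 f2]; apply: complexE; rewrite ?ReD ?ImD /= Rintegral_setU.
Qed.

Lemma cintegrable0 : cintegrable D (fun=> 0).
Proof. by split; apply: integrable0. Qed.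

Lemma cintegral0 : cintegral mu D (fun=> 0) = 0.
Proof.
by apply: complexE => /=; rewrite (Rintegral_cst mu mD) mul0r.
Qed.

Lemma cintegrableZ (a : CC R) f : cintegrable D f -> cintegrable D (fun x => a * f x).
Proof.
move=> fi; have := cintegrable_lin a fi cintegrable0.
by under eq_fun do rewrite addr0.
Qed.

Lemma cintegralZ (a : CC R) f : cintegrable D f ->
  cintegral mu D (fun x => a * f x) = a * cintegral mu D f.
Proof.
move=> fi; have := cintegral_lin a fi cintegrable0.
by under eq_fun do rewrite addr0; rewrite cintegral0 addr0.
Qed.

Lemma cintegralB f g : cintegrable D f -> cintegrable D g ->
  cintegral mu D (fun x => f x - g x) = cintegral mu D f - cintegral mu D g.
Proof.
move=> fi gi; have := cintegral_lin (-1) gi fi.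
by under eq_fun do rewrite mulN1r addrC; rewrite mulN1r addrC.
Qed.

Lemma cintegral_conj f : cintegrable D f ->
  cintegral mu D (fun x => (f x)^*%C : CC R) = (cintegral mu D f)^*%C.
Proof.
move=> [f1 f2]; apply: complexE => /=.
  by apply: eq_Rintegral => x _; case: (f x).
rewrite -mulN1r -RintegralZl//; apply: eq_Rintegral => x _.
by rewrite mulN1r; case: (f x).
Qed.

Lemma cintegrable_nrm f : cintegrable D f -> mu.-integrable D (EFin \o (fun x => nrm (f x))).
Proof.
move=> [f1 f2]; have := integrableD mD (integrable_abse f1) (integrable_abse f2).
apply: le_integrable => //; last first.
  move=> x _ /=; rewrite ger0_norm ?nrm_ge0// lee_fin.
  by rewrite ger0_norm ?addr_ge0//; exact: nrm_le_ReIm.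
apply/measurable_EFinP.
have m1 : measurable_fun D (fun x => complex.Re (f x)).
  by apply/measurable_EFinP; exact: measurable_int f1.
have m2 : measurable_fun D (fun x => complex.Im (f x)).
  by apply/measurable_EFinP; exact: measurable_int f2.
have -> : (fun x => nrm (f x)) =
   (fun x => Num.sqrt (complex.Re (f x) ^+ 2 + complex.Im (f x) ^+ 2)).
  by apply/funext => x; rewrite -nrm_sqr sqrtr_sqr ger0_norm// nrm_ge0.
apply: (measurableT_comp (continuous_measurable_fun (@sqrt_continuous R))).
by apply: measurable_funD; apply: measurable_funX.
Qed.

(** Multiplication by the unimodular constant [c] makes the integral real and nonnegative; the real
    part of the rotated integrand is at most its norm. *)
Lemma nrm_cintegral_le f : cintegrable D f ->
  nrm (cintegral mu D f) <= \int[mu]_(x in D) nrm (f x).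
Proof.
move=> fi; set I := cintegral mu D f.
have [I0|I0] := eqVneq (nrm I) 0; first by rewrite I0; apply: Rintegral_ge0 => x _; exact: nrm_ge0.
pose c : CC R := (I^*)%C / (nrm I)%:C.
have cI : c * I = (nrm I)%:C.
  rewrite /c mulrAC [_^*%C * I]mulrC mul_conjr expr2 rmorphM /= mulfK//.
  by apply/eqP => /complexI /eqP; rewrite (negbTE I0).
have nc : nrm c = 1.
  apply: (mulIf I0); rewrite mul1r -nrmM cI nrm_real ger0_norm//.
  exact: nrm_ge0.
have <- : complex.Re (c * I) = nrm I by rewrite cI.
rewrite -cintegralZ//= ; apply: le_Rintegral => //.
- by case: (cintegrableZ c fi).
- exact: cintegrable_nrm.
- move=> x _; apply: le_trans (ler_norm _) _; apply: le_trans (nrm_Re _) _.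
  by rewrite nrmM nc mul1r.
Qed.

End Dom.
End ComplexIntegral.

(** * Continuity relative to a subset *)

Section WithinContinuous.
Variables (R : realType) (T : topologicalType).
Implicit Types (D : set T) (f g : T -> CC R).

Lemma within_nrmP D f : {within D, continuous f} <->
  forall x, D x -> forall e : R, 0 < e -> \forall y \near x, D y -> nrm (f x - f y) < e.
Proof.
split => [/subspace_continuousP cf x Dx e e0|H].
  by have /cvg_nrmP/(_ e e0) := cf x Dx.
apply/subspace_continuousP => x Dx; apply/cvg_nrmP => e e0; exact: H.
Qed.

Lemma within_continuous_Re D f : {within D, continuous f} ->
  {within D, continuous (fun x => complex.Re (f x))}.
Proof.
move=> /subspace_continuousP cf; apply/subspace_continuousP => x Dx.
by apply: continuous_cvg; [exact: Re_continuous|exact: cf].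
Qed.

Lemma within_continuous_Im D f : {within D, continuous f} ->
  {within D, continuous (fun x => complex.Im (f x))}.
Proof.
move=> /subspace_continuousP cf; apply/subspace_continuousP => x Dx.
by apply: continuous_cvg; [exact: Im_continuous|exact: cf].
Qed.

Lemma within_continuous_nrm D f : {within D, continuous f} ->
  {within D, continuous (fun x => nrm (f x))}.
Proof.
move=> /subspace_continuousP cf; apply/subspace_continuousP => x Dx.
by apply: continuous_cvg; [exact: nrm_continuous|exact: cf].
Qed.

Lemma within_continuous_conj D f : {within D, continuous f} ->
  {within D, continuous (fun x => (f x)^*%C : CC R)}.
Proof.
move=> /subspace_continuousP cf; apply/subspace_continuousP => x Dx.
by apply: continuous_cvg; [exact: conj_continuous|exact: cf].
Qed.

Lemma within_continuousM D f g : {within D, continuous f} ->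
  {within D, continuous g} -> {within D, continuous (fun x => f x * g x)}.
Proof.
move=> /subspace_continuousP cf /subspace_continuousP cg.
by apply/subspace_continuousP => x Dx; apply: cvgM; [exact: cf|exact: cg].
Qed.

Lemma within_continuousD D f g : {within D, continuous f} ->
  {within D, continuous g} -> {within D, continuous (fun x => f x + g x)}.
Proof.
move=> /subspace_continuousP cf /subspace_continuousP cg.
by apply/subspace_continuousP => x Dx; apply: cvgD; [exact: cf|exact: cg].
Qed.

Lemma within_continuousB D f g : {within D, continuous f} ->
  {within D, continuous g} -> {within D, continuous (fun x => f x - g x)}.
Proof.
move=> /subspace_continuousP cf /subspace_continuousP cg.
by apply/subspace_continuousP => x Dx; apply: cvgB; [exact: cf|exact: cg].
Qed.

Lemma within_continuousZ D (a : CC R) f : {within D, continuous f} ->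
  {within D, continuous (fun x => a * f x)}.
Proof.
by apply: within_continuousM; apply: continuous_subspaceT => x; exact: cvg_cst.
Qed.

Lemma real_complex_continuous : continuous (fun a : R => a%:C : CC R).
Proof.
move=> a; apply/(@cvg_nrmP R (CC R) _ _ (@nbhs_filter R a)) => e e0.
have := (@cvgrPdist_lt R R R _ (@nbhs_filter R a) id a).1 cvg_id _ e0.
by apply: filterS => b; rewrite -rmorphB/= nrm_real.
Qed.

Lemma within_continuous_complex D (f : T -> R) : {within D, continuous f} ->
  {within D, continuous (fun x => (f x)%:C : CC R)}.
Proof.
move=> /subspace_continuousP cf; apply/subspace_continuousP => x Dx.
by apply: continuous_cvg; [exact: real_complex_continuous|exact: cf].
Qed.

Lemma continuous_complexE f : continuous (fun x => complex.Re (f x)) ->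
  continuous (fun x => complex.Im (f x)) -> continuous f.
Proof.
move=> c1 c2 x; apply/(@cvg_nrmP R (CC R) _ _ (@nbhs_filter T x)) => e e0.
have e2 : 0 < e / 2 by rewrite divr_gt0.
have /cvgrPdist_lt/(_ _ e2) h1 := c1 x; have /cvgrPdist_lt/(_ _ e2) h2 := c2 x.
near=> y; apply: le_lt_trans (nrm_le_ReIm _) _.
rewrite !raddfB (splitr e) ltrD//; [near: y|near: y] => //.
Unshelve. all: by end_near. Qed.

Lemma within_compact_bounded D f : compact D -> {within D, continuous f} ->
  exists2 M : R, 0 <= M & forall x, D x -> nrm (f x) <= M.
Proof.
move=> cD cf.
have /compact_bounded[M [_ MK]] := continuous_compact (within_continuous_nrm cf) cD.
have M1 : M < `|M| + 1 by rewrite (le_lt_trans (ler_norm _))// ltrDl.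
exists (`|M| + 1); first by rewrite addr_ge0.
move=> x Dx; apply: le_trans (ler_norm _) _; apply: (MK _ M1).
by exists x.
Qed.

Lemma compact_cextension (lcT : locally_compact [set: T]) (hT : hausdorff_space T)
    D f : compact D -> {within D, continuous f} ->
  exists2 g : T -> CC R, continuous g & forall x, D x -> g x = f x.
Proof.
move=> cD cf.
have [g1 cg1 g1f] := compact_extension lcT hT cD (within_continuous_Re cf).
have [g2 cg2 g2f] := compact_extension lcT hT cD (within_continuous_Im cf).
exists (fun x => g1 x +i* g2 x); first exact: continuous_complexE.
by move=> x Dx; rewrite g1f// g2f//; case: (f x).
Qed.

End WithinContinuous.

Lemma within_continuous_comp (S T U : topologicalType) (D : set S) (E : set T)
    (h : S -> T) (f : T -> U) : {within D, continuous h} ->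
  (forall x, D x -> E (h x)) -> {within E, continuous f} ->
  {within D, continuous (f \o h)}.
Proof.
move=> /subspace_continuousP ch hE /subspace_continuousP cf.
apply/subspace_continuousP => x Dx V Vfx.
have := ch x Dx _ (cf (h x) (hE x Dx) V Vfx).
rewrite /nbhs /= /within /= /nbhs /=; apply: filterS => y H Dy.
by apply: (H Dy); exact: hE.
Qed.

Lemma within_continuous_pair (S T U : topologicalType) (D : set S)
    (f : S -> T) (g : S -> U) : {within D, continuous f} ->
  {within D, continuous g} -> {within D, continuous (fun x => (f x, g x))}.
Proof.
move=> /subspace_continuousP cf /subspace_continuousP cg.
by apply/subspace_continuousP => x Dx; apply: cvg_pair; [exact: cf|exact: cg].
Qed.

(** Compactness of [K], as near-covering, makes the smallness around each [(x, z0)] uniform in [x].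
    As [Phi] is controlled on [E] only, points [(x, z0)] outside [E] must have a neighbourhood that
    avoids [E]. *)
Lemma tube_lemma (R : realType) (X Z : topologicalType) (K : set X)
    (E : set (X * Z)) (Phi : X * Z -> CC R) (z0 : Z) : compact K ->
  {within E, continuous Phi} ->
  (forall x, K x -> E (x, z0) -> Phi (x, z0) = 0) ->
  (forall x, K x -> ~ E (x, z0) -> \forall p \near (x, z0), ~ E p) ->
  forall e : R, 0 < e ->
  \forall z \near z0, forall x, K x -> E (x, z) -> nrm (Phi (x, z)) < e.
Proof.
move=> cK /within_nrmP cPhi Phi0 nE e e0.
pose P z x := K x -> E (x, z) -> nrm (Phi (x, z)) < e.
have : \forall z \near z0, K `<=` P z.
  apply: ((@compact_near_coveringP X K).1 cK) => x Kx.
  have [Ex|nEx] := pselect (E (x, z0)); last first.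
    by have := nE _ Kx nEx; apply: filterS => -[x' z] /= h _ /h.
  have := cPhi _ Ex _ e0; apply: filterS => -[x' z] /= h _ Ez.
  by have := h Ez; rewrite Phi0// sub0r nrmN.
by apply: filterS => z KP x Kx; exact: KP.
Qed.

Lemma within_continuous_measurable (R : realType) (T : topologicalType) (u : T)
    (D : set T) (f : T -> R) : closed D -> {within D, continuous f} ->
  measurable_fun (D : set (borel u)) (f : borel u -> R).
Proof.
move=> cD cf; apply: (measurability _ (RGenOpens.measurableE R)).
move=> _ [_ [a [b ->] <-]].
have oI : open (`]a, b[%classic : set R) by exact: interval_open.
have /continuousP/(_ _ oI)/open_subspaceP[V oV VE] := cf.
rewrite setIC -VE; apply: (@measurableI _ (borel u)).
  exact: open_measurable_borel.
exact: closed_measurable_borel.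
Qed.

(** * Measures that are finite on compact sets *)

Section CompactFinite.
Variables (R : realType) (T : topologicalType) (u : T).
Variable m : {measure set borel u -> \bar R}.
Hypothesis hT : hausdorff_space T.
Hypothesis m_compact : forall K : set T, compact K -> (m K < +oo)%E.
Implicit Types (D K : set T) (f g : T -> CC R).

Lemma compact_measurable_borel K : compact K -> measurable (K : set (borel u)).
Proof. by move=> cK; apply: closed_measurable_borel; exact: compact_closed. Qed.

Lemma compact_integrable K (A : set (borel u)) f : compact K -> A `<=` K ->
  measurable A -> {within K, continuous f} -> cintegrable m A f.
Proof.
move=> cK AK mA cf; have [M M0 fM] := within_compact_bounded cK cf.
have mK := compact_measurable_borel cK.
have mAoo : (m A < +oo)%E.
  by apply: le_lt_trans (m_compact cK); apply: le_measure => //; rewrite inE.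
split; apply: measurable_bounded_integrable => //.
- apply: (measurable_funS mK) => //.
  apply: within_continuous_measurable; first exact: compact_closed.
  exact: within_continuous_Re.
- exists M; split; rewrite ?num_real// => x Mx y Ay /=; apply: le_trans (ltW Mx).
  by apply: le_trans (nrm_Re _) _; apply: fM; exact: AK.
- apply: (measurable_funS mK) => //.
  apply: within_continuous_measurable; first exact: compact_closed.
  exact: within_continuous_Im.
- exists M; split; rewrite ?num_real// => x Mx y Ay /=; apply: le_trans (ltW Mx).
  by apply: le_trans (nrm_Im _) _; apply: fM; exact: AK.
Qed.

Lemma compact_nrm_integral_le K (A : set (borel u)) f (M : R) : compact K -> A `<=` K ->
  measurable A -> {within K, continuous f} -> (forall x, A x -> nrm (f x) <= M) ->
  nrm (cintegral m A f) <= M * fine (m A).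
Proof.
move=> cK AK mA cf fM; have fi := compact_integrable cK AK mA cf.
apply: le_trans (nrm_cintegral_le mA fi) _.
rewrite -Rintegral_cst//; apply: le_Rintegral => //.
  exact: cintegrable_nrm.
apply: measurable_bounded_integrable => //; last first.
  by exists `|M|; split; rewrite ?num_real// => x Mx y Ay /=; exact: ltW.
apply: le_lt_trans (m_compact cK); apply: le_measure => //; rewrite inE//.
exact: compact_measurable_borel.
Qed.

End CompactFinite.

(** * Integrals depending on a parameter *)

Section ParametricIntegral.
Variables (R : realType) (X Y : topologicalType) (v : Y).
Variable m : {measure set borel v -> \bar R}.
Hypotheses (hY : hausdorff_space Y).
Hypothesis m_compact : forall K : set Y, compact K -> (m K < +oo)%E.
Variables (K : set X) (L : set Y) (F : X -> Y -> CC R).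
Hypothesis (cL : compact L).
Hypothesis cF : {within K `*` L, continuous (fun z => F z.1 z.2)}.

Lemma within_continuous_section x : K x -> {within L, continuous (F x)}.
Proof.
move=> Kx; apply: (@within_continuous_comp _ _ _ L (K `*` L) (fun y => (x, y)) _ _ _ cF) => //.
apply: within_continuous_pair; apply: continuous_subspaceT => y; [exact: cvg_cst|exact: cvg_id].
Qed.

Lemma compact_tube (x0 : X) : K x0 -> forall e : R, 0 < e ->
  \forall x \near x0, K x -> forall y, L y -> nrm (F x y - F x0 y) < e.
Proof.
move=> Kx0 e e0.
have c1 : {within [set z : Y * X | L z.1 /\ K z.2], continuous (fun z : Y * X => F z.2 z.1)}.
  apply: (@within_continuous_comp _ _ _ _ (K `*` L) (fun z : Y * X => (z.2, z.1)) _ _ _ cF).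
    by apply: within_continuous_pair; apply: continuous_subspaceT => y;
      [exact: cvg_snd|exact: cvg_fst].
  by move=> z /= [].
have c2 : {within [set z : Y * X | L z.1 /\ K z.2], continuous (fun z : Y * X => F x0 z.1)}.
  apply: (@within_continuous_comp _ _ _ _ L fst); last exact: within_continuous_section.
    by apply: continuous_subspaceT => y; exact: cvg_fst.
  by move=> z /= [].
have := @tube_lemma R Y X L _ (fun z => F z.2 z.1 - F x0 z.1) x0 cL
  (within_continuousB c1 c2) _ _ e e0.
have h1 : forall y, L y -> (L y /\ K x0) -> F x0 y - F x0 y = 0 by move=> y _ _; rewrite subrr.
have h2 : forall y, L y -> ~ (L y /\ K x0) ->
  \forall p \near (y, x0), ~ (L p.1 /\ K p.2) by move=> y Ly [].
by move=> /(_ h1 h2); apply: filterS => x H Kx y Ly; exact: H.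
Qed.

(** By [compact_tube] the sections [F x] converge uniformly on [L], and [A] has finite measure. *)
Lemma within_continuous_cintegral (A : set (borel v)) : measurable A -> A `<=` L ->
  {within K, continuous (fun x => cintegral m A (F x))}.
Proof.
move=> mA AL; apply/within_nrmP => x0 Kx0 e e0.
(* Adding 1 keeps the divisor of [e] positive when [A] is a null set. *)
pose M := fine (m A) + 1.
have M0 : 0 < M by rewrite ltr_wpDl// fine_ge0.
have := compact_tube Kx0 (divr_gt0 e0 M0); apply: filterS => x xx0 Kx.
rewrite -cintegralB//; last 2 first.
- by apply: (compact_integrable hY m_compact cL) => //; exact: within_continuous_section.
- by apply: (compact_integrable hY m_compact cL) => //; exact: within_continuous_section.
apply: (@le_lt_trans _ _ (e / M * fine (m A))).
  apply: (compact_nrm_integral_le hY m_compact cL) => //.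
    by apply: within_continuousB; exact: within_continuous_section.
  by move=> y Ay; rewrite nrmB ltW//; apply: xx0 => //; exact: AL.
by rewrite -mulrA gtr_pMr// mulrC ltr_pdivrMr// mul1r ltrDl.
Qed.

End ParametricIntegral.

(** * Fubini's theorem for continuous kernels on compact sets *)

Section Fubini.
Variables (R : realType) (X Y : topologicalType) (u : X) (v : Y).
Variable m1 : {measure set borel u -> \bar R}.
Variable m2 : {measure set borel v -> \bar R}.
Hypotheses (hX : hausdorff_space X) (hY : hausdorff_space Y).
Hypothesis m1_compact : forall K : set X, compact K -> (m1 K < +oo)%E.
Hypothesis m2_compact : forall K : set Y, compact K -> (m2 K < +oo)%E.
Variables (K : set X) (L : set Y) (F : X -> Y -> CC R).
Hypotheses (cK : compact K) (cL : compact L).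
Hypothesis cF : {within K `*` L, continuous (fun z => F z.1 z.2)}.

Let cF' : {within L `*` K, continuous (fun z => F z.2 z.1)}.
Proof.
apply: (@within_continuous_comp _ _ _ _ (K `*` L) (fun z : Y * X => (z.2, z.1)) _ _ _ cF).
  by apply: within_continuous_pair; apply: continuous_subspaceT => y;
    [exact: cvg_snd|exact: cvg_fst].
by move=> z /= [].
Qed.

Let mK : measurable (K : set (borel u)) := compact_measurable_borel hX cK.
Let mL : measurable (L : set (borel v)) := compact_measurable_borel hY cL.
Let cFx x := @within_continuous_section R X Y K L F cF x.
Let cFy y := @within_continuous_section R Y X L K (fun y x => F x y) cF' y.
Let iFx (A : set (borel u)) (mA : measurable A) (AK : A `<=` K) :=
  compact_integrable hX m1_compact cK AK mA
    (within_continuous_cintegral hY m2_compact cL cF mL (@subset_refl _ L)).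
Let iFy (A : set (borel u)) (mA : measurable A) (AK : A `<=` K) :=
  compact_integrable hY m2_compact cL (@subset_refl _ L) mL
    (within_continuous_cintegral hX m1_compact (F := fun y x => F x y) cK cF' mA AK).

(** Both iterated integrals are compared with [m1(A)] times the integral of [F x0], their common
    value if [F] were constant in [x] on [A]. Each comparison costs at most [e m1(A) m2(L)]. *)
Let small_swap (e : R) (x0 : X) (A : set (borel u)) : measurable A -> A `<=` K -> K x0 ->
  (forall x, A x -> forall y, L y -> nrm (F x y - F x0 y) <= e) ->
  nrm (cintegral m1 A (fun x => cintegral m2 L (F x)) -
       cintegral m2 L (fun y => cintegral m1 A (F^~ y)))
  <= (e * fine (m1 A) * fine (m2 L)) *+ 2.
Proof.
move=> mA AK Kx0 small.
have iL := compact_integrable hY m2_compact cL (@subset_refl _ L) mL.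
have iA := compact_integrable hX m1_compact cK AK mA.
have cc (c : CC R) : {within K, continuous (fun=> c)}.
  by apply: continuous_subspaceT => x; exact: cvg_cst.
pose c : CC R := (fine (m1 A))%:C; pose g0 := cintegral m2 L (F x0).
rewrite -(subrKA (c * g0)); apply: le_trans (nrmD _ _) _; rewrite mulr2n lerD//.
- rewrite {1}/c mulrC -cintegral_cst// -cintegralB//; [|exact: iFx|exact: iA].
  rewrite mulrAC.
  apply: (compact_nrm_integral_le hX m1_compact cK) => //.
    apply: within_continuousB => //.
    exact: (within_continuous_cintegral hY m2_compact cL cF mL).
  move=> x Ax; rewrite -cintegralB//; [|apply: iL|apply: iL]; [|exact/cFx/AK|exact: cFx].
  apply: (compact_nrm_integral_le hY m2_compact cL) => //; last exact: small.
  by apply: within_continuousB; apply: cFx => //; exact: AK.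
- rewrite nrmB /g0 -cintegralZ//; last by apply: iL; exact: cFx.
  rewrite -cintegralB//; [|exact: iFy|]; last first.
    by apply: iL; apply: within_continuousZ; exact: cFx.
  apply: (compact_nrm_integral_le hY m2_compact cL) => //.
    apply: within_continuousB; last by apply: within_continuousZ; exact: cFx.
    exact: (within_continuous_cintegral hX m1_compact (F := fun y x => F x y) cK cF' mA AK).
  move=> y Ly; rewrite {1}/c mulrC -cintegral_cst// -cintegralB//; [|apply: iA|exact: iA].
    apply: (compact_nrm_integral_le hX m1_compact cK) => //.
      by apply: within_continuousB => //; exact: cFy.
    by move=> x Ax; exact: small.
  exact: cFy.
Qed.

(** Induction on the list of centres: [A] is split along [U x0], [small_swap] handles the part
    inside and the induction hypothesis the rest. The error is additive in [m1(A)], so the number of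
    pieces does not enter the bound. *)
Let cover_swap (e : R) (s : seq X) (U : X -> set X) (A : set (borel u)) :
  (forall x, open (U x)) -> measurable A -> A `<=` K ->
  (forall x, x \in s -> K x) ->
  (forall x0 x, x0 \in s -> U x0 x -> K x -> forall y, L y -> nrm (F x y - F x0 y) <= e) ->
  (forall x, A x -> exists2 x0, x0 \in s & U x0 x) ->
  nrm (cintegral m1 A (fun x => cintegral m2 L (F x)) -
       cintegral m2 L (fun y => cintegral m1 A (F^~ y)))
  <= (e * fine (m1 A) * fine (m2 L)) *+ 2.
Proof.
move=> oU; elim: s A => [|x0 s IH] A mA AK sK small cov.
  have -> : A = set0 by rewrite -subset0 => x /cov[].
  rewrite measure0/= mulr0 mul0r mul0rn.
  suff -> : cintegral m1 set0 (fun x => cintegral m2 L (F x)) -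
       cintegral m2 L (fun y => cintegral m1 set0 (F^~ y)) = 0 by rewrite nrm0.
  have z (f : X -> CC R) : cintegral m1 set0 f = 0.
    by apply: complexE; rewrite /= Rintegral_set0.
  by rewrite z; under eq_cintegral do rewrite z; rewrite cintegral0 ?subrr.
have mU : measurable (U x0 : set (borel u)) by exact: open_measurable_borel.
pose A1 : set (borel u) := A `&` U x0; pose A2 : set (borel u) := A `\` U x0.
have mA1 : measurable A1 by exact: measurableI.
have mA2 : measurable A2 by exact: measurableD.
have A1K : A1 `<=` K by move=> x [/AK].
have A2K : A2 `<=` K by move=> x [/AK].
have AE : A1 `|` A2 = A by rewrite /A1 /A2 setUIDK.
have dA : [disjoint A1 & A2] by apply/disj_setPS => x [[_ ?] []].
have s1 : nrm (cintegral m1 A1 (fun x => cintegral m2 L (F x)) -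
       cintegral m2 L (fun y => cintegral m1 A1 (F^~ y)))
  <= (e * fine (m1 A1) * fine (m2 L)) *+ 2.
  apply: (@small_swap e x0) => //; first by apply: sK; rewrite inE eqxx.
  by move=> x [Ax Ux] y Ly; apply: small => //; [rewrite inE eqxx|exact: AK].
have s2 : nrm (cintegral m1 A2 (fun x => cintegral m2 L (F x)) -
       cintegral m2 L (fun y => cintegral m1 A2 (F^~ y)))
  <= (e * fine (m1 A2) * fine (m2 L)) *+ 2.
  apply: IH => //.
  - by move=> x xs; apply: sK; rewrite inE xs orbT.
  - by move=> x x' xs; apply: small; rewrite inE xs orbT.
  - move=> x [Ax nUx]; have [x1] := cov x Ax; rewrite inE => /orP[/eqP ->//|x1s Ux1].
    by exists x1.
have fin (B : set (borel u)) : measurable B -> B `<=` K -> m1 B \is a fin_num.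
  move=> mB BK; rewrite ge0_fin_numE//; apply: le_lt_trans (m1_compact cK).
  by apply: le_measure => //; rewrite inE.
have mAE : fine (m1 A) = fine (m1 A1) + fine (m1 A2).
  rewrite -fineD; [|exact: fin|exact: fin]; rewrite -measureU// ?AE//.
  by rewrite -subset0; exact/disj_setPS.
have iA f : {within K, continuous f} -> cintegrable m1 (A1 `|` A2) f.
  by rewrite AE; exact: (compact_integrable hX m1_compact cK AK mA).
have spl f : {within K, continuous f} ->
    cintegral m1 A f = cintegral m1 A1 f + cintegral m1 A2 f.
  by move=> cf; rewrite -{1}AE cintegral_setU//; exact: iA.
rewrite spl; last exact: (within_continuous_cintegral hY m2_compact cL cF mL).
have -> : cintegral m2 L (fun y => cintegral m1 A (F^~ y)) =
    cintegral m2 L (fun y => cintegral m1 A1 (F^~ y)) +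
    cintegral m2 L (fun y => cintegral m1 A2 (F^~ y)).
  under eq_cintegral => y /set_mem Ly do rewrite (spl _ (cFy Ly)) -[X in X + _]mul1r.
  by rewrite cintegral_lin ?mul1r//; exact: iFy.
rewrite opprD addrACA; apply: le_trans (nrmD _ _) _.
by rewrite mAE mulrDr mulrDl mulrnDl lerD.
Qed.

(* The measures need not be sigma-finite; by compactness F is uniformly close to
   a function constant in x on the pieces of a finite partition of K. *)
Lemma fubini_compact : cintegral m1 K (fun x => cintegral m2 L (F x)) =
  cintegral m2 L (fun y => cintegral m1 K (F^~ y)).
Proof.
apply/eqP; rewrite -subr_eq0; apply/eqP/nrm0_eq0/eqP; rewrite eq_le nrm_ge0 andbT.
set d := nrm _; pose M := fine (m1 K) * fine (m2 L) *+ 2 + 1.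
have M0 : 0 < M by rewrite ltr_wpDl// mulrn_wge0// mulr_ge0// fine_ge0.
rewrite leNgt; apply/negP => d0.
(* With oscillation at most [e], [cover_swap] bounds [d] by [2 e m1(K) m2(L)], which is less than
   [e * (M *+ 2)], that is, less than [d]. *)
pose e := d / (M *+ 2).
have e0 : 0 < e by rewrite divr_gt0// pmulrn_lgt0.
have Uex x : exists V, open V /\ (K x -> V x /\
    forall x', V x' -> K x' -> forall y, L y -> nrm (F x' y - F x y) < e).
  have [Kx|nKx] := pselect (K x); last by exists setT; split=> //; exact: openT.
  exists [set x' | K x' -> forall y, L y -> nrm (F x' y - F x y) < e]°.
  split => [|_]; first exact: open_interior.
  by split=> [|x']; [exact: compact_tube|exact: interior_subset].
have [U UP] := choice Uex.
have oU x : open (U x) by case: (UP x).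
pose Xp : ptopologicalType := HB.pack (X : Type) (isPointed.Build X u) (Topological.class X).
have : @compact Xp K by exact: cK.
rewrite compact_cover => /(_ X K U (fun x _ => oU x)).
move=> [|D DK cov]; first by move=> x Kx; exists x => //; have [_ /(_ Kx)[]] := UP x.
have := @cover_swap e (finmap.enum_fset D) U K oU mK (@subset_refl _ K).
have h1 : forall x, x \in finmap.enum_fset D -> K x by move=> x /DK /set_mem.
have h2 : forall x0 x, x0 \in finmap.enum_fset D -> U x0 x -> K x ->
    forall y, L y -> nrm (F x y - F x0 y) <= e.
  move=> x0 x x0D Ux Kx y Ly; have [_ /(_ (h1 _ x0D))[_ h]] := UP x0.
  by apply/ltW/h.
have h3 : forall x, K x -> exists2 x0, x0 \in finmap.enum_fset D & U x0 x.
  by move=> x /cov[x0 /= x0D Ux]; exists x0.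
move=> /(_ h1 h2 h3); apply/negP; rewrite -ltNge -/d.
have : 0 <= e * (fine (m1 K) * fine (m2 L)) by apply: mulr_ge0; [exact: ltW|apply: mulr_ge0; rewrite fine_ge0].
have : d = e * (M *+ 2) by rewrite /e divfK// gt_eqF// pmulrn_lgt0.
rewrite -mulrA /M; move: (fine _ * fine _) (e) (d) e0.
move=> t e1 d1 e10 ->; rewrite !mulr2n !mulrDr mulr1; lra.
Qed.

End Fubini.

Lemma within_continuous_compl (S T U : topologicalType) (D : set S)
    (h : S -> T) (f : T -> U) : {within D, continuous h} -> continuous f ->
  {within D, continuous (f \o h)}.
Proof.
move=> ch cf; apply: (@within_continuous_comp _ _ _ _ setT) => //.
exact: continuous_subspaceT.
Qed.

Lemma within_continuous_cst (S T : topologicalType) (D : set S) (t : T) :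
  {within D, continuous (fun=> t)}.
Proof. by apply: continuous_subspaceT => x; exact: cvg_cst. Qed.

Lemma within_continuous_id (S : topologicalType) (D : set S) :
  {within D, continuous (fun x : S => x)}.
Proof. by apply: continuous_subspaceT => x; exact: cvg_id. Qed.

Lemma within_continuous_fst (S T : topologicalType) (D : set (S * T)) :
  {within D, continuous fst}.
Proof. by apply: continuous_subspaceT => x; exact: cvg_fst. Qed.

Lemma within_continuous_snd (S T : topologicalType) (D : set (S * T)) :
  {within D, continuous snd}.
Proof. by apply: continuous_subspaceT => x; exact: cvg_snd. Qed.

(** * The convolution algebra *)

Section GroupoidTopology.
Variables (R : realType) (G : twisted_groupoid R).
Implicit Types (u x y : G) (f g : G -> CC R).

Let hG : hausdorff_space G := @arrow_hausdorff G.
Let lcG : locally_compact [set: G] := @arrow_lc G.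

Section Within.
Variables (S : topologicalType) (D : set S).
Implicit Types (a b : S -> G).

Lemma within_continuous_mul a b : {within D, continuous a} -> {within D, continuous b} ->
  (forall z, D z -> src (a z) = rng (b z)) ->
  {within D, continuous (fun z => mul (a z) (b z))}.
Proof.
move=> ca cb ab.
apply: (@within_continuous_comp _ _ _ D _ (fun z => (a z, b z)) _ _ _ (@mul_continuous G)) => //.
exact: within_continuous_pair.
Qed.

Lemma within_continuous_twist a b : {within D, continuous a} -> {within D, continuous b} ->
  (forall z, D z -> src (a z) = rng (b z)) ->
  {within D, continuous (fun z => twist (a z) (b z))}.
Proof.
move=> ca cb ab.
apply: (@within_continuous_comp _ _ _ D _ (fun z => (a z, b z)) _ _ _ (cocycle_continuous (twistP G))) => //.
exact: within_continuous_pair.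
Qed.

Lemma within_continuous_inv a : {within D, continuous a} ->
  {within D, continuous (fun z => inv (a z))}.
Proof. by move=> ca; apply: (within_continuous_compl ca); exact: inv_continuous. Qed.

End Within.

(** It follows from the continuity of multiplication and inversion, [rng x] being the product of [x]
    and [inv x]. *)
Lemma rng_continuous : continuous (@rng G).
Proof.
have -> : @rng G = fun x => mul x (inv x) by apply/funext => x; rewrite mul_inv.
move=> x; have /subspace_continuousP/(_ x I) : {within [set: G], continuous (fun x => mul x (inv x))}.
  apply: within_continuous_mul => [||z _]; last by rewrite rng_inv.
    by apply: continuous_subspaceT => z; exact: cvg_id.
  by apply: continuous_subspaceT; exact: inv_continuous.
by rewrite withinET.
Qed.

Lemma src_continuous : continuous (@src G).
Proof.
have -> : @src G = @rng G \o @inv G by apply/funext => x /=; rewrite rng_inv.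
by move=> x; apply: continuous_comp; [exact: inv_continuous|exact: rng_continuous].
Qed.

Lemma unit_rng x : units (rng x). Proof. by rewrite /units /= rng_rng. Qed.
Lemma unit_src x : units (src x). Proof. by rewrite /units /= rng_src. Qed.

Lemma invK x : inv (inv x) = x.
Proof.
rewrite -[LHS]mul_src src_inv rng_inv -inv_mul mul_assoc ?src_inv ?rng_inv//.
by rewrite inv_mul src_inv mul_rng.
Qed.

Lemma inv_mulK x y : src x = rng y -> mul (inv x) (mul x y) = y.
Proof.
move=> xy; rewrite mul_assoc ?src_inv//.
by rewrite inv_mul xy mul_rng.
Qed.

Lemma mul_invK x y : rng x = rng y -> mul x (mul (inv x) y) = y.
Proof. by move=> xy; rewrite -{1}[x]invK inv_mulK// src_inv. Qed.

Lemma closed_rfiber u : closed (rfiber u).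
Proof.
have -> : rfiber u = @rng G @^-1` [set u] by [].
apply: closed_comp => [x _|]; first exact: rng_continuous.
exact/accessible_closed_set1/hausdorff_accessible.
Qed.

Lemma Cc_compact_support f : Cc f -> exists2 K, compact K & forall x, ~ K x -> f x = 0.
Proof.
move=> [cf sf]; exists (closure [set x | f x != 0]) => // x nx.
by apply: contrapT => /eqP fx; apply: nx; exact: subset_closure.
Qed.

Lemma Cc_intro f : continuous f -> (exists2 K, compact K & forall x, ~ K x -> f x = 0) -> Cc f.
Proof.
move=> cf [K cK fK]; split => //; apply: (subclosed_compact _ cK); first exact: closed_closure.
have /closure_id -> : closed K by exact: compact_closed.
by apply: closureS => x /= fx; apply: contrapT => /fK /eqP; rewrite (negbTE fx).
Qed.

Lemma Cc_bounded f : Cc f -> exists2 M : R, 0 <= M & forall x, nrm (f x) <= M.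
Proof.
move=> [cf sf]; have [M M0 fM] := within_compact_bounded sf (continuous_subspaceT cf).
exists M => // x; have [->|fx] := eqVneq (f x) 0; first by rewrite nrm0.
exact/fM/subset_closure.
Qed.

(** Values of [mul] at non-composable pairs are arbitrary, so a function such as [y |-> f (mul x y)]
    has continuity and compact support only relative to the fibre over [src x]. *)
Definition fiberCc u f := {within rfiber u, continuous f} /\
  exists2 K, compact K & forall x, rfiber u x -> ~ K x -> f x = 0.

Lemma Cc_fiberCc u f : Cc f -> fiberCc u f.
Proof.
move=> cf; split; first by apply: continuous_subspaceT; case: cf.
by have [K cK fK] := Cc_compact_support cf; exists K => // x _; exact: fK.
Qed.

(** The axioms of a Haar system concern C_c(G); this lemma makes them available for functions that
    live on one fibre. A continuous extension from a compact part of the fibre is multiplied by a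
    cutoff that is 1 on the support. *)
Lemma fiberCc_extension u f : fiberCc u f ->
  exists2 h, Cc h & forall x, rng x = u -> h x = f x.
Proof.
move=> [cf [K cK fK]].
have [k [ck k01 k1 sk _]] := compact_cutoff R lcG hG cK (@openT G) (@subsetT _ K).
(* Extending from [L] and not just from [K] forces [g] to vanish at those points of the fibre
   outside [K] where the cutoff [k] may still be nonzero. *)
pose L := closure [set x | k x != 0] `&` rfiber u.
have cL : compact L by apply: compact_closedI => //; exact: closed_rfiber.
have cfL : {within L, continuous f} by apply: continuous_subspaceW cf => x [].
have [g cg gf] := compact_cextension lcG hG cL cfL.
have kN x : ~ closure [set x | k x != 0] x -> k x = 0.
  by move=> nx; apply: contrapT => /eqP kx; apply: nx; exact: subset_closure.
exists (fun x => (k x)%:C * g x).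
  apply: Cc_intro.
    move=> x; apply: cvgM; last exact: cg.
    by apply: (continuous_comp (ck x)); exact: real_complex_continuous.
  by exists (closure [set x | k x != 0]) => // x /kN ->; rewrite mul0r.
move=> x xu; have [Kx|nKx] := pselect (K x).
  rewrite k1// mul1r gf//; split => //; apply: subset_closure => /=.
  by rewrite k1// oner_neq0.
have [Lx|nLx] := pselect (closure [set x | k x != 0] x).
  by rewrite gf// fK// mulr0.
by rewrite (kN _ nLx) mul0r fK.
Qed.

Lemma fiberCc_lin u (a : CC R) f g : fiberCc u f -> fiberCc u g ->
  fiberCc u (fun x => a * f x + g x).
Proof.
move=> [cf [K cK fK]] [cg [L cL gL]]; split.
  exact: (within_continuousD (within_continuousZ cf) cg).
exists (K `|` L); first exact: compactU.
by move=> x xu /not_orP[nK nL]; rewrite fK// gL// mulr0 addr0.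
Qed.

Lemma fiberCcZ u (a : CC R) f : fiberCc u f -> fiberCc u (fun x => a * f x).
Proof.
move=> [cf [K cK fK]]; split; first exact: (within_continuousZ cf).
by exists K => // x xu nK; rewrite fK// mulr0.
Qed.

Lemma fiberCcM u f g : fiberCc u f -> {within rfiber u, continuous g} ->
  fiberCc u (fun x => f x * g x).
Proof.
move=> [cf [K cK fK]] cg; split; first exact: (within_continuousM cf cg).
by exists K => // x xu nK; rewrite fK// mul0r.
Qed.

Lemma fiberCc_conj u f : fiberCc u f -> fiberCc u (fun x => (f x)^*%C : CC R).
Proof.
move=> [cf [K cK fK]]; split; first exact: (within_continuous_conj cf).
by exists K => // x xu nK; rewrite fK// conjc0.
Qed.

Lemma fiberCc_nrm u f : fiberCc u f -> fiberCc u (fun x => (nrm (f x))%:C).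
Proof.
move=> [cf [K cK fK]]; split.
  by apply: within_continuous_complex; exact: within_continuous_nrm.
by exists K => // x xu nK; rewrite fK// nrm0.
Qed.

Lemma fiberCc_translate x f : fiberCc (rng x) f -> fiberCc (src x) (fun y => f (mul x y)).
Proof.
move=> [cf [K cK fK]]; split.
  apply: (@within_continuous_comp _ _ _ _ (rfiber (rng x)) (fun y => mul x y)) cf.
    apply: within_continuous_mul => //; first exact: within_continuous_cst.
    exact: within_continuous_id.
  by move=> y /= yx; rewrite /rfiber /= rng_mul.
exists (mul (inv x) @` (K `&` rfiber (rng x))).
  apply: continuous_compact.
    apply: (@within_continuous_mul _ _ (fun=> inv x) id) => [||y [_ yx]]; last by rewrite src_inv yx.
      exact: within_continuous_cst.
    exact: within_continuous_id.
  by apply: compact_closedI => //; exact: closed_rfiber.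
move=> y yx nK; have rxy : rng (mul x y) = rng x by rewrite rng_mul.
apply: fK => // Kxy; apply: nK; exists (mul x y); first by split.
by rewrite inv_mulK.
Qed.

End GroupoidTopology.

(** * Integration over the fibres against the Haar system *)

Section HaarIntegral.
Variables (R : realType) (G : twisted_groupoid R).
Implicit Types (u v x y : G) (f g : G -> CC R).

Let hG : hausdorff_space G := @arrow_hausdorff G.
Let lcG : locally_compact [set: G] := @arrow_lc G.

Definition fint u f : CC R := cintegral (haar u) (rfiber u) f.
Definition fnorm1 u f : R := (\int[haar u]_(x in rfiber u) nrm (f x))%R.

Lemma haar_compact u (K : set G) : units u -> compact K -> (haar u K < +oo)%E.
Proof. by move=> uu; apply: radon_compact; apply: haar_radon uu; exact: haarP. Qed.

Lemma measurable_rfiber u v : measurable (rfiber u : set (borel v)).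
Proof. by apply: closed_measurable_borel; exact: closed_rfiber. Qed.

Lemma compact_fiber u (K : set G) : compact K -> compact (K `&` rfiber u).
Proof. by move=> cK; apply: compact_closedI => //; exact: closed_rfiber. Qed.

Lemma eq_fint u f g : (forall x, rng x = u -> f x = g x) -> fint u f = fint u g.
Proof. by move=> fg; apply: eq_cintegral => x /set_mem; exact: fg. Qed.

Lemma eq_fnorm1 u f g : (forall x, rng x = u -> nrm (f x) = nrm (g x)) ->
  fnorm1 u f = fnorm1 u g.
Proof. by move=> fg; apply: eq_Rintegral => x /set_mem; exact: fg. Qed.

Lemma eq_le_fnorm1 u f g : (forall x, rng x = u -> nrm (f x) = nrm (g x)) ->
  fnorm1 u f <= fnorm1 u g.
Proof. by move=> /eq_fnorm1 ->. Qed.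

Lemma fnorm1_ge0 u f : 0 <= fnorm1 u f.
Proof. by apply: Rintegral_ge0 => x _; exact: nrm_ge0. Qed.

Section Unit.
Variables (u : G) (uu : units u).

Lemma fiberCc_integrable f : fiberCc u f -> cintegrable (haar u) (rfiber u) f.
Proof.
move=> [cf [K cK fK]].
pose L := K `&` rfiber u; have cL : compact L := compact_fiber cK.
have mL : measurable (L : set (borel u)) by exact: compact_measurable_borel.
apply: (@cintegrable_subset R _ _ (haar u) _ _ f mL (@measurable_rfiber u u)) => [x []//|x xu nL|].
  by apply: fK => // Kx; exact: nL.
apply: (compact_integrable hG (fun K => @haar_compact u K uu) cL) => //.
by apply: continuous_subspaceW cf => x [].
Qed.

Lemma fint_lin (a : CC R) f g : fiberCc u f -> fiberCc u g ->
  fint u (fun x => a * f x + g x) = a * fint u f + fint u g.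
Proof.
by move=> cf cg; apply: cintegral_lin; [exact: measurable_rfiber|exact: fiberCc_integrable..].
Qed.

Lemma fintZ (a : CC R) f : fiberCc u f -> fint u (fun x => a * f x) = a * fint u f.
Proof.
by move=> cf; apply: cintegralZ; [exact: measurable_rfiber|exact: fiberCc_integrable].
Qed.

Lemma fintB f g : fiberCc u f -> fiberCc u g ->
  fint u (fun x => f x - g x) = fint u f - fint u g.
Proof.
by move=> cf cg; apply: cintegralB; [exact: measurable_rfiber|exact: fiberCc_integrable..].
Qed.

Lemma fint_conj f : fiberCc u f -> fint u (fun x => (f x)^*%C : CC R) = (fint u f)^*%C.
Proof.
by move=> cf; apply: cintegral_conj; [exact: measurable_rfiber|exact: fiberCc_integrable].
Qed.

Lemma fint0 : fint u (fun=> 0) = 0.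
Proof. by apply: cintegral0; exact: measurable_rfiber. Qed.

Lemma nrm_fint_le f : fiberCc u f -> nrm (fint u f) <= fnorm1 u f.
Proof.
by move=> cf; apply: nrm_cintegral_le; [exact: measurable_rfiber|exact: fiberCc_integrable].
Qed.

Lemma fnorm1_le f g : fiberCc u f -> fiberCc u g ->
  (forall x, rng x = u -> nrm (f x) <= nrm (g x)) -> fnorm1 u f <= fnorm1 u g.
Proof.
move=> cf cg fg; apply: le_Rintegral => //; first exact: measurable_rfiber.
- by apply: cintegrable_nrm; [exact: measurable_rfiber|exact: fiberCc_integrable].
- by apply: cintegrable_nrm; [exact: measurable_rfiber|exact: fiberCc_integrable].
Qed.

Lemma fnorm1Z (a : CC R) f : fiberCc u f -> fnorm1 u (fun x => a * f x) = nrm a * fnorm1 u f.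
Proof.
move=> cf; rewrite /fnorm1 -RintegralZl//; last 2 first.
- exact: measurable_rfiber.
- by apply: cintegrable_nrm; [exact: measurable_rfiber|exact: fiberCc_integrable].
by apply: eq_Rintegral => x _; rewrite nrmM.
Qed.

Lemma fint_fnorm1 f : fint u (fun x => (nrm (f x))%:C) = (fnorm1 u f)%:C.
Proof.
apply: complexE => //=.
by under eq_Rintegral do rewrite /=; rewrite Rintegral_cst ?mul0r//; exact: measurable_rfiber.
Qed.

Lemma Cc_integrable f : Cc f -> cintegrable (haar u) setT f.
Proof.
move=> cf; have [K cK fK] := Cc_compact_support cf.
have mK : measurable (K : set (borel u)) by exact: compact_measurable_borel.
apply: (@cintegrable_subset R _ _ (haar u) _ _ f mK measurableT) => // [x _|]; first exact: fK.
apply: (compact_integrable hG (fun K => @haar_compact u K uu) cK) => //.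
by apply: continuous_subspaceT; case: cf.
Qed.

Lemma integral_setT_fiber (h : G -> R) : (haar u).-integrable setT (EFin \o h) ->
  (\int[haar u]_x (h x)%:E = \int[haar u]_(x in rfiber u) (h x)%:E)%E.
Proof.
have N : haar u (~` rfiber u) = 0%E by exact: haar_support (haarP G) _ uu.
have mN : measurable (~` rfiber u : set (borel u)) by apply: measurableC; exact: measurable_rfiber.
move=> ih; rewrite (negligible_integral mN _ ih N)//.
by rewrite setTD setCK.
Qed.

Lemma fint_setT f : Cc f -> cintegral (haar u) setT f = fint u f.
Proof.
move=> /Cc_integrable[f1 f2].
by apply: complexE; rewrite /= /Rintegral integral_setT_fiber.
Qed.

Lemma integral_nrm f : Cc f -> (\int[haar u]_x (nrm (f x))%:E = (fnorm1 u f)%:E)%E.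
Proof.
move=> cf; have ci := cintegrable_nrm measurableT (Cc_integrable cf).
rewrite integral_setT_fiber// /fnorm1 fineK//; apply: integrable_fin_num => //.
  exact: measurable_rfiber.
by apply: cintegrable_nrm; [exact: measurable_rfiber|exact/fiberCc_integrable/Cc_fiberCc].
Qed.

End Unit.

(** The function is first extended from its fibre to C_c(G), where invariance is an axiom. *)
Lemma fint_invariant x f : fiberCc (rng x) f ->
  fint (rng x) f = fint (src x) (fun y => f (mul x y)).
Proof.
move=> cf; have [h ch hf] := fiberCc_extension cf.
transitivity (fint (rng x) h); first by apply: eq_fint => y yx; rewrite hf.
rewrite -fint_setT//; last exact: unit_rng.
rewrite (haar_invariant (haarP G))//; apply: eq_fint => y yx.
by rewrite hf// rng_mul.
Qed.

Lemma fnorm1_invariant x f : fiberCc (rng x) f ->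
  fnorm1 (rng x) f = fnorm1 (src x) (fun y => f (mul x y)).
Proof.
move=> cf; apply: complexI; rewrite -!fint_fnorm1.
by rewrite fint_invariant//; exact: fiberCc_nrm.
Qed.

(** Continuity holds on a product of fibres only, and the support lies in a compact rectangle: this
    is the class of kernels to which [fubini_compact] applies. *)
Definition fiber2Cc u v (F : G -> G -> CC R) :=
  {within rfiber u `*` rfiber v, continuous (fun z => F z.1 z.2)} /\
  exists K, exists2 L, compact K /\ compact L &
    forall x y, rng x = u -> rng y = v -> ~ (K x /\ L y) -> F x y = 0.

Lemma fiber2Cc_swap u v F : fiber2Cc u v F -> fiber2Cc v u (fun y x => F x y).
Proof.
move=> [cF [K [L [cK cL] FKL]]]; split.
  apply: (@within_continuous_comp _ _ _ _ (rfiber u `*` rfiber v) (fun z : G * G => (z.2, z.1)) _ _ _ cF).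
    apply: within_continuous_pair; [exact: within_continuous_snd|exact: within_continuous_fst].
  by move=> z /= [].
exists L, K; first by split.
by move=> y x yv xu n; apply: FKL => // -[Kx Ly]; apply: n.
Qed.

Lemma fiber2Cc_section u v F x : rng x = u -> fiber2Cc u v F -> fiberCc v (F x).
Proof.
move=> xu [cF [K [L [cK cL] FKL]]]; split.
  exact: (within_continuous_section cF).
by exists L => // y yv nL; apply: FKL => // -[].
Qed.

Section Fubini2.
Variables (u v : G) (F : G -> G -> CC R).
Hypotheses (uu : units u) (uv : units v) (cF : fiber2Cc u v F).

Lemma fiberCc_fint : fiberCc u (fun x => fint v (F x)).
Proof.
have [cF1 [K [L [cK cL] FKL]]] := cF.
pose L' := L `&` rfiber v; have cL' : compact L' := compact_fiber cL.
have E x : rng x = u -> fint v (F x) = cintegral (haar v) L' (F x).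
  move=> xu; apply: cintegral_subset => [y []//|y yv nL].
  by apply: FKL => // -[_ Ly]; apply: nL.
split; last first.
  exists K => // x xu nK; rewrite -[RHS](fint0 v); apply: eq_fint => y yv.
  by apply: FKL => // -[].
apply: (@subspace_eq_continuous _ _ _ (fun x => cintegral (haar v) L' (F x))).
  by move=> x /set_mem xu; symmetry; exact: E.
apply: (within_continuous_cintegral hG (fun K => @haar_compact v K uv) cL') => //.
  by apply: continuous_subspaceW cF1 => -[x y] [/= ? []].
by apply: compact_measurable_borel.
Qed.

Lemma fint_fubini : fint u (fun x => fint v (F x)) = fint v (fun y => fint u (F^~ y)).
Proof.
have [cF1 [K [L [cK cL] FKL]]] := cF.
pose L' := L `&` rfiber v; have cL' : compact L' := compact_fiber cL.
pose K' := K `&` rfiber u; have cK' : compact K' := compact_fiber cK.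
have E x : rng x = u -> fint v (F x) = cintegral (haar v) L' (F x).
  move=> xu; apply: cintegral_subset => [y []//|y yv nL].
  by apply: FKL => // -[_ Ly]; apply: nL.
have E' y : rng y = v -> fint u (F^~ y) = cintegral (haar u) K' (F^~ y).
  move=> yv; apply: cintegral_subset => [x []//|x xu nK].
  by apply: FKL => // -[Kx _]; apply: nK.
transitivity (cintegral (haar u) K' (fun x => cintegral (haar v) L' (F x))).
  rewrite (eq_fint E); apply: cintegral_subset => [x []//|x xu nK].
  rewrite -E// -[RHS](fint0 v); apply: eq_fint => y yv.
  by apply: FKL => // -[Kx _]; apply: nK.
transitivity (cintegral (haar v) L' (fun y => cintegral (haar u) K' (F^~ y))).
  apply: (fubini_compact hG hG (fun K => @haar_compact u K uu) (fun K => @haar_compact v K uv) cK' cL').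
  by apply: continuous_subspaceW cF1 => -[x y] [/= [? ?] []].
symmetry; rewrite (eq_fint E'); apply: cintegral_subset => [x []//|y yv nL].
rewrite -E'// -[RHS](fint0 u); apply: eq_fint => x xu.
by apply: FKL => // -[_ Ly]; apply: nL.
Qed.

End Fubini2.

Section Parametrized.
Variables (Z : topologicalType) (a : Z -> G) (q : Z -> G -> CC R) (g : G -> CC R).
Hypotheses (ca : continuous a) (ua : forall z, units (a z)) (cg : Cc g).
Hypothesis cq : {within [set p : G * Z | rng p.1 = a p.2],
  continuous (fun p => q p.2 p.1)}.

Lemma fint_continuous f : Cc f -> continuous (fun z => fint (a z) f).
Proof.
move=> cf z0.
have -> : (fun z => fint (a z) f) = (fun u => cintegral (haar u) setT f) \o a.
  by apply/funext => z /=; rewrite fint_setT.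
have : {within [set: Z], continuous ((fun u => cintegral (haar u) setT f) \o a)}.
  apply: (@within_continuous_comp _ _ _ _ (@units G)) => //.
    exact: continuous_subspaceT.
  exact: (haar_continuous (haarP G)).
by move=> /subspace_continuousP/(_ z0 I); rewrite withinET.
Qed.

Let fiber_sep y z0 : rng y <> a z0 -> \forall p \near (y, z0), ~ rng p.1 = a p.2.
Proof.
move=> /eqP ya; move: (hG); rewrite open_hausdorff => /(_ _ _ ya).
move=> [[A B]] /= [/set_mem Ay /set_mem Bz] [oA oB AB0].
have cr : continuous (fun p : G * Z => rng p.1).
  by move=> p; apply: continuous_comp; [exact: cvg_fst|exact: rng_continuous].
have cs : continuous (fun p : G * Z => a p.2).
  by move=> p; apply: continuous_comp; [exact: cvg_snd|exact: ca].
have cA : \forall p \near (y, z0), A (rng p.1).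
  by apply: (cr (y, z0)); exact: open_nbhs_nbhs.
have cB : \forall p \near (y, z0), B (a p.2).
  by apply: (cs (y, z0)); exact: open_nbhs_nbhs.
near=> p => yz; have : (A `&` B) (rng p.1).
  by split; [near: p|rewrite yz; near: p].
by move/eqP: AB0 => ->.
Unshelve. all: by end_near. Qed.

(** Both the fibre and the integrand move with [z]. The integrand at [z0] is frozen, as a function
    [g * h] in C_c(G) whose integral is continuous by the Haar axiom. The error [g * (q z - h)] is
    uniformly small near [z0] by [tube_lemma], and the measures of the support on nearby fibres are
    bounded. *)
Lemma fint_parametrized_continuous :
  continuous (fun z => fint (a z) (fun y => g y * q z y)).
Proof.
move=> z0; have [K cK gK] := Cc_compact_support cg.
have [M M0 gM] := Cc_bounded cg.
pose D0 := K `&` rfiber (a z0); have cD0 : compact D0 := compact_fiber cK.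
have cqz z : {within rfiber (a z), continuous (q z)}.
  apply: (@within_continuous_comp _ _ _ _ _ (fun y => (y, z)) _ _ _ cq) => //.
  by apply: within_continuous_pair; [exact: within_continuous_id|exact: within_continuous_cst].
(* [h] continues [q z0] from the compact part of its fibre that meets the support of [g]; elsewhere
   [g] vanishes and [h] is free. *)
have [h ch hq] : exists2 h : G -> CC R, continuous h & forall x, D0 x -> h x = q z0 x.
  by apply: compact_cextension => //; apply: continuous_subspaceW (cqz z0) => x [].
have cgh : Cc (fun y => g y * h y).
  apply: Cc_intro; last by exists K => // x /gK ->; rewrite mul0r.
  by move=> x; apply: cvgM; [case: cg => + _; apply|exact: ch].
have [k [ck k01 k1 sk _]] := compact_cutoff R lcG hG cK (@openT G) (@subsetT _ K).
pose kc y : CC R := (k y)%:C.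
have ckc : Cc kc.
  apply: Cc_intro => [y|]; first by apply: (continuous_comp (ck y)); exact: real_complex_continuous.
  exists (closure [set x | k x != 0]) => // x nx; rewrite /kc.
  suff -> : k x = 0 by [].
  by apply: contrapT => /eqP kx; apply: nx; exact: subset_closure.
(* The integral of the cutoff [kc] is continuous in [z], so near [z0] it exceeds its value at [z0]
   by less than 1. As [kc] is 1 on [K], this controls the mass of [K] on nearby fibres. *)
pose B := nrm (fint (a z0) kc) + 1.
have B0 : 0 <= B by rewrite addr_ge0 ?nrm_ge0.
have kB : \forall z \near z0, fnorm1 (a z) kc <= B.
  have /cvg_nrmP/(_ 1 ltr01) := @fint_continuous _ ckc z0; apply: filterS => z zB.
  have -> : fnorm1 (a z) kc = nrm (fint (a z) kc).
    rewrite -[LHS]ger0_norm ?fnorm1_ge0// -nrm_real -fint_fnorm1//; congr nrm.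
    apply: eq_fint => y _; rewrite nrm_real ger0_norm//.
    by have /andP[] := k01 y.
  rewrite /B addrC -lerBlDr; apply: le_trans (ltW zB); rewrite nrmB.
  by rewrite lerBlDr; apply: le_trans (nrmD _ _); rewrite subrK.
apply/(@cvg_nrmP R (CC R) _ _ (@nbhs_filter Z z0)) => e e0.
have e2 : 0 < e / 2 by rewrite divr_gt0.
have MB : 0 < M * B + 1 by rewrite ltr_wpDl// mulr_ge0.
(* Chosen so that [M * d * B], the bound on the error term, is at most [e / 2]; the summand 1 in the
   denominator keeps it positive. *)
pose d := e / 2 / (M * B + 1); have d0 : 0 < d by rewrite divr_gt0.
have cPhi : {within [set p : G * Z | rng p.1 = a p.2],
    continuous (fun p : G * Z => q p.2 p.1 - h p.1)}.
  apply: (within_continuousB cq); apply: (within_continuous_compl _ ch).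
  exact: within_continuous_fst.
have T1 : forall y, K y -> rng y = a z0 -> q z0 y - h y = 0.
  by move=> y Ky ya; rewrite hq ?subrr.
have := tube_lemma cK cPhi T1 (fun y _ => @fiber_sep y z0) d0 => near_q.
have /cvg_nrmP/(_ _ e2) near_J := @fint_continuous _ cgh z0.
near=> z.
have -> : fint (a z0) (fun y => g y * q z0 y) = fint (a z0) (fun y => g y * h y).
  apply: eq_fint => y ya; have [Ky|nKy] := pselect (K y); first by rewrite hq.
  by rewrite gK// !mul0r.
rewrite -(subrKA (fint (a z) (fun y => g y * h y))).
apply: le_lt_trans (nrmD _ _) _; rewrite (splitr e) ltr_leD//; first by near: z.
have cgz : fiberCc (a z) (fun y => g y * q z y).
  exact: (fiberCcM (Cc_fiberCc (a z) cg) (cqz z)).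
have cghz := Cc_fiberCc (a z) cgh; rewrite -(fintB (ua z) cghz cgz).
have cd : fiberCc (a z) (fun y => g y * h y - g y * q z y).
  have := fiberCc_lin (-1) cgz cghz.
  by under eq_fun do rewrite mulN1r addrC.
apply: le_trans (nrm_fint_le (ua z) cd) _.
apply: (@le_trans _ _ (fnorm1 (a z) (fun y => (M * d)%:C * kc y))).
  have ckz : fiberCc (a z) (fun y => (M * d)%:C * kc y).
    exact: (fiberCcZ _ (Cc_fiberCc (a z) ckc)).
  apply: (fnorm1_le (ua z) cd ckz) => y ya; have [Ky|nKy] := pselect (K y); last first.
    by rewrite gK// !mul0r subrr nrm0 nrm_ge0.
  rewrite -mulrBr nrmM nrmM /kc k1// nrm1 mulr1 nrm_real ger0_norm; last first.
    by rewrite mulr_ge0// ltW.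
  rewrite ler_pM ?nrm_ge0// nrmB ltW//.
  have : forall y, K y -> rng y = a z -> nrm (q z y - h y) < d by near: z.
  by apply.
rewrite (fnorm1Z (ua z) _ (Cc_fiberCc (a z) ckc)).
have Md0 : 0 <= M * d by rewrite mulr_ge0// ltW.
rewrite nrm_real ger0_norm//.
apply: (@le_trans _ _ (M * d * B)).
  by rewrite ler_wpM2l//; near: z.
rewrite mulrAC /d mulrCA -[leRHS]mulr1 ler_wpM2l//; first exact: ltW.
by rewrite ler_pdivrMr// mul1r lerDl.
Unshelve. all: by end_near. Qed.

End Parametrized.

End HaarIntegral.

Lemma closed_equalizer (S T : topologicalType) (a b : S -> T) : hausdorff_space T ->
  continuous a -> continuous b -> closed [set z | a z = b z].
Proof.
move=> hT ca cb; rewrite -[X in closed X]setCK; apply: open_closedC.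
rewrite openE => z /= /eqP ab; move: hT; rewrite open_hausdorff => /(_ _ _ ab).
move=> [[A B]] /= [/set_mem Az /set_mem Bz] [oA oB AB0].
have cA : \forall p \near z, A (a p) by apply: (ca z); exact: open_nbhs_nbhs.
have cB : \forall p \near z, B (b p) by apply: (cb z); exact: open_nbhs_nbhs.
rewrite /interior; near=> p => /= yz; have : (A `&` B) (a p).
  by split; [near: p|rewrite yz; near: p].
by move/eqP: AB0 => ->.
Unshelve. all: by end_near. Qed.

(** * Convolution of compactly supported functions *)

Section Convolution.
Variables (R : realType) (G : twisted_groupoid R).
Implicit Types (u v x y z : G) (f g h : G -> CC R).
Let hG : hausdorff_space G := @arrow_hausdorff G.

Definition mulset (K L : set G) : set G :=
  (fun z : G * G => mul z.1 z.2) @` (K `*` L `&` @composable G).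

Lemma compact_mulset (K L : set G) : compact K -> compact L -> compact (mulset K L).
Proof.
move=> cK cL; apply: continuous_compact.
  apply: continuous_subspaceW (@mul_continuous G); exact: subIsetr.
apply: compact_closedI; first exact: compact_setX.
apply: closed_equalizer => //.
- by move=> z; apply: continuous_comp; [exact: cvg_fst|exact: src_continuous].
- by move=> z; apply: continuous_comp; [exact: cvg_snd|exact: rng_continuous].
Qed.

Definition invset (K : set G) : set G := @inv G @` K.

Lemma compact_invset (K : set G) : compact K -> compact (invset K).
Proof.
by move=> cK; apply: continuous_compact => //; apply: continuous_subspaceT; exact: inv_continuous.
Qed.

Lemma invM x y : src x = rng y -> inv (mul x y) = mul (inv y) (inv x).
Proof.
move=> xy; have yx : src (inv y) = rng (inv x) by rewrite src_inv rng_inv xy.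
have pq : mul (mul x y) (mul (inv y) (inv x)) = rng (mul x y).
  have e : src y = rng (mul (inv y) (inv x)) by rewrite rng_mul// rng_inv.
  rewrite -(mul_assoc xy e) mul_invK; last by rewrite rng_inv.
  by rewrite mul_inv rng_mul.
by rewrite -[LHS]mul_src src_inv -pq inv_mulK// src_mul// rng_mul// rng_inv.
Qed.

Lemma mulK_inv x y : src x = rng y -> mul (mul x y) (inv y) = x.
Proof.
by move=> xy; rewrite -mul_assoc ?rng_inv// mul_inv -xy mul_src.
Qed.

Lemma Cc_inv f : Cc f -> Cc (fun x => f (inv x)).
Proof.
move=> cf; have [K cK fK] := Cc_compact_support cf; apply: Cc_intro.
  by move=> x; apply: continuous_comp; [exact: inv_continuous|case: cf => + _; apply].
exists (invset K); first exact: compact_invset.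
by move=> x nx; apply: fK => Kx; apply: nx; exists (inv x) => //; exact: invK.
Qed.

Lemma Cc_lin (a : CC R) f g : Cc f -> Cc g -> Cc (fun x => a * f x + g x).
Proof.
move=> cf cg; have [K cK fK] := Cc_compact_support cf.
have [L cL gL] := Cc_compact_support cg; apply: Cc_intro.
  move=> x; apply: cvgD; last by case: cg => + _; apply.
  by apply: cvgM; [exact: cvg_cst|case: cf => + _; apply].
exists (K `|` L); first exact: compactU.
by move=> x /not_orP[nK nL]; rewrite fK// gL// mulr0 addr0.
Qed.

Lemma Cc0 : Cc (fun _ : G => 0 : CC R).
Proof. by apply: Cc_intro => [x|]; [exact: cvg_cst|exists set0 => //; exact: compact0]. Qed.

Lemma CcZ (a : CC R) f : Cc f -> Cc (fun x => a * f x).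
Proof.
move=> cf; have [K cK fK] := Cc_compact_support cf; apply: Cc_intro.
  by move=> x; apply: cvgM; [exact: cvg_cst|case: cf => + _; apply].
by exists K => // x nK; rewrite fK// mulr0.
Qed.

Lemma CcM f g : Cc f -> continuous g -> Cc (fun x => g x * f x).
Proof.
move=> cf cg; have [K cK fK] := Cc_compact_support cf; apply: Cc_intro.
  by move=> x; apply: cvgM; [exact: cg|case: cf => + _; apply].
by exists K => // x nK; rewrite fK// mulr0.
Qed.

Lemma Cc_conj f : Cc f -> Cc (fun x => (f x)^*%C : CC R).
Proof.
move=> cf; have [K cK fK] := Cc_compact_support cf; apply: Cc_intro.
  by move=> x; apply: continuous_comp; [case: cf => + _; apply|exact: conj_continuous].
by exists K => // x nK; rewrite fK// conjc0.
Qed.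

Lemma within_continuous_Cc (S : topologicalType) (D : set S) (a : S -> G) f :
  {within D, continuous a} -> Cc f -> {within D, continuous (fun s => f (a s))}.
Proof. by move=> ca [cf _]; exact: (within_continuous_compl ca cf). Qed.

Lemma convE f g x : conv f g x = fint (src x)
  (fun y => f (mul x y) * g (inv y) * twist (mul x y) (inv y)).
Proof. by []. Qed.

Lemma fiberCc_conv x f g : Cc f -> Cc g ->
  fiberCc (src x) (fun y => f (mul x y) * g (inv y) * twist (mul x y) (inv y)).
Proof.
move=> cf cg; have [L cL gL] := Cc_compact_support cg.
have cm : {within rfiber (src x), continuous (fun y => mul x y)}.
  apply: within_continuous_mul => //; first exact: within_continuous_cst.
  exact: within_continuous_id.
have ci : {within rfiber (src x), continuous (fun y : G => inv y)}.
  exact: (within_continuous_inv (@within_continuous_id _ _)).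
split.
  apply: (within_continuousM (within_continuousM (within_continuous_Cc cm cf) (within_continuous_Cc ci cg))).
  apply: (within_continuous_twist cm ci) => y /= yx.
  by rewrite src_mul ?rng_inv.
exists (invset L); first exact: compact_invset.
move=> y yx nL; rewrite (gL (inv y)) ?mulr0 ?mul0r// => Ly; apply: nL.
by exists (inv y) => //; rewrite invK.
Qed.

Lemma fiberCc_shift f g x y : Cc f -> Cc g -> src x = rng y -> fiberCc (rng y)
  (fun z => f (mul x z) * g (mul (inv z) y) * twist (mul x z) (mul (inv z) y)).
Proof.
move=> cf cg xy; have [K cK fK] := Cc_compact_support cf.
have cm : {within rfiber (rng y), continuous (fun y => mul x y)}.
  apply: within_continuous_mul => //; first exact: within_continuous_cst.
    exact: within_continuous_id.
  by move=> z /= ->.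
have ci : {within rfiber (rng y), continuous (fun z : G => mul (inv z) y)}.
  apply: within_continuous_mul; last by move=> z /= <-; rewrite src_inv.
    exact: (within_continuous_inv (@within_continuous_id _ _)).
  exact: within_continuous_cst.
split.
  apply: (within_continuousM (within_continuousM (within_continuous_Cc cm cf) (within_continuous_Cc ci cg))).
  apply: (within_continuous_twist cm ci) => z /= zy.
  by rewrite src_mul ?rng_mul ?src_inv ?rng_inv ?xy.
exists (mulset [set inv x] K); first by apply: compact_mulset => //; exact: compact_set1.
move=> z zy nK; rewrite fK ?mul0r// => Kz; apply: nK.
exists (inv x, mul x z); last by rewrite /= inv_mulK// xy zy.
by split => //=; rewrite /composable /= src_inv rng_mul// xy zy.
Qed.

(** Left invariance in the form of the substitution [z = y w], for which [z^-1 y = w^-1]. *)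
Lemma conv_shift f g x y : Cc f -> Cc g -> src x = rng y ->
  conv f g (mul x y) = fint (rng y)
    (fun z => f (mul x z) * g (mul (inv z) y) * twist (mul x z) (mul (inv z) y)).
Proof.
move=> cf cg xy; rewrite convE src_mul// (fint_invariant (fiberCc_shift cf cg xy)).
apply: eq_fint => w wy; have yw : src y = rng w by [].
rewrite -(mul_assoc xy yw).
suff -> : mul (inv (mul y w)) y = inv w by [].
rewrite invM// -mul_assoc ?src_inv ?rng_inv// inv_mul yw.
by rewrite -src_inv mul_src.
Qed.

Lemma convE_rng f g x : Cc f -> Cc g -> conv f g x = fint (rng x)
  (fun z => f z * g (mul (inv z) x) * twist z (mul (inv z) x)).
Proof.
move=> cf cg; rewrite -{1}[x]mul_rng conv_shift ?src_rng//.
by apply: eq_fint => z zx; rewrite -zx mul_rng.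
Qed.

Lemma Cc_conv f g : Cc f -> Cc g -> Cc (conv f g).
Proof.
move=> cf cg; have [K cK fK] := Cc_compact_support cf.
have [L cL gL] := Cc_compact_support cg; apply: Cc_intro; last first.
  exists (mulset K L); first exact: compact_mulset.
  move=> x nx; rewrite convE -(fint0 (src x)); apply: eq_fint => y yx.
  have [Kxy|/fK ->] := pselect (K (mul x y)); last by rewrite !mul0r.
  have [Ly|/gL ->] := pselect (L (inv y)); last by rewrite mulr0 mul0r.
  case: nx; exists (mul x y, inv y); last by rewrite /= mulK_inv.
  by split => //; rewrite /composable /= src_mul// rng_inv.
(* The factor [g (inv y)] is compactly supported and independent of [x]; the remaining factors,
   defined only on the fibre over [src x], form the parametrised kernel. *)
have -> : conv f g = fun x => fint (src x)
    (fun y => g (inv y) * (f (mul x y) * twist (mul x y) (inv y))).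
  by apply/funext => x; rewrite convE; apply: eq_fint => y _; rewrite mulrCA mulrA.
apply: (fint_parametrized_continuous (@src_continuous _ G) (@unit_src _ G) (Cc_inv cg)
  (q := fun x y => f (mul x y) * twist (mul x y) (inv y))).
have cm : {within [set p : G * G | rng p.1 = src p.2], continuous (fun p => mul p.2 p.1)}.
  by apply: within_continuous_mul; [exact: within_continuous_snd|exact: within_continuous_fst|].
apply: (within_continuousM (within_continuous_Cc cm cf)).
apply: (within_continuous_twist cm (within_continuous_inv (@within_continuous_fst _ _ _))).
by move=> p /= pp; rewrite src_mul// rng_inv.
Qed.

Lemma twist_inv_continuous : continuous (fun x : G => twist x (inv x)).
Proof.
move=> x; have /subspace_continuousP/(_ x I) :
    {within [set: G], continuous (fun x : G => twist x (inv x))}.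
  apply: within_continuous_twist => [||y _]; last by rewrite rng_inv.
    exact: within_continuous_id.
  exact: (within_continuous_inv (@within_continuous_id _ _)).
by rewrite withinET.
Qed.

Lemma twist_rng_continuous : continuous (fun x : G => twist (rng x) (rng x)).
Proof.
move=> x; have /subspace_continuousP/(_ x I) :
    {within [set: G], continuous (fun x : G => twist (rng x) (rng x))}.
  apply: within_continuous_twist => [||y _]; last by rewrite src_rng rng_rng.
    by apply: continuous_subspaceT; exact: rng_continuous.
  by apply: continuous_subspaceT; exact: rng_continuous.
by rewrite withinET.
Qed.

Lemma Cc_star f : Cc f -> Cc (star f).
Proof.
move=> cf; rewrite /star; apply: Cc_conj.
have := CcM (Cc_inv cf) twist_inv_continuous.
by congr Cc; apply/funext => x; rewrite mulrC.
Qed.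

Lemma Cc_star_red f : Cc f -> Cc (star_red f).
Proof.
move=> cf; apply: (CcM (Cc_star cf)).
move=> x; apply: (@continuous_comp _ _ _ (fun x : G => twist (rng x) (rng x))
  (fun z : CC R => z^*%C : CC R)); [exact: twist_rng_continuous|exact: conj_continuous].
Qed.

End Convolution.

(** * Associativity, adjoints and the norm [normI] *)

Section ConvolutionAlgebra.
Variables (R : realType) (G : twisted_groupoid R).
Implicit Types (u v x y z : G) (f g h xi eta : G -> CC R).

Section Kernels.
Variables (u : G).
Let D := rfiber u `*` rfiber u.
Let D1 p : D p -> rng p.1 = u. Proof. by case. Qed.
Let D2 p : D p -> rng p.2 = u. Proof. by case. Qed.

Lemma within_continuous_inv1_mul2 :
  {within D, continuous (fun p : G * G => mul (inv p.1) p.2)}.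
Proof.
apply: within_continuous_mul; last by move=> p Dp; rewrite src_inv (D1 Dp) (D2 Dp).
  exact: (within_continuous_inv (@within_continuous_fst _ _ _)).
exact: within_continuous_snd.
Qed.

Lemma within_continuous_inv2_mul1 :
  {within D, continuous (fun p : G * G => mul (inv p.2) p.1)}.
Proof.
apply: within_continuous_mul; last by move=> p Dp; rewrite src_inv (D1 Dp) (D2 Dp).
  exact: (within_continuous_inv (@within_continuous_snd _ _ _)).
exact: within_continuous_fst.
Qed.

Let ci1 : {within D, continuous (fun p : G * G => inv p.1)} :=
  within_continuous_inv (@within_continuous_fst _ _ _).
Let ci2 : {within D, continuous (fun p : G * G => inv p.2)} :=
  within_continuous_inv (@within_continuous_snd _ _ _).

Lemma assoc_kernel x f g h : src x = u -> Cc f -> Cc g -> Cc h ->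
  fiber2Cc u u (fun y z => f (mul x z) * g (mul (inv z) y) *
    twist (mul x z) (mul (inv z) y) * (h (inv y) * twist (mul x y) (inv y))).
Proof.
move=> xu cf cg ch; have [K cK fK] := Cc_compact_support cf.
have [L cL hL] := Cc_compact_support ch.
have c1 : {within D, continuous (fun p : G * G => mul x p.2)}.
  apply: within_continuous_mul; [exact: within_continuous_cst|exact: within_continuous_snd|].
  by move=> p Dp; rewrite (D2 Dp).
have c2 : {within D, continuous (fun p : G * G => mul x p.1)}.
  apply: within_continuous_mul; [exact: within_continuous_cst|exact: within_continuous_fst|].
  by move=> p Dp; rewrite (D1 Dp).
have t1 : {within D, continuous (fun p : G * G => twist (mul x p.2) (mul (inv p.2) p.1))}.
  apply: (within_continuous_twist c1 within_continuous_inv2_mul1) => p Dp.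
  by rewrite src_mul ?rng_mul ?src_inv ?rng_inv ?(D1 Dp) ?(D2 Dp).
have t2 : {within D, continuous (fun p : G * G => twist (mul x p.1) (inv p.1))}.
  apply: (within_continuous_twist c2 ci1) => p Dp.
  by rewrite src_mul ?rng_inv ?(D1 Dp).
split.
  exact: (within_continuousM (within_continuousM (within_continuousM
    (within_continuous_Cc c1 cf) (within_continuous_Cc within_continuous_inv2_mul1 cg)) t1)
    (within_continuousM (within_continuous_Cc ci1 ch) t2)).
exists (invset L), (mulset [set inv x] K).
  split; [exact: compact_invset|apply: compact_mulset => //; exact: compact_set1].
move=> y z yu zu nKL; have [Ly|nL] := pselect (L (inv y)); last by rewrite (hL _ nL) mul0r mulr0.
rewrite fK ?mul0r// => Kz; apply: nKL; split.
  by exists (inv y) => //; rewrite invK.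
exists (inv x, mul x z); last by rewrite /= inv_mulK// xu zu.
by split => //=; rewrite /composable /= src_inv rng_mul// xu zu.
Qed.

Lemma pairing_kernel f xi eta : Cc f -> Cc xi -> Cc eta ->
  fiber2Cc u u (fun x y => f (mul (inv x) y) * xi (inv y) *
    twist (mul (inv x) y) (inv y) * (eta (inv x))^*%C).
Proof.
move=> cf cxi ceta; have [K cK xiK] := Cc_compact_support cxi.
have [L cL etaL] := Cc_compact_support ceta.
have t1 : {within D, continuous (fun p : G * G => twist (mul (inv p.1) p.2) (inv p.2))}.
  apply: (within_continuous_twist within_continuous_inv1_mul2 ci2) => p Dp.
  by rewrite src_mul ?rng_inv ?src_inv ?(D1 Dp) ?(D2 Dp).
split.
  exact: (within_continuousM (within_continuousM (within_continuousM
    (within_continuous_Cc within_continuous_inv1_mul2 cf) (within_continuous_Cc ci2 cxi)) t1)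
    (within_continuous_conj (within_continuous_Cc ci1 ceta))).
exists (invset L), (invset K); first by split; exact: compact_invset.
move=> x y xu yu nKL; have [Ky|nK] := pselect (K (inv y)); last first.
  by rewrite (xiK _ nK) mulr0 !mul0r.
rewrite (etaL (inv x)) ?conjc0 ?mulr0// => Lx; apply: nKL.
by split; [exists (inv x) => //|exists (inv y) => //]; rewrite invK.
Qed.

Lemma convl_kernel f g : Cc f -> Cc g ->
  fiber2Cc u u (fun x z => f z * g (mul (inv z) x) * twist z (mul (inv z) x)).
Proof.
move=> cf cg; have [K cK fK] := Cc_compact_support cf.
have [L cL gL] := Cc_compact_support cg.
have t1 : {within D, continuous (fun p : G * G => twist p.2 (mul (inv p.2) p.1))}.
  apply: (within_continuous_twist (@within_continuous_snd _ _ _) within_continuous_inv2_mul1) => p Dp.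
  by rewrite rng_mul ?rng_inv ?src_inv ?(D1 Dp) ?(D2 Dp).
split.
  exact: (within_continuousM (within_continuousM
    (within_continuous_Cc (@within_continuous_snd _ _ _) cf)
    (within_continuous_Cc within_continuous_inv2_mul1 cg)) t1).
exists (mulset K L), K; first by split => //; exact: compact_mulset.
move=> x z xu zu nKL; have [Kz|nK] := pselect (K z); last by rewrite (fK _ nK) !mul0r.
rewrite (gL (mul (inv z) x)) ?mulr0 ?mul0r// => Lx; apply: nKL; split => //.
exists (z, mul (inv z) x); last by rewrite /= mul_invK// xu zu.
by split => //; rewrite /composable /= rng_mul ?rng_inv ?src_inv// xu zu.
Qed.

Lemma convr_kernel f g : Cc f -> Cc g ->
  fiber2Cc u u (fun x y => f (mul (inv x) y) * g (inv y) * twist (mul (inv x) y) (inv y)).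
Proof.
move=> cf cg; have [K cK fK] := Cc_compact_support cf.
have [L cL gL] := Cc_compact_support cg.
have t1 : {within D, continuous (fun p : G * G => twist (mul (inv p.1) p.2) (inv p.2))}.
  apply: (within_continuous_twist within_continuous_inv1_mul2 ci2) => p Dp.
  by rewrite src_mul ?rng_inv ?src_inv ?(D1 Dp) ?(D2 Dp).
split.
  exact: (within_continuousM (within_continuousM
    (within_continuous_Cc within_continuous_inv1_mul2 cf) (within_continuous_Cc ci2 cg)) t1).
have cL' := compact_invset cL; have cK' := compact_invset cK.
exists (mulset (invset L) (invset K)), (invset L); first by split => //; exact: compact_mulset.
move=> x y xu yu nKL; have [Ly|nL] := pselect (L (inv y)); last first.
  by rewrite (gL _ nL) mulr0 mul0r.
rewrite fK ?mul0r// => Kxy; apply: nKL.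
have Ly' : invset L y by exists (inv y) => //; rewrite invK.
split => //; exists (y, mul (inv y) x); last by rewrite /= mul_invK// xu yu.
split; last by rewrite /composable /= rng_mul ?rng_inv ?src_inv// xu yu.
split => //=; exists (mul (inv x) y) => //.
by rewrite invM ?invK// src_inv xu yu.
Qed.

End Kernels.

(** With [conv_shift] the left side becomes a double integral. After [fint_fubini] the two
    integrands differ by their twists only, which the cocycle identity at [x z], [z^-1 y], [y^-1]
    reconciles. *)
Lemma convA f g h : Cc f -> Cc g -> Cc h -> conv (conv f g) h = conv f (conv g h).
Proof.
move=> cf cg ch; apply/funext => x; rewrite 2!convE; set s := src x.
have us : units s by exact: unit_src.
have cF := assoc_kernel (erefl s) cf cg ch; rewrite -/s in cF.
pose F y z := f (mul x z) * g (mul (inv z) y) *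
    twist (mul x z) (mul (inv z) y) * (h (inv y) * twist (mul x y) (inv y)).
transitivity (fint s (fun y => fint s (F y))).
  apply: eq_fint => y ys; rewrite (@conv_shift _ _ f g x y cf cg (esym ys)).
  rewrite -mulrA mulrC -(fintZ (unit_rng y) _ (fiberCc_shift cf cg (esym ys))) ys.
  by apply: eq_fint => z _; rewrite mulrC.
rewrite (fint_fubini us us cF); apply: eq_fint => z zs.
rewrite convE src_inv zs mulrAC -[RHS]mulrC.
have ci := fiberCc_conv (inv z) cg ch; rewrite src_inv zs in ci.
rewrite mulrC -(fintZ us _ ci); apply: eq_fint => y ys.
have e1 : src (mul x z) = rng (mul (inv z) y).
  by rewrite src_mul ?rng_mul ?rng_inv ?src_inv// zs ys.
have e2 : src (mul (inv z) y) = rng (inv y) by rewrite src_mul ?rng_inv ?src_inv// zs ys.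
have E := cocycleP (twistP G) e1 e2.
have m1 : mul (mul x z) (mul (inv z) y) = mul x y.
  rewrite -mul_assoc ?zs ?rng_mul ?rng_inv ?src_inv ?zs ?ys// mul_invK// zs ys//.
have m2 : mul (mul (inv z) y) (inv y) = inv z by rewrite mulK_inv// src_inv zs ys.
rewrite m1 m2 in E.
transitivity (f (mul x z) * g (mul (inv z) y) * h (inv y) *
  (twist (mul x z) (mul (inv z) y) * twist (mul x y) (inv y))); first by rewrite /F; ring.
by rewrite E; ring.
Qed.

(** The cocycle identity at [u], [u], [x], after cancelling the unimodular factor [twist u x].
    Through this constant an unnormalised cocycle enters the adjoint formula. *)
Lemma twist_unit_l u x : rng x = u -> twist u x = twist u u :> CC R.
Proof.
move=> xu; have uu : rng u = u by rewrite -xu rng_rng.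
have su : src u = u by rewrite -uu src_rng.
have e1 : src u = rng u by rewrite su uu.
have e2 : src u = rng x by rewrite su xu.
have m1 : mul u u = u by rewrite -{1}uu mul_rng.
have m2 : mul u x = x by rewrite -xu mul_rng.
have := cocycleP (twistP G) e1 e2; rewrite m1 m2.
move=> /mulIf ->//; rewrite -normr_eq0 (cocycle_norm (twistP G) e2).
exact: oner_neq0.
Qed.

Lemma nrm_twist x y : src x = rng y -> nrm (twist x y : CC R) = 1.
Proof. by move=> xy; rewrite /nrm (cocycle_norm (twistP G) xy). Qed.

Lemma twist_conj x y : src x = rng y -> twist x y * (twist x y)^*%C = 1 :> CC R.
Proof. by move=> xy; rewrite mul_conjr nrm_twist// expr1n. Qed.

(* The inner product of L^2(G_u, mu_u), mu_u being the image of mu^u under inversion. *)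
Definition pairing u f g : CC R := fint u (fun y => f (inv y) * (g (inv y))^*%C).

(** Both sides are double integrals over the fibre, exchanged by [fint_fubini]. With [k = x^-1 y],
    the cocycle identity at [k^-1], [k], [y^-1] relates the two twists up to the value of the
    cocycle at the unit [src y]; the extra factor of [star_red] is the conjugate of this value. *)
Lemma pairing_adjoint u f xi eta : units u -> Cc f -> Cc xi -> Cc eta ->
  pairing u (conv f xi) eta = pairing u xi (conv (star_red f) eta).
Proof.
move=> uu cf cxi ceta.
have cF := pairing_kernel u cf cxi ceta.
transitivity (fint u (fun x => fint u (fun y => f (mul (inv x) y) * xi (inv y) *
    twist (mul (inv x) y) (inv y) * (eta (inv x))^*%C))).
  apply: eq_fint => x xu; rewrite convE src_inv xu mulrC.
  have ci := fiberCc_conv (inv x) cf cxi; rewrite src_inv xu in ci.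
  by rewrite -(fintZ uu _ ci); apply: eq_fint => y yu; rewrite mulrC.
rewrite (fint_fubini uu uu cF); apply: eq_fint => y yu.
rewrite convE src_inv yu.
have ci := fiberCc_conv (inv y) (Cc_star_red cf) ceta; rewrite src_inv yu in ci.
rewrite -(fint_conj uu ci).
rewrite -(fintZ uu _ (fiberCc_conj ci)); apply: eq_fint => x xu.
have xy : src (inv x) = rng y by rewrite src_inv xu yu.
have yx : src (inv y) = rng x by rewrite src_inv xu yu.
set k := mul (inv x) y; set k' := mul (inv y) x.
have kk' : inv k' = k by rewrite /k' invM// invK.
have k'k : inv k = k' by rewrite /k invM// invK.
have sk : src k = src y by rewrite /k src_mul.
have rk : rng k = src x by rewrite /k rng_mul// rng_inv.
have sk' : src k' = src x by rewrite /k' src_mul.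
have rk' : rng k' = src y by rewrite /k' rng_mul// rng_inv.
have e1 : src k' = rng k by rewrite sk' rk.
have e2 : src k = rng (inv y) by rewrite sk rng_inv.
have e3 : src k' = rng (inv x) by rewrite sk' rng_inv.
have m1 : mul k' k = src y by rewrite -k'k inv_mul.
have m2 : mul k (inv y) = inv x by rewrite /k mulK_inv.
have := cocycleP (twistP G) e1 e2; rewrite m1 m2.
rewrite (@twist_unit_l (src y) (inv y)) ?rng_inv// => E.
have E' : twist k (inv y) = twist k' k * twist (src y) (src y) * (twist k' (inv x))^*%C :> CC R.
  by rewrite E mulrAC twist_conj// mul1r.
rewrite E' /star_red /star rk' kk' !rmorphM /= !conjcK.
by ring.
Qed.

(** The integral of the norm over the fibre of [rng x] is continuous in [x], hence bounded on the
    compact support; fibres that miss the support contribute zero. *)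
Lemma fnorm1_bounded f : Cc f ->
  exists2 B : R, 0 <= B & forall u, units u -> fnorm1 u f <= B.
Proof.
move=> cf; have [K cK fK] := Cc_compact_support cf.
pose kf x : CC R := (nrm (f x))%:C.
have ckf : Cc kf.
  apply: Cc_intro; last by exists K => // x nK; rewrite /kf fK// nrm0.
  have c1 : continuous (fun x => nrm (f x)).
    by move=> x; apply: continuous_comp; [case: cf => + _; apply|exact: nrm_continuous].
  by move=> x; apply: (continuous_comp (c1 x)); exact: real_complex_continuous.
have kfE u : units u -> nrm (fint u kf) = fnorm1 u f.
  by move=> uu; rewrite /kf fint_fnorm1// nrm_real ger0_norm// fnorm1_ge0.
have c : {within K, continuous (fun x => fint (rng x) kf)}.
  apply: continuous_subspaceT.
  exact: (fint_continuous (@rng_continuous _ G) (@unit_rng _ G) ckf).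
have [B B0 KB] := within_compact_bounded cK c.
exists B => // u uu; have [[x Kx xu]|nu] := pselect (exists2 x, K x & rng x = u).
  by rewrite -kfE// -xu; exact: KB.
rewrite -kfE// (_ : fint u kf = 0) ?nrm0//.
rewrite -(fint0 u); apply: eq_fint => x xu; rewrite /kf fK ?nrm0// => Kx.
by apply: nu; exists x.
Qed.

Lemma fiber2Cc_nrm u v F : fiber2Cc u v F -> fiber2Cc u v (fun x y => (nrm (F x y))%:C).
Proof.
move=> [cF [K [L [cK cL] FKL]]]; split.
  exact: (within_continuous_complex (within_continuous_nrm cF)).
by exists K, L => // x y xu yv n; rewrite FKL// nrm0.
Qed.

(** A Tonelli estimate: the norms of the kernel are integrated in the other order. It yields both
    halves of the submultiplicativity of [normI]. *)
Lemma fnorm1_fint_le u v F g (B : R) : units u -> units v -> fiber2Cc u v F ->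
  fiberCc v g -> 0 <= B ->
  (forall y, rng y = v -> fnorm1 u (F^~ y) <= nrm (g y) * B) ->
  fnorm1 u (fun x => fint v (F x)) <= fnorm1 v g * B.
Proof.
move=> uu uv cF cg B0 FB; have cN := fiber2Cc_nrm cF.
have cN' := fiber2Cc_swap cN.
have E1 := @fiberCc_fint _ _ u v _ uv cF.
have E2 := @fiberCc_fint _ _ u v _ uv cN.
have E3 := @fiberCc_fint _ _ v u _ uu cN'.
apply: (@le_trans _ _ (fnorm1 u (fun x => fint v (fun y => (nrm (F x y))%:C)))).
  apply: (fnorm1_le uu E1 E2) => x xu; rewrite fint_fnorm1// nrm_real ger0_norm ?fnorm1_ge0//.
  exact: (nrm_fint_le uv (fiber2Cc_section xu cF)).
have -> : fnorm1 u (fun x => fint v (fun y => (nrm (F x y))%:C)) =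
    fnorm1 v (fun y => fint u (fun x => (nrm (F x y))%:C)).
  apply: complexI; rewrite -!fint_fnorm1//.
  (* An integral of norms is nonnegative and so equals its own norm; in this form [fint_fnorm1] also
     applies to the outer integral. *)
  have N s t (k : G -> G -> CC R) : units t -> (forall x, rng x = s -> fint t (fun y => (nrm (k x y))%:C)
      = (nrm (fint t (fun y => (nrm (k x y))%:C)))%:C).
    by move=> ut x _; rewrite fint_fnorm1// nrm_real ger0_norm// fnorm1_ge0.
  by rewrite -(eq_fint (N u v F uv)) (fint_fubini uu uv cN) -(eq_fint (N v u (fun y x => F x y) uu)).
rewrite mulrC -[X in X * _]ger0_norm// -nrm_real -(fnorm1Z uv _ cg).
have E4 := fiberCcZ (B%:C) cg.
apply: (fnorm1_le uv E3 E4) => y yv; rewrite fint_fnorm1// nrmM !nrm_real.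
by rewrite !ger0_norm ?fnorm1_ge0// mulrC; exact: FB.
Qed.

(** Integrated in [x] first, the translate of [g] by [inv z] has by invariance the L^1 norm of [g]
    over the fibre of [src z]. This unit varies with [z], whence a bound over all units. *)
Lemma fnorm1_conv u f g (B : R) : units u -> Cc f -> Cc g -> 0 <= B ->
  (forall v, units v -> fnorm1 v g <= B) -> fnorm1 u (conv f g) <= fnorm1 u f * B.
Proof.
move=> uu cf cg B0 gB.
have -> : fnorm1 u (conv f g) = fnorm1 u (fun x => fint u
    (fun z => f z * g (mul (inv z) x) * twist z (mul (inv z) x))).
  by apply: eq_fnorm1 => x xu; rewrite convE_rng// xu.
apply: (fnorm1_fint_le uu uu (convl_kernel u cf cg) (Cc_fiberCc u cf) B0) => z zu.
have sz : src (inv z) = u by rewrite src_inv.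
apply: (@le_trans _ _ (fnorm1 u (fun x => f z * g (mul (inv z) x)))).
  apply: eq_le_fnorm1 => x xu; rewrite nrmM nrm_twist ?mulr1//.
  by rewrite rng_mul ?rng_inv ?src_inv// zu xu.
have ct : fiberCc u (fun x => g (mul (inv z) x)).
  by rewrite -sz; exact: (fiberCc_translate (Cc_fiberCc _ cg)).
rewrite (fnorm1Z uu _ ct) ler_wpM2l ?nrm_ge0//.
rewrite -sz -(fnorm1_invariant (Cc_fiberCc _ cg)); apply: gB; exact: unit_rng.
Qed.

Lemma fnorm1_conv_inv u f g (B : R) : units u -> Cc f -> Cc g -> 0 <= B ->
  (forall v, units v -> fnorm1 v (fun x => f (inv x)) <= B) ->
  fnorm1 u (fun x => conv f g (inv x)) <= fnorm1 u (fun x => g (inv x)) * B.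
Proof.
move=> uu cf cg B0 fB.
have -> : fnorm1 u (fun x => conv f g (inv x)) = fnorm1 u (fun x => fint u
    (fun y => f (mul (inv x) y) * g (inv y) * twist (mul (inv x) y) (inv y))).
  by apply: eq_fnorm1 => x xu; rewrite convE src_inv xu.
apply: (fnorm1_fint_le uu uu (convr_kernel u cf cg) (Cc_fiberCc u (Cc_inv cg)) B0) => y yu.
have sy : src (inv y) = u by rewrite src_inv.
have ci := Cc_inv cf.
apply: (@le_trans _ _ (fnorm1 u (fun x => g (inv y) * f (inv (mul (inv y) x))))).
  apply: eq_le_fnorm1 => x xu; have xy : src (inv x) = rng y by rewrite src_inv xu yu.
  rewrite nrmM nrm_twist ?mulr1 1?mulrC//; last by rewrite src_mul// rng_inv.
  by rewrite invM ?invK// src_inv yu xu.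
have ct : fiberCc u (fun x => f (inv (mul (inv y) x))).
  by rewrite -sy; exact: (fiberCc_translate (Cc_fiberCc _ ci)).
rewrite (fnorm1Z uu _ ct) ler_wpM2l ?nrm_ge0//.
rewrite -sy -(fnorm1_invariant (Cc_fiberCc _ ci)); apply: fB; exact: unit_rng.
Qed.

Lemma fnorm1_star u f : fnorm1 u (star f) = fnorm1 u (fun x => f (inv x)).
Proof.
apply: eq_fnorm1 => x _; rewrite nrm_conj nrmM nrm_twist ?mulr1//.
by rewrite rng_inv.
Qed.

Lemma fnorm1_star_inv u f : fnorm1 u (fun x => star f (inv x)) = fnorm1 u f.
Proof.
apply: eq_fnorm1 => x _; rewrite nrm_conj nrmM nrm_twist ?mulr1 ?invK//.
by rewrite src_inv.
Qed.

Definition nI f : R := fine (normI f).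

Lemma normIE f : Cc f -> normI f = (nI f)%:E.
Proof.
move=> cf; have [B1 B10 fB1] := fnorm1_bounded cf.
have [B2 B20 fB2] := fnorm1_bounded (Cc_inv cf).
rewrite /nI fineK// ge0_fin_numE; last first.
  by rewrite /normI le_max; apply/orP; left; apply: ereal_sup_ubound; left.
rewrite gt_max; apply/andP; split.
  apply: (@le_lt_trans _ _ B1%:E); last exact: ltry.
  apply: ge_ereal_sup => _ [->|[u uu <-]]; first by rewrite lee_fin.
  by rewrite integral_nrm// lee_fin fB1.
apply: (@le_lt_trans _ _ B2%:E); last exact: ltry.
apply: ge_ereal_sup => _ [->|[u uu <-]]; first by rewrite lee_fin.
by rewrite (integral_nrm uu (Cc_inv cf)) lee_fin fB2.
Qed.

Lemma nI_ge0 f : Cc f -> 0 <= nI f.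
Proof.
move=> cf; rewrite -lee_fin -normIE//.
by rewrite /normI le_max; apply/orP; left; apply: ereal_sup_ubound; left.
Qed.

Lemma nI_ub u f : units u -> Cc f -> fnorm1 u f <= nI f /\ fnorm1 u (fun x => f (inv x)) <= nI f.
Proof.
move=> uu cf; rewrite -!lee_fin -normIE// -(integral_nrm uu cf) -(integral_nrm uu (Cc_inv cf)).
split; rewrite /normI le_max; apply/orP; [left|right]; apply: ereal_sup_ubound; right; by exists u.
Qed.

Lemma nI_le f (B : R) : Cc f -> 0 <= B -> (forall u, units u -> fnorm1 u f <= B) ->
  (forall u, units u -> fnorm1 u (fun x => f (inv x)) <= B) -> nI f <= B.
Proof.
move=> cf B0 f1 f2; rewrite -lee_fin -normIE// /normI ge_max.
apply/andP; split; apply: ge_ereal_sup => _ [->|[u uu <-]]; rewrite ?lee_fin//.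
  by rewrite integral_nrm// lee_fin f1.
by rewrite (integral_nrm uu (Cc_inv cf)) lee_fin f2.
Qed.

Lemma nI_conv f g : Cc f -> Cc g -> nI (conv f g) <= nI f * nI g.
Proof.
move=> cf cg; apply: nI_le; [exact: Cc_conv|by rewrite mulr_ge0 ?nI_ge0|move=> u uu..].
  apply: le_trans (fnorm1_conv uu cf cg (nI_ge0 cg) _) _.
    by move=> v uv; have [] := nI_ub uv cg.
  by rewrite ler_wpM2r ?nI_ge0//; have [] := nI_ub uu cf.
apply: le_trans (fnorm1_conv_inv uu cf cg (nI_ge0 cf) _) _.
  by move=> v uv; have [] := nI_ub uv cf.
by rewrite mulrC ler_wpM2l ?nI_ge0//; have [] := nI_ub uu cg.
Qed.

Lemma nI_star f : Cc f -> nI (star f) <= nI f.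
Proof.
move=> cf; apply: nI_le; [exact: Cc_star|exact: nI_ge0|move=> u uu..].
  by rewrite fnorm1_star; have [] := nI_ub uu cf.
by rewrite fnorm1_star_inv; have [] := nI_ub uu cf.
Qed.

End ConvolutionAlgebra.

(** * Completions and C*-seminorms *)

(* The identities of a C*-algebra hold up to null vectors only: star is not an
   involution of C_c(G) when the cocycle is not normalised. *)
Record pre_cstar (R : realType) := PreCstar {
  pc_car :> lmodType R[i];
  pc_mul : pc_car -> pc_car -> pc_car;
  pc_adj : pc_car -> pc_car;
  pc_nu : pc_car -> R;
  pc_nu_ge0 : forall x, 0 <= pc_nu x;
  pc_nuD : forall x y, pc_nu (x + y) <= pc_nu x + pc_nu y;
  pc_nuZ : forall (a : R[i]) x, pc_nu (a *: x) = nrm (a : CC R) * pc_nu x;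
  pc_mulDl : forall a x y z, pc_mul (a *: x + y) z = a *: pc_mul x z + pc_mul y z;
  pc_mulDr : forall a x y z, pc_mul z (a *: x + y) = a *: pc_mul z x + pc_mul z y;
  pc_adjD : forall (a : R[i]) x y, pc_adj (a *: x + y) = a^*%C *: pc_adj x + pc_adj y;
  pc_nuM : forall x y, pc_nu (pc_mul x y) <= pc_nu x * pc_nu y;
  pc_nu_adj : forall x, pc_nu (pc_mul (pc_adj x) x) = pc_nu x ^+ 2;
  pc_mulA : forall x y z, pc_nu (pc_mul x (pc_mul y z) - pc_mul (pc_mul x y) z) = 0;
  pc_adjM : forall x y, pc_nu (pc_adj (pc_mul x y) - pc_mul (pc_adj y) (pc_adj x)) = 0;
  pc_adjK : forall x, pc_nu (pc_adj (pc_adj x) - x) = 0 }.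

Section Completion.
Local Open Scope quotient_scope.
Variables (R : realType) (V : pre_cstar R).
Implicit Types (x y z : V) (a : R[i]).
Local Notation nu := (@pc_nu R V).
Local Notation mul := (@pc_mul R V).
Local Notation adj := (@pc_adj R V).

Let nuN x : nu (- x) = nu x.
Proof. by rewrite -scaleN1r pc_nuZ nrmN nrm1 mul1r. Qed.

Let nuB x y : nu (x - y) = nu (y - x).
Proof. by rewrite -nuN opprB. Qed.

Let nu0 : nu 0 = 0.
Proof. by rewrite -(scale0r 0) pc_nuZ nrm0 mul0r. Qed.

Let nu_dist x y : `|nu x - nu y| <= nu (x - y).
Proof.
have h p q : nu p - nu q <= nu (p - q).
  by rewrite lerBlDr -{1}[p](subrK q); exact: pc_nuD.
by rewrite ler_norml lerNl opprB {1}nuB !h.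
Qed.

Let mulBl x y z : mul (x - y) z = mul x z - mul y z.
Proof. by rewrite addrC -scaleN1r pc_mulDl scaleN1r addrC. Qed.
Let mulBr x y z : mul z (x - y) = mul z x - mul z y.
Proof. by rewrite addrC -scaleN1r pc_mulDr scaleN1r addrC. Qed.
Let adjB x y : adj (x - y) = adj x - adj y.
Proof. by rewrite addrC -scaleN1r pc_adjD rmorphN1 scaleN1r addrC. Qed.

(** One factor [nu x] is cancelled in the C*-identity combined with submultiplicativity. *)
Let nu_adj_le x : nu x <= nu (adj x).
Proof.
have [->|x0] := eqVneq (nu x) 0; first exact: pc_nu_ge0.
have x1 : 0 < nu x by rewrite lt_def x0 pc_nu_ge0.
by rewrite -(ler_pM2r x1) -expr2 -pc_nu_adj pc_nuM.
Qed.

Let nu_adj x : nu (adj x) = nu x.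
Proof.
apply/eqP; rewrite eq_le nu_adj_le andbT; apply: le_trans (nu_adj_le _) _.
rewrite -{1}[adj (adj x)](subrK x); apply: le_trans (pc_nuD _ _) _.
by rewrite pc_adjK add0r.
Qed.

Definition ncauchy (u : nat -> V) := forall e : R, 0 < e ->
  exists N, forall m n, (N <= m)%N -> (N <= n)%N -> nu (u m - u n) < e.
Definition nnull (u : nat -> V) := forall e : R, 0 < e ->
  exists N, forall n, (N <= n)%N -> nu (u n) < e.

Record cauchy_seq := CauchySeq { cs_fun :> nat -> V; csP : ncauchy cs_fun }.
Implicit Types (u v w : cauchy_seq).

Lemma cauchy_seq_eq u v : u =1 v -> u = v.
Proof.
case: u v => [u up] [v vp] /= /funext uv; subst v.
by congr CauchySeq; exact: Prop_irrelevance.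
Qed.

HB.instance Definition _ := gen_eqMixin cauchy_seq.
HB.instance Definition _ := gen_choiceMixin cauchy_seq.

Definition cs_equiv u v : bool := `[< nnull (fun n => u n - v n) >].

Lemma nnullD (u v : nat -> V) : nnull u -> nnull v -> nnull (fun n => u n + v n).
Proof.
move=> un vn e e0; have e2 : 0 < e / 2 by rewrite divr_gt0.
have [N uN] := un _ e2; have [M vM] := vn _ e2; exists (maxn N M) => n.
rewrite geq_max => /andP[Nn Mn]; apply: le_lt_trans (pc_nuD _ _) _.
by rewrite (splitr e) ltrD// ?uN// vM.
Qed.

Lemma nnull_le (u v : nat -> V) (B : R) : nnull v -> (forall n, nu (u n) <= B * nu (v n)) ->
  nnull u.
Proof.
move=> vn uv e e0; have B1 : 0 < `|B| + 1 by rewrite ltr_wpDl.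
have [N vN] := vn _ (divr_gt0 e0 B1); exists N => n /vN.
rewrite ltr_pdivlMr// => h; apply: le_lt_trans (uv n) _; apply: le_lt_trans h.
rewrite mulrC ler_wpM2l ?pc_nu_ge0//; apply: le_trans (ler_norm B) _.
by rewrite lerDl.
Qed.

Lemma nnull0 (u : nat -> V) : (forall n, nu (u n) = 0) -> nnull u.
Proof. by move=> u0 e e0; exists 0%N => n _; rewrite u0. Qed.

Lemma cs_equiv_refl : reflexive cs_equiv.
Proof. by move=> u; apply/asboolP; apply: nnull0 => n; rewrite subrr nu0. Qed.
Lemma cs_equiv_sym : symmetric cs_equiv.
Proof.
move=> u v; apply/asboolP/asboolP => H; apply: (@nnull_le _ _ 1 H) => n;
  by rewrite mul1r nuB.
Qed.
Lemma cs_equiv_trans : transitive cs_equiv.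
Proof.
move=> v u w /asboolP uv /asboolP vw; apply/asboolP.
by have := nnullD uv vw; congr nnull; apply/funext => n; rewrite subrKA.
Qed.

Canonical cs_equiv_rel := EquivRel cs_equiv cs_equiv_refl cs_equiv_sym cs_equiv_trans.

(** A constant sequence at a null vector is equivalent to 0, so this quotient separates the seminorm
    and completes it in a single construction. *)
Definition completion := {eq_quot cs_equiv_rel}.
HB.instance Definition _ := Choice.on completion.
HB.instance Definition _ := EqQuotient.on completion.

Definition cpi (u : cauchy_seq) : completion := \pi_completion u.

Lemma cpiP u v : cpi u = cpi v <-> nnull (fun n => u n - v n).
Proof.
split => [/eqP|H]; first by rewrite /cpi eqmodE => /asboolP.
by apply/eqP; rewrite /cpi eqmodE; apply/asboolP.
Qed.

Lemma cpiK (x : completion) : cpi (repr x) = x. Proof. exact: reprK. Qed.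

Lemma ncauchy_cst x : ncauchy (fun=> x).
Proof. by move=> e e0; exists 0%N => m n _ _; rewrite subrr nu0. Qed.
Definition cs_cst x := CauchySeq (ncauchy_cst x).

Lemma ncauchyD u v : ncauchy (fun n => u n + v n).
Proof.
move=> e e0; have e2 : 0 < e / 2 by rewrite divr_gt0.
have [N uN] := csP u e2; have [M vM] := csP v e2; exists (maxn N M) => m n.
rewrite !geq_max => /andP[Nm Mm] /andP[Nn Mn]; rewrite opprD addrACA.
by apply: le_lt_trans (pc_nuD _ _) _; rewrite (splitr e) ltrD// ?uN// vM.
Qed.
Definition cs_add u v := CauchySeq (ncauchyD u v).

Lemma ncauchy_le u (v : nat -> V) (B : R) :
  (forall m n, nu (v m - v n) <= B * nu (u m - u n)) -> ncauchy v.
Proof.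
move=> uv e e0; have B1 : 0 < `|B| + 1 by rewrite ltr_wpDl.
have [N uN] := csP u (divr_gt0 e0 B1); exists N => m n Nm Nn.
have := uN m n Nm Nn; rewrite ltr_pdivlMr// => h.
apply: le_lt_trans (uv m n) _; apply: le_lt_trans h.
rewrite mulrC ler_wpM2l ?pc_nu_ge0//; apply: le_trans (ler_norm B) _.
by rewrite lerDl.
Qed.

Lemma ncauchyZ a u : ncauchy (fun n => a *: u n).
Proof.
by apply: (@ncauchy_le u _ (nrm (a : CC R))) => m n; rewrite -scalerBr pc_nuZ.
Qed.
Definition cs_scale a u := CauchySeq (ncauchyZ a u).

Lemma ncauchy_adj u : ncauchy (fun n => adj (u n)).
Proof. by apply: (@ncauchy_le u _ 1) => m n; rewrite -adjB nu_adj mul1r. Qed.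
Definition cs_adj u := CauchySeq (ncauchy_adj u).

Lemma cs_bounded u : exists2 B : R, 0 <= B & forall n, nu (u n) <= B.
Proof.
have [N uN] := csP u (@ltr01 R).
have [B0 B0P] : exists B : R, forall n, (n <= N)%N -> nu (u n) <= B.
  elim: {uN} N => [|N [B BP]]; first by exists (nu (u 0%N)) => n; rewrite leqn0 => /eqP ->.
  exists (Num.max B (nu (u N.+1))) => n; rewrite leq_eqVlt => /orP[/eqP ->|nN].
    by rewrite le_max lexx orbT.
  by rewrite le_max BP.
exists (Num.max 0 (B0 + 1)) => [|n]; first by rewrite le_max lexx.
rewrite le_max; apply/orP; right; have [nN|Nn] := leqP n N.
  by apply: le_trans (B0P _ nN) _; rewrite lerDl.
rewrite -(subrK (u N) (u n)); apply: le_trans (pc_nuD _ _) _; rewrite addrC lerD ?B0P//.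
by apply/ltW/uN => //; exact: ltnW.
Qed.

Lemma ncauchyM u v : ncauchy (fun n => mul (u n) (v n)).
Proof.
move=> e e0; have [A A0 uA] := cs_bounded u; have [B B0 vB] := cs_bounded v.
have A1 : 0 < (A + 1) * 2 by rewrite mulr_gt0// ltr_wpDl.
have B1 : 0 < (B + 1) * 2 by rewrite mulr_gt0// ltr_wpDl.
have [N uN] := csP u (divr_gt0 e0 B1); have [M vM] := csP v (divr_gt0 e0 A1).
exists (maxn N M) => m n; rewrite !geq_max => /andP[Nm Mm] /andP[Nn Mn].
rewrite -(subrKA (mul (u n) (v m))) -mulBl -mulBr.
apply: le_lt_trans (pc_nuD _ _) _; rewrite (splitr e).
have h (p q C r : R) : 0 <= p -> 0 <= q -> q <= C -> 0 < r -> p < r / ((C + 1) * 2) -> p * q < r / 2.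
  move=> p0 q0 qC r0; rewrite ltr_pdivlMr; last by rewrite mulr_gt0// ltr_wpDl// (le_trans q0).
  by move=> pr; nra.
apply: ltrD; apply: le_lt_trans (pc_nuM _ _) _.
  by apply: (h _ _ B) => //; [exact: pc_nu_ge0|exact: pc_nu_ge0|exact: uN].
by rewrite mulrC; apply: (h _ _ A) => //; [exact: pc_nu_ge0|exact: pc_nu_ge0|exact: vM].
Qed.
Definition cs_mul u v := CauchySeq (ncauchyM u v).

Definition cadd (x y : completion) := cpi (cs_add (repr x) (repr y)).
Definition cscale a (x : completion) := cpi (cs_scale a (repr x)).
Definition copp (x : completion) := cscale (-1) x.
Definition cplmul (x y : completion) := cpi (cs_mul (repr x) (repr y)).
Definition cpladj (x : completion) := cpi (cs_adj (repr x)).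
Definition cemb (x : V) := cpi (cs_cst x).

Lemma nnull_repr u : nnull (fun n => repr (cpi u) n - u n).
Proof. by apply/cpiP; rewrite cpiK. Qed.

Lemma caddE u v : cadd (cpi u) (cpi v) = cpi (cs_add u v).
Proof.
apply/cpiP; have := nnullD (nnull_repr u) (nnull_repr v).
by congr nnull; apply/funext => n /=; rewrite opprD addrACA.
Qed.

Lemma cscaleE a u : cscale a (cpi u) = cpi (cs_scale a u).
Proof.
apply/cpiP; apply: (nnull_le (B := nrm (a : CC R)) (nnull_repr u)) => n.
by rewrite -scalerBr pc_nuZ.
Qed.

Lemma cpladjE u : cpladj (cpi u) = cpi (cs_adj u).
Proof.
apply/cpiP; apply: (nnull_le (B := 1) (nnull_repr u)) => n.
by rewrite /= -adjB nu_adj mul1r.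
Qed.

Lemma cplmulE u v : cplmul (cpi u) (cpi v) = cpi (cs_mul u v).
Proof.
apply/cpiP; have [A A0 uA] := cs_bounded (repr (cpi u)); have [B B0 vB] := cs_bounded v.
have n1 : nnull (fun n => mul (repr (cpi u) n) (repr (cpi v) n - v n)).
  apply: (nnull_le (B := A) (nnull_repr v)) => n; apply: le_trans (pc_nuM _ _) _.
  by rewrite ler_wpM2r ?pc_nu_ge0.
have n2 : nnull (fun n => mul (repr (cpi u) n - u n) (v n)).
  apply: (nnull_le (B := B) (nnull_repr u)) => n; apply: le_trans (pc_nuM _ _) _.
  by rewrite mulrC ler_wpM2r ?pc_nu_ge0.
have := nnullD n1 n2; congr nnull; apply/funext => n /=.
by rewrite mulBl mulBr subrKA.
Qed.

Lemma cpi_ind (P : completion -> Prop) : (forall u, P (cpi u)) -> forall x : completion, P x.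
Proof. by move=> H x; rewrite -(cpiK x). Qed.

Lemma caddA : associative cadd.
Proof.
elim/cpi_ind => u; elim/cpi_ind => v; elim/cpi_ind => w; rewrite !caddE.
by congr cpi; apply: cauchy_seq_eq => n /=; rewrite addrA.
Qed.
Lemma caddC : commutative cadd.
Proof.
elim/cpi_ind => u; elim/cpi_ind => v; rewrite !caddE.
by congr cpi; apply: cauchy_seq_eq => n /=; rewrite addrC.
Qed.
Lemma cadd0 : left_id (cemb 0) cadd.
Proof.
elim/cpi_ind => u; rewrite !caddE.
by congr cpi; apply: cauchy_seq_eq => n /=; rewrite add0r.
Qed.
Lemma caddN : left_inverse (cemb 0) copp cadd.
Proof.
elim/cpi_ind => u; rewrite /copp cscaleE !caddE.
by congr cpi; apply: cauchy_seq_eq => n /=; rewrite scaleN1r addNr.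
Qed.

HB.instance Definition _ := GRing.isZmodule.Build completion caddA caddC cadd0 caddN.

Lemma cscaleA a b (x : completion) : cscale a (cscale b x) = cscale (a * b) x.
Proof.
elim/cpi_ind: x => u; rewrite !cscaleE.
by congr cpi; apply: cauchy_seq_eq => n /=; rewrite scalerA.
Qed.
Lemma cscale1 : left_id 1 cscale.
Proof.
elim/cpi_ind => u; rewrite !cscaleE.
by congr cpi; apply: cauchy_seq_eq => n /=; rewrite scale1r.
Qed.
Lemma cscaleDr : right_distributive cscale +%R.
Proof.
move=> a; elim/cpi_ind => u; elim/cpi_ind => v.
rewrite -[cpi u + cpi v]/(cadd _ _) -[RHS]/(cadd _ _) !(caddE, cscaleE).
by congr cpi; apply: cauchy_seq_eq => n /=; rewrite scalerDr.
Qed.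
Lemma cscaleDl (x : completion) : {morph cscale^~ x : a b / a + b}.
Proof.
move=> a b; elim/cpi_ind: x => u.
rewrite -[RHS]/(cadd _ _) !(cscaleE, caddE).
by congr cpi; apply: cauchy_seq_eq => n /=; rewrite scalerDl.
Qed.

HB.instance Definition _ := GRing.Zmodule_isLmodule.Build R[i] completion
  cscaleA cscale1 cscaleDr cscaleDl.

Lemma cpi_lin a u v : a *: cpi u + cpi v = cpi (cs_add (cs_scale a u) v).
Proof. by rewrite -[LHS]/(cadd (cscale _ _) _) cscaleE caddE. Qed.

Lemma cpiB u v : cpi u - cpi v = cpi (cs_add u (cs_scale (-1) v)).
Proof. by rewrite -[LHS]/(cadd _ (cscale _ _)) cscaleE caddE. Qed.

Lemma cs_norm_cvg u : cvg ((fun n => nu (u n)) @ \oo).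
Proof.
apply/(@cauchy_cvgP R)/(@cauchyP R R) => e e0.
have [N uN] := csP u e0; exists (nu (u N)).
exists N => // n /= Nn; rewrite -ball_normE /=.
by apply: le_lt_trans (nu_dist _ _) _; exact: uN.
Qed.

Definition cs_norm u : R := lim ((fun n => nu (u n)) @ \oo).

Lemma cs_normP u : (fun n => nu (u n)) @ \oo --> cs_norm u.
Proof. exact: cs_norm_cvg. Qed.

Lemma cs_norm_eq u v : nnull (fun n => u n - v n) -> cs_norm u = cs_norm v.
Proof.
move=> uv; apply: (cvg_lim (@Rhausdorff R)).
have : (fun n => nu (v n) + (nu (u n) - nu (v n))) @ \oo --> cs_norm v + 0.
  apply: cvgD; first exact: cs_normP.
  apply/cvgrPdist_lt => e e0; have [N uN] := uv e e0; exists N => // n /= /uN h.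
  by rewrite sub0r normrN; apply: le_lt_trans (nu_dist _ _) h.
by rewrite addr0; under eq_fun do rewrite addrC subrK.
Qed.

Definition cpl_nrm (x : completion) : R := cs_norm (repr x).

Lemma cpl_nrmE u : cpl_nrm (cpi u) = cs_norm u.
Proof. by apply: cs_norm_eq; exact: nnull_repr. Qed.

Lemma cs_norm_cst x : cs_norm (cs_cst x) = nu x.
Proof. by rewrite /cs_norm /=; exact: (lim_cst (@Rhausdorff R)). Qed.

Lemma cs_norm_le_near u (B : R) N : (forall n, (N <= n)%N -> nu (u n) <= B) -> cs_norm u <= B.
Proof.
move=> uB; apply: (ler_cvg_to (@cs_normP u) (cvg_cst B)).
by exists N => // n /=; exact: uB.
Qed.

Lemma cpl_nrmD (x y : completion) : cpl_nrm (x + y) <= cpl_nrm x + cpl_nrm y.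
Proof.
elim/cpi_ind: x => u; elim/cpi_ind: y => v.
rewrite -[cpi u + cpi v]/(cadd _ _) caddE !cpl_nrmE.
apply: (ler_cvg_to (@cs_normP _) (cvgD (@cs_normP u) (@cs_normP v))).
by apply: nearW => n; exact: pc_nuD.
Qed.

Lemma cpl_nrmZ a (x : completion) : cpl_nrm (a *: x) = nrm (a : CC R) * cpl_nrm x.
Proof.
elim/cpi_ind: x => u; rewrite -[a *: cpi u]/(cscale _ _) cscaleE !cpl_nrmE.
apply: (cvg_lim (@Rhausdorff R)) => /=; under eq_fun do rewrite pc_nuZ.
by apply: cvgM; [exact: cvg_cst|exact: cs_normP].
Qed.

Definition cpl_norm (x : completion) : R[i] := (cpl_nrm x)%:C.

Lemma cpl_normD (x y : completion) : cpl_norm (x + y) <= cpl_norm x + cpl_norm y.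
Proof. by rewrite /cpl_norm -rmorphD lecR cpl_nrmD. Qed.

Lemma cpl_normZ (a : R[i]) (x : completion) : cpl_norm (a *: x) = `|a| * cpl_norm x.
Proof. by rewrite /cpl_norm cpl_nrmZ rmorphM /= -(nrmE (a : CC R)). Qed.

Lemma cpl_norm_eq0 (x : completion) : cpl_norm x = 0 -> x = 0.
Proof.
move=> /complexI; elim/cpi_ind: x => u; rewrite cpl_nrmE => u0; apply/cpiP => e e0.
have := @cs_normP u; rewrite u0 => /cvgrPdist_lt/(_ _ e0)[N _ uN]; exists N => n /uN.
by rewrite /= sub0r normrN ger0_norm ?pc_nu_ge0//= subr0.
Qed.

HB.instance Definition _ := Lmodule_isNormed.Build R[i] completion
  cpl_normD cpl_normZ cpl_norm_eq0.

Lemma cpl_nrm_nrm (x : completion) : nrm x = cpl_nrm x. Proof. by []. Qed.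

Lemma nrm_cpi u : nrm (cpi u) = cs_norm u.
Proof. by rewrite cpl_nrm_nrm cpl_nrmE. Qed.

Lemma nrm_cemb x : nrm (cemb x) = nu x.
Proof. by rewrite nrm_cpi cs_norm_cst. Qed.

Lemma cemb_lin a x y : cemb (a *: x + y) = a *: cemb x + cemb y.
Proof. by rewrite cpi_lin; congr cpi; apply: cauchy_seq_eq. Qed.

Lemma cemb_mul x y : cemb (mul x y) = cplmul (cemb x) (cemb y).
Proof. by rewrite cplmulE; congr cpi; apply: cauchy_seq_eq. Qed.

Lemma cemb_adj x : cemb (adj x) = cpladj (cemb x).
Proof. by rewrite cpladjE; congr cpi; apply: cauchy_seq_eq. Qed.

Lemma cemb_approx u (e : R) : 0 < e -> exists N, forall n, (N <= n)%N ->
  nrm (cpi u - cemb (u n)) < e.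
Proof.
move=> e0; have e2 : 0 < e / 2 by rewrite divr_gt0.
have [N uN] := csP u e2; exists N => n Nn; rewrite cpiB nrm_cpi.
apply: (@le_lt_trans _ _ (e / 2)); last by rewrite [ltRHS](splitr e) ltrDl.
apply: (@cs_norm_le_near _ _ N) => m Nm /=; rewrite scaleN1r.
by apply/ltW/uN.
Qed.

Lemma cemb_dense : dense (range cemb).
Proof.
move=> O [x Ox] oO; move: Ox; elim/cpi_ind: x => u Ou.
have := open_nbhs_nbhs (conj oO Ou).
move=> /nbhs_ballP[e /= e0]; have [e0' ee] := pos_complexE e0.
rewrite -ball_normE /= => eO.
have [N uN] := cemb_approx u e0'; exists (cemb (u N)); split; last by exists (u N).
by apply: eO => /=; rewrite ee nrmE ltcR; exact: uN.
Qed.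

(** At each scale [1/(n+1)] a point close to the filter is chosen and replaced by an element [v n]
    of [V]. The sequence [v] is then Cauchy in [V], and its own class is the limit. *)
Lemma completion_complete (F : set_system completion) :
  ProperFilter F -> cauchy F -> cvg F.
Proof.
move=> FF Fc.
have Fex n : exists x : completion, F [set y | nrm (x - y) < n.+1%:R^-1].
  have e0' : (0 : R[i]) < (n.+1%:R^-1 : R)%:C by rewrite ltcR invr_gt0.
  have [x Fx] := (cauchyP F).1 Fc _ e0'; exists x.
  move: Fx; apply: filterS => y.
  by rewrite -ball_normE /= nrmE ltcR.
have [x xP] := choice Fex.
have vex n : exists v : V, nrm (x n - cemb v) < n.+1%:R^-1.
  move: (x n); elim/cpi_ind => u.
  have [|N uN] := @cemb_approx u (n.+1%:R^-1); first by rewrite invr_gt0.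
  by exists (u N); exact: uN.
have [v vP] := choice vex.
have vF n : F [set y | nrm (cemb (v n) - y) < n.+1%:R^-1 *+ 2].
  move: (xP n); apply: filterS => y /= xy; rewrite -(subrKA (x n)) mulr2n.
  by apply: le_lt_trans (nrmD _ _) _; rewrite ltrD// nrmB.
have inv_small (e : R) : 0 < e -> exists N, forall n, (N <= n)%N -> n.+1%:R^-1 < e.
  move=> e0; have /cvgrPdist_lt/(_ _ e0)[N _ NP] := @cvg_harmonic R; exists N => n Nn.
  by have := NP n Nn; rewrite /= sub0r normrN ger0_norm// /harmonic.
have vc : ncauchy v.
  move=> e e0; have [N NP] := inv_small (e / 4) (divr_gt0 e0 (ltr0n _ 4)); exists N => m n Nm Nn.
  have [y [/= ym yn]] := filter_ex (filterI (vF m) (vF n)).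
  rewrite -nrm_cemb.
  have -> : cemb (v m - v n) = cemb (v m) - cemb (v n).
    by rewrite -scaleN1r addrC cemb_lin scaleN1r addrC.
  rewrite -(subrKA y); apply: le_lt_trans (nrmD _ _) _; rewrite [nrm (y - _)]nrmB.
  move: (NP m Nm) (NP n Nn) ym yn; rewrite !mulr2n.
  move: (m.+1%:R^-1) (n.+1%:R^-1) (nrm _) (nrm _) => a b c d; lra.
pose l := cpi (CauchySeq vc).
apply/cvg_ex; exists l; apply/cvg_nrmP => e e0.
have e4 : 0 < e / 4 by rewrite divr_gt0.
have [N NP] := inv_small _ e4; have [M MP] := cemb_approx (CauchySeq vc) e4.
pose n := maxn N M; move: (vF n); apply: filterS => y /= vy.
rewrite -(subrKA (cemb (v n))); apply: le_lt_trans (nrmD _ _) _.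
move: (NP n (leq_maxl _ _)) (MP n (leq_maxr _ _)) vy; rewrite /l /= !mulr2n.
move: (n.+1%:R^-1) (nrm _) (nrm _) => a b c; lra.
Qed.

HB.instance Definition _ := Uniform_isComplete.Build completion completion_complete.

Lemma cplmulA (x y z : completion) : cplmul x (cplmul y z) = cplmul (cplmul x y) z.
Proof.
elim/cpi_ind: x => u; elim/cpi_ind: y => v; elim/cpi_ind: z => w; rewrite !cplmulE.
by apply/cpiP; apply: nnull0 => n; exact: pc_mulA.
Qed.

Lemma cplmulDl a (x y z : completion) : cplmul (a *: x + y) z = a *: cplmul x z + cplmul y z.
Proof.
elim/cpi_ind: x => u; elim/cpi_ind: y => v; elim/cpi_ind: z => w.
rewrite cpi_lin !cplmulE cpi_lin.
by congr cpi; apply: cauchy_seq_eq => n /=; exact: pc_mulDl.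
Qed.

Lemma cplmulDr a (x y z : completion) : cplmul z (a *: x + y) = a *: cplmul z x + cplmul z y.
Proof.
elim/cpi_ind: x => u; elim/cpi_ind: y => v; elim/cpi_ind: z => w.
rewrite cpi_lin !cplmulE cpi_lin.
by congr cpi; apply: cauchy_seq_eq => n /=; exact: pc_mulDr.
Qed.

Lemma cpladjD a (x y : completion) : cpladj (a *: x + y) = a^*%C *: cpladj x + cpladj y.
Proof.
elim/cpi_ind: x => u; elim/cpi_ind: y => v.
rewrite cpi_lin !cpladjE cpi_lin.
by congr cpi; apply: cauchy_seq_eq => n /=; exact: pc_adjD.
Qed.

Lemma cpladjM (x y : completion) : cpladj (cplmul x y) = cplmul (cpladj y) (cpladj x).
Proof.
elim/cpi_ind: x => u; elim/cpi_ind: y => v; rewrite !(cplmulE, cpladjE).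
by apply/cpiP; apply: nnull0 => n; exact: pc_adjM.
Qed.

Lemma cpladjK (x : completion) : cpladj (cpladj x) = x.
Proof.
elim/cpi_ind: x => u; rewrite !cpladjE.
by apply/cpiP; apply: nnull0 => n; exact: pc_adjK.
Qed.

Lemma cpl_norm_mul (x y : completion) : `|cplmul x y| <= `|x| * `|y|.
Proof.
elim/cpi_ind: x => u; elim/cpi_ind: y => v; rewrite cplmulE !nrmE -rmorphM lecR !nrm_cpi.
apply: (ler_cvg_to (@cs_normP _) (cvgM (@cs_normP u) (@cs_normP v))).
by apply: nearW => n; exact: pc_nuM.
Qed.

Lemma cpl_norm_adj (x : completion) : `|cplmul (cpladj x) x| = `|x| ^+ 2.
Proof.
elim/cpi_ind: x => u; rewrite cpladjE cplmulE !nrmE -rmorphXn; congr (_%:C); rewrite !nrm_cpi.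
apply: (cvg_lim (@Rhausdorff R)) => /=; under eq_fun do rewrite pc_nu_adj.
by rewrite expr2; under eq_fun do rewrite expr2; apply: cvgM; exact: cs_normP.
Qed.

Definition completion_cstar : cstar_algebra R := @CstarAlgebra R completion
  cplmul cpladj cplmulA cplmulDl cplmulDr cpladjD cpladjM cpladjK cpl_norm_mul cpl_norm_adj.

End Completion.

(** If [t = a 0 / b] exceeded [K], induction would give [b t^(2^n) <= a n], and hence
    [b <= C (K/t)^(2^n)], which tends to 0. The constant [C] plays no part in the limit, so any a
    priori bound with the right growth rate suffices. *)
Lemma doubling_bound (R : realType) (a : nat -> R) (b C K : R) :
  (forall n, 0 <= a n) -> 0 <= b -> 0 <= K ->
  (forall n, a n ^+ 2 <= a n.+1 * b) -> (forall n, a n <= C * K ^+ (2 ^ n)) ->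
  a 0%N <= K * b.
Proof.
move=> a0 b0 K0 aS aK; rewrite leNgt; apply/negP => Kb.
have b1 : 0 < b.
  rewrite lt_def b0 andbT; apply/eqP => bE; have := aS 0%N; rewrite bE mulr0.
  by rewrite bE mulr0 in Kb; rewrite leNgt exprn_gt0.
pose t := a 0%N / b; have Kt : K < t by rewrite ltr_pdivlMr.
have at_ n : b * t ^+ (2 ^ n) <= a n.
  elim: n => [|n IH]; first by rewrite expn0 expr1 /t mulrCA divff ?mulr1// gt_eqF.
  rewrite -(ler_pM2r b1); apply: le_trans (aS n).
  have -> : b * t ^+ (2 ^ n.+1) * b = (b * t ^+ (2 ^ n)) ^+ 2.
    by rewrite expnS mulnC exprM; move: (t ^+ _) => T; ring.
  have t0 : 0 <= t by rewrite divr_ge0.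
  by rewrite ler_sqr ?nnegrE// mulr_ge0// exprn_ge0.
have t1 : 0 < t by apply: le_lt_trans Kt.
pose q := K / t; have q0 : 0 <= q by rewrite divr_ge0// ltW.
have q1 : q < 1 by rewrite ltr_pdivrMr// mul1r.
(* Since [n <= 2^n] and [q < 1], the bound may be weakened to a geometric sequence. *)
have bq n : b <= `|C| * q ^+ n.
  have bq2 : b <= C * q ^+ (2 ^ n).
    rewrite /q expr_div_n mulrA ler_pdivlMr ?exprn_gt0//.
    exact: le_trans (at_ n) (aK n).
  apply: le_trans bq2 _; apply: (@le_trans _ _ (`|C| * q ^+ (2 ^ n))).
    by rewrite ler_wpM2r ?exprn_ge0// ler_norm.
  rewrite ler_wpM2l// ler_wiXn2l// ?ltW//.
  by rewrite ltnW// ltn_expl.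
have := @cvg_geometric R `|C| q; rewrite ger0_norm// => /(_ q1) /cvgrPdist_lt/(_ _ b1)[N _ NP].
have := NP N (leqnn N); rewrite /= sub0r normrN ger0_norm; last by rewrite mulr_ge0// exprn_ge0.
by rewrite ltNge bq.
Qed.

(** * C*-seminorms and representations on semi-inner product spaces *)

Section CstarSeminorm.
Variables (R : realType) (V : lmodType R[i]).
Variables (mul : V -> V -> V) (adj : V -> V).
Implicit Types (f g h : V).

Record cstar_seminorm (nu : V -> R) : Prop := CstarSeminorm {
  csn_ge0 : forall f, 0 <= nu f;
  csnD : forall f g, nu (f + g) <= nu f + nu g;
  csnZ : forall (a : R[i]) f, nu (a *: f) = nrm (a : CC R) * nu f;
  csnM : forall f g, nu (mul f g) <= nu f * nu g;
  csn_adj : forall f, nu (mul (adj f) f) = nu f ^+ 2;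
  csnA : forall f g h, nu (mul f (mul g h) - mul (mul f g) h) = 0;
  csn_adjM : forall f g, nu (adj (mul f g) - mul (adj g) (adj f)) = 0;
  csn_adjK : forall f, nu (adj (adj f) - f) = 0 }.

Section Sup.
Variables (F : set (V -> R)) (B : V -> R).
Hypothesis FP : forall nu, F nu -> cstar_seminorm nu.
Hypothesis FB : forall nu f, F nu -> nu f <= B f.

(** The element 0 covers an empty family, as occurs for a groupoid without units. *)
Definition sup_seminorm f : R := sup (0 |` [set nu f | nu in F]).

Let has_sup f : has_sup (0 |` [set nu f | nu in F]).
Proof.
split; first by exists 0; left.
exists (Num.max 0 (B f)) => _ [->|[nu Fnu <-]]; rewrite le_max ?lexx//.
by rewrite FB// orbT.
Qed.

Lemma sup_seminorm_ub nu f : F nu -> nu f <= sup_seminorm f.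
Proof. by move=> Fnu; apply: ub_le_sup; [case: (has_sup f)|right; exists nu]. Qed.

Lemma sup_seminorm_ge0 f : 0 <= sup_seminorm f.
Proof. by apply: ub_le_sup; [case: (has_sup f)|left]. Qed.

Lemma sup_seminorm_le f (C : R) : 0 <= C -> (forall nu, F nu -> nu f <= C) -> sup_seminorm f <= C.
Proof.
move=> C0 FC; apply: ge_sup; first by exists 0; left.
by move=> _ [->//|[nu Fnu <-]]; exact: FC.
Qed.

(** Squaring is monotone on nonnegative numbers, so the C*-identity passes to suprema; the
    identities modulo null vectors do so because each seminorm of the family vanishes on the
    defect. *)
Lemma cstar_seminorm_sup : cstar_seminorm sup_seminorm.
Proof.
have zero f : (forall nu, F nu -> nu f = 0) -> sup_seminorm f = 0.
  move=> z; apply/eqP; rewrite eq_le sup_seminorm_ge0 andbT.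
  by apply: sup_seminorm_le => // nu /z ->.
split.
- exact: sup_seminorm_ge0.
- move=> f g; apply: sup_seminorm_le => [|nu Fnu]; first by rewrite addr_ge0 ?sup_seminorm_ge0.
  by apply: le_trans (csnD (FP Fnu) _ _) _; rewrite lerD ?sup_seminorm_ub.
- move=> a f.
  have le b k : sup_seminorm (b *: k) <= nrm (b : CC R) * sup_seminorm k.
    apply: sup_seminorm_le => [|nu Fnu]; first by rewrite mulr_ge0 ?nrm_ge0 ?sup_seminorm_ge0.
    by rewrite (csnZ (FP Fnu)) ler_wpM2l ?nrm_ge0// sup_seminorm_ub.
  apply/eqP; rewrite eq_le le /=; have [->|a0] := eqVneq a 0.
    by rewrite nrm0 mul0r sup_seminorm_ge0.
  have -> : sup_seminorm f = sup_seminorm (a^-1 *: (a *: f)) by rewrite scalerA mulVf// scale1r.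
  apply: le_trans (ler_wpM2l (nrm_ge0 _) (le _ _)) _.
  by rewrite mulrA -nrmM (divff a0) nrm1 mul1r.
- move=> f g; apply: sup_seminorm_le => [|nu Fnu]; first by rewrite mulr_ge0 ?sup_seminorm_ge0.
  apply: le_trans (csnM (FP Fnu) _ _) _.
  by rewrite ler_pM ?(csn_ge0 (FP Fnu)) ?sup_seminorm_ub.
- move=> f; apply/eqP; rewrite eq_le; apply/andP; split.
    apply: sup_seminorm_le => [|nu Fnu]; first by rewrite sqr_ge0.
    rewrite (csn_adj (FP Fnu)) ler_sqr ?nnegrE ?(csn_ge0 (FP Fnu)) ?sup_seminorm_ge0//.
    exact: sup_seminorm_ub.
  rewrite -[leRHS]sqr_sqrtr ?sup_seminorm_ge0// ler_sqr ?nnegrE ?sqrtr_ge0 ?sup_seminorm_ge0//.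
  apply: sup_seminorm_le => [|nu Fnu]; first exact: sqrtr_ge0.
  rewrite -[leLHS]ger0_norm ?(csn_ge0 (FP Fnu))// -sqrtr_sqr -(csn_adj (FP Fnu)).
  by rewrite ler_wsqrtr// sup_seminorm_ub.
- by move=> f g h; apply: zero => nu Fnu; exact: (csnA (FP Fnu)).
- by move=> f g; apply: zero => nu Fnu; exact: (csn_adjM (FP Fnu)).
- by move=> f; apply: zero => nu Fnu; exact: (csn_adjK (FP Fnu)).
Qed.

End Sup.

(** The form may be degenerate and the operators carry no boundedness assumption. This covers
    representations on a Hilbert space as well as C_c(G) acting on itself by convolution, with the
    inner product of one fibre. *)
Record pre_representation (E : lmodType R[i]) (dot : E -> E -> CC R) (rho : V -> E -> E) :
    Prop := PreRepresentation {
  pr_dotl : forall (a : R[i]) x y z, dot (a *: x + y) z = a * dot x z + dot y z;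
  pr_dotC : forall x y, dot y x = (dot x y)^*%C;
  pr_dot_ge0 : forall x, 0 <= complex.Re (dot x x);
  pr_linl : forall (a : R[i]) f g v, rho (a *: f + g) v = a *: rho f v + rho g v;
  pr_linr : forall (a : R[i]) f v w, rho f (a *: v + w) = a *: rho f v + rho f w;
  pr_mul : forall f g v, rho (mul f g) v = rho f (rho g v);
  pr_adj : forall f v w, dot (rho (adj f) v) w = dot v (rho f w) }.

Section PreRepresentation.
Variables (E : lmodType R[i]) (dot : E -> E -> CC R) (rho : V -> E -> E).
Hypothesis P : pre_representation dot rho.
Implicit Types (v w x y z : E).

Let dotr (a : R[i]) x y z : dot z (a *: x + y) = (a^*)%C * dot z x + dot z y.
Proof. by rewrite (pr_dotC P) (pr_dotl P) rmorphD rmorphM /= -!(pr_dotC P). Qed.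

Definition semi v : R := Num.sqrt (complex.Re (dot v v)).

Lemma semi_ge0 v : 0 <= semi v. Proof. exact: sqrtr_ge0. Qed.

Lemma semi_sqr v : semi v ^+ 2 = complex.Re (dot v v).
Proof. by rewrite sqr_sqrtr// (pr_dot_ge0 P). Qed.

Let dot_real v : dot v v = ((semi v ^+ 2)%:C : CC R).
Proof.
rewrite semi_sqr; apply: complexE => //=.
have := congr1 (fun z : CC R => complex.Im z) (pr_dotC P v v).
by case: (dot v v) => a b /= bN; lra.
Qed.

Let dot0l v : dot 0 v = 0.
Proof.
have := pr_dotl P 1 0 0 v; rewrite !scale1r addr0 mul1r.
by move/(congr1 (fun t => t - dot 0 v)); rewrite subrr addrK.
Qed.

Let dotB x y z : dot (x - y) z = dot x z - dot y z.
Proof. by rewrite addrC -scaleN1r (pr_dotl P) mulN1r addrC. Qed.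

Let semi_expand x y (c : CC R) : semi (c *: y + x) ^+ 2 =
  semi x ^+ 2 + 2 * complex.Re (c * dot y x) + nrm c ^+ 2 * semi y ^+ 2.
Proof.
rewrite semi_sqr (pr_dotl P) !dotr !dot_real (pr_dotC P y x).
move: (dot y x) (semi x ^+ 2) (semi y ^+ 2) => [p q] X Y; rewrite nrm_sqr; case: c => a b.
by rewrite !(ReD, ReM, ImD, ImM) /=; ring.
Qed.

Lemma semi_cauchy_schwarz x y : nrm (dot x y) <= semi x * semi y.
Proof.
have D t : 0 <= semi x ^+ 2 - 2 * t * nrm (dot x y) ^+ 2 +
    t ^+ 2 * nrm (dot x y) ^+ 2 * semi y ^+ 2.
  have := sqr_ge0 (semi ((- (t%:C * dot x y) : CC R) *: y + x)).
  rewrite semi_expand nrmN nrmM nrm_real exprMn real_normK ?num_real//.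
  have -> : complex.Re (- (t%:C * dot x y) * dot y x : CC R) = - (t * nrm (dot x y) ^+ 2).
    rewrite (pr_dotC P x y) -mulNr -mulrA mul_conjr.
    by move: (nrm _ ^+ 2) => N /=; ring.
  by congr (_ <= _); ring.
rewrite -ler_sqr ?nnegrE ?nrm_ge0 ?mulr_ge0 ?semi_ge0// exprMn.
move: D (sqr_ge0 (semi x)) (sqr_ge0 (semi y)) (sqr_ge0 (nrm (dot x y))).
move: (semi x ^+ 2) (semi y ^+ 2) (nrm (dot x y) ^+ 2) => X Y N D X0 Y0 N0.
have [Y00|Y1] := eqVneq Y 0.
  (* For [Y = 0] the inequality [D] is affine in [t]; at this [t] its right side is -1 unless [N]
     vanishes. In the other case the optimal value is [Y^-1]. *)
  rewrite Y00 mulr0; have := D ((X + 1) / (2 * N)); rewrite Y00 mulr0 addr0.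
  have [->//|N1] := eqVneq N 0; rewrite -mulrA.
  have -> : 2 * ((X + 1) / (2 * N) * N) = X + 1 by field; rewrite N1.
  lra.
have := D Y^-1.
have -> : X - 2 * Y^-1 * N + Y^-1 ^+ 2 * N * Y = X - N / Y by field.
by rewrite subr_ge0 ler_pdivrMr// lt_def Y1.
Qed.

Lemma semiZ (a : R[i]) v : semi (a *: v) = nrm (a : CC R) * semi v.
Proof.
have aE : semi (a *: v) ^+ 2 = (nrm (a : CC R) * semi v) ^+ 2.
  have := semi_expand 0 v a; rewrite addr0 => ->.
  by rewrite (semi_sqr 0) (pr_dotC P 0 v) !dot0l conjc0 mulr0 exprMn /=; ring.
apply/eqP; rewrite -(@eqrXn2 _ 2)// ?semi_ge0 ?mulr_ge0 ?nrm_ge0 ?semi_ge0//.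
by rewrite aE.
Qed.

Lemma semiD v w : semi (v + w) <= semi v + semi w.
Proof.
rewrite -ler_sqr ?nnegrE ?addr_ge0 ?semi_ge0//.
have := semi_expand v w 1; rewrite scale1r addrC => ->.
rewrite mul1r nrm1 expr1n mul1r sqrrD mulr2n.
have : complex.Re (dot w v) <= semi v * semi w.
  apply: le_trans (ler_norm _) _; apply: le_trans (nrm_Re _) _.
  by rewrite mulrC; exact: semi_cauchy_schwarz.
move: (complex.Re _) (semi v * semi w) (semi v ^+ 2) (semi w ^+ 2) => p q r t; lra.
Qed.

Lemma semi0 : semi 0 = 0.
Proof. by have := semiZ 0 0; rewrite scale0r nrm0 mul0r. Qed.

Lemma semi_eq0 v : (forall w, dot v w = 0) -> semi v = 0.
Proof. by move=> /(_ v) vv; rewrite /semi vv /= sqrtr0. Qed.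

Let dotCr x y : dot x y = (dot y x)^*%C. Proof. exact: (pr_dotC P). Qed.

Lemma pr_adjr f v w : dot v (rho (adj f) w) = dot (rho f v) w.
Proof. by rewrite dotCr (pr_adj P) -dotCr. Qed.

(** The power of exponent [2^n] of the product of [adj f] and [f], bracketed by repeated
    squaring. *)
Fixpoint dpow f n : V := if n is n.+1 then mul (dpow f n) (dpow f n) else mul (adj f) f.

Lemma dpow_symmetric f n v w : dot (rho (dpow f n) v) w = dot v (rho (dpow f n) w).
Proof.
elim: n v w => [|n IH] v w /=; first by rewrite !(pr_mul P) (pr_adj P) pr_adjr.
by rewrite !(pr_mul P) !IH.
Qed.

Lemma semi_rho_sqr f v : semi (rho f v) ^+ 2 <= semi (rho (dpow f 0) v) * semi v.
Proof.
rewrite semi_sqr -(pr_adjr f) /= -(pr_mul P).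
apply: le_trans (ler_norm _) _; apply: le_trans (nrm_Re _) _.
by rewrite mulrC; exact: semi_cauchy_schwarz.
Qed.

(* By Cauchy-Schwarz the numbers a_n = |(f^* f)^(2^n) v| satisfy
   a_n^2 <= a_(n+1) |v|, so that their growth rate bounds |f^* f v| / |v|: no
   boundedness of rho f is assumed. *)
Lemma semi_rho_bound f v (C K : R) : 0 <= K ->
  (forall n, semi (rho (dpow f n) v) <= C * K ^+ (2 ^ n)) ->
  semi (rho f v) ^+ 2 <= K * semi v ^+ 2.
Proof.
move=> K0 H; apply: le_trans (semi_rho_sqr f v) _.
rewrite expr2 mulrA ler_wpM2r ?semi_ge0//.
apply: (doubling_bound (fun n => semi_ge0 (rho (dpow f n) v)) (semi_ge0 v) K0 _ H) => n.
rewrite semi_sqr dpow_symmetric /= (pr_mul P).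
apply: le_trans (ler_norm _) _; apply: le_trans (nrm_Re _) _.
by rewrite mulrC; exact: semi_cauchy_schwarz.
Qed.

Section Bounded.
Variable B : V -> R.
Hypothesis rhoB : forall f v, semi (rho f v) <= B f * semi v.

Definition opn f : R := sup [set semi (rho f v) | v in [set v | semi v <= 1]].

Let opn_has_sup f : has_sup [set semi (rho f v) | v in [set v | semi v <= 1]].
Proof.
split; first by exists (semi (rho f 0)), 0 => //=; rewrite semi0.
exists `|B f| => _ [v /= v1 <-]; apply: le_trans (rhoB _ _) _.
apply: le_trans (_ : `|B f| * semi v <= _); first by rewrite ler_wpM2r ?semi_ge0// ler_norm.
by rewrite -[leRHS]mulr1 ler_wpM2l.
Qed.

Lemma opn_ge0 f : 0 <= opn f.
Proof.
apply: le_trans (semi_ge0 (rho f 0)) _; apply: ub_le_sup; first by case: (opn_has_sup f).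
by exists 0 => //=; rewrite semi0.
Qed.

Lemma opn_ub f v : semi (rho f v) <= opn f * semi v.
Proof.
(* A null vector cannot be normalised; for it the a priori bound [rhoB] shows that its image is null
   too. *)
have [v0|v0] := eqVneq (semi v) 0.
  by have := rhoB f v; rewrite v0 !mulr0.
have v1 : 0 < semi v by rewrite lt_def v0 semi_ge0.
have rZ (a : R[i]) w : rho f (a *: w) = a *: rho f w.
  have r0 : rho f 0 = 0.
    have := pr_linr P 1 f 0 0; rewrite !scale1r addr0.
    by move/(congr1 (fun t => t - rho f 0)); rewrite subrr addrK.
  by have := pr_linr P a f w 0; rewrite addr0 r0 addr0.
have e : semi (((semi v)^-1)%:C *: v) = 1.
  by rewrite semiZ nrm_real ger0_norm ?invr_ge0 ?semi_ge0// mulVf.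
have : semi (rho f (((semi v)^-1)%:C *: v)) <= opn f.
  apply: ub_le_sup; first by case: (opn_has_sup f).
  by exists (((semi v)^-1)%:C *: v) => //=; rewrite e.
by rewrite rZ semiZ nrm_real ger0_norm ?invr_ge0 ?semi_ge0// mulrC ler_pdivrMr.
Qed.

Lemma opn_le f (C : R) : 0 <= C -> (forall v, semi (rho f v) <= C * semi v) -> opn f <= C.
Proof.
move=> C0 fC; apply: ge_sup; first by case: (opn_has_sup f).
move=> _ [v /= v1 <-]; apply: le_trans (fC v) _.
by rewrite -[leRHS]mulr1 ler_wpM2l.
Qed.

Lemma opn_null f : (forall v, semi (rho f v) = 0) -> opn f = 0.
Proof.
move=> f0; apply/eqP; rewrite eq_le opn_ge0 andbT; apply: opn_le => // v.
by rewrite f0 mul0r.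
Qed.

(** The C*-identity comes from Cauchy-Schwarz as for bounded operators. The laws of the adjoint are
    obtained by pairing with arbitrary vectors, which determines a vector up to null vectors
    only. *)
Lemma cstar_seminorm_opn : cstar_seminorm opn.
Proof.
have rD f g v : rho (f + g) v = rho f v + rho g v.
  by have := pr_linl P 1 f g v; rewrite !scale1r.
have rB f g v : rho (f - g) v = rho f v - rho g v.
  by rewrite addrC -scaleN1r (pr_linl P) scaleN1r addrC.
have rZ (a : R[i]) f v : rho (a *: f) v = a *: rho f v.
  have r0 : rho 0 v = 0.
    have := rD 0 0 v; rewrite addr0.
    by move/(congr1 (fun t => t - rho 0 v)); rewrite subrr addrK.
  by have := pr_linl P a f 0 v; rewrite addr0 r0 addr0.
have oM f g : opn (mul f g) <= opn f * opn g.
  apply: opn_le => [|v]; first by rewrite mulr_ge0 ?opn_ge0.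
  rewrite (pr_mul P); apply: le_trans (opn_ub _ _) _.
  by rewrite -mulrA ler_wpM2l ?opn_ge0// opn_ub.
split.
- exact: opn_ge0.
- move=> f g; apply: opn_le => [|v]; first by rewrite addr_ge0 ?opn_ge0.
  by rewrite rD; apply: le_trans (semiD _ _) _; rewrite mulrDl lerD ?opn_ub.
- move=> a f.
  have le b k : opn (b *: k) <= nrm (b : CC R) * opn k.
    apply: opn_le => [|v]; first by rewrite mulr_ge0 ?nrm_ge0 ?opn_ge0.
    by rewrite rZ semiZ -mulrA ler_wpM2l ?nrm_ge0// opn_ub.
  apply/eqP; rewrite eq_le le /=; have [->|a0] := eqVneq a 0.
    by rewrite nrm0 mul0r opn_ge0.
  have -> : opn f = opn (a^-1 *: (a *: f)) by rewrite scalerA mulVf// scale1r.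
  apply: le_trans (ler_wpM2l (nrm_ge0 _) (le _ _)) _.
  by rewrite mulrA -nrmM (divff a0) nrm1 mul1r.
- exact: oM.
- move=> f; apply/eqP; rewrite eq_le; apply/andP; split.
    apply: le_trans (oM _ _) _; rewrite expr2 ler_wpM2r ?opn_ge0//.
    (* The adjoint is no larger than [f]: with [w = rho (adj f) v], the square of [semi w] is the
       pairing of [v] with [rho f w], and one factor [semi w] cancels. *)
    apply: opn_le => [|v]; first exact: opn_ge0.
    have [->|z] := eqVneq (semi (rho (adj f) v)) 0; first by rewrite mulr_ge0 ?opn_ge0 ?semi_ge0.
    have z1 : 0 < semi (rho (adj f) v) by rewrite lt_def z semi_ge0.
    rewrite -(ler_pM2r z1) -expr2 semi_sqr (pr_adj P).
    apply: le_trans (ler_norm _) _; apply: le_trans (nrm_Re _) _.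
    apply: le_trans (semi_cauchy_schwarz _ _) _.
    by rewrite mulrC mulrAC ler_wpM2r ?semi_ge0// opn_ub.
  rewrite -[leRHS]sqr_sqrtr ?opn_ge0// ler_sqr ?nnegrE ?sqrtr_ge0 ?opn_ge0//.
  apply: opn_le => [|v]; first exact: sqrtr_ge0.
  rewrite -[leLHS]ger0_norm ?semi_ge0// -sqrtr_sqr -[X in _ * X]ger0_norm ?semi_ge0//.
  rewrite -sqrtr_sqr -sqrtrM ?opn_ge0// ler_wsqrtr//.
  apply: le_trans (semi_rho_sqr _ _) _; rewrite expr2 mulrA ler_wpM2r ?semi_ge0//.
  exact: opn_ub.
- by move=> f g h; apply: opn_null => v; rewrite rB !(pr_mul P) subrr semi0.
- move=> f g; apply: opn_null => v; apply: semi_eq0 => w.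
  by rewrite rB dotB (pr_mul P) !(pr_adj P) (pr_mul P) subrr.
- move=> f; apply: opn_null => v; apply: semi_eq0 => w.
  by rewrite rB dotB (pr_adj P) pr_adjr subrr.
Qed.

End Bounded.
End PreRepresentation.
End CstarSeminorm.

(** * The algebra C_c(G) *)

Record Ccfun (R : realType) (G : twisted_groupoid R) := CcFun {
  ccval :> G -> CC R;
  ccP : Cc ccval }.

HB.instance Definition _ (R : realType) (G : twisted_groupoid R) := gen_eqMixin (Ccfun G).
HB.instance Definition _ (R : realType) (G : twisted_groupoid R) := gen_choiceMixin (Ccfun G).

Section CcModule.
Variables (R : realType) (G : twisted_groupoid R).
Implicit Types (f g h : Ccfun G).

Lemma Ccfun_eq f g : f =1 g -> f = g.
Proof.
case: f g => [f cf] [g cg] /= /funext fg; subst g.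
by congr CcFun; exact: Prop_irrelevance.
Qed.

Lemma CcD f g : Cc (fun x => f x + g x).
Proof.
have := Cc_lin 1 (ccP f) (ccP g); congr Cc.
by apply/funext => x; rewrite mul1r.
Qed.

Definition Cczero : Ccfun G := CcFun (Cc0 G).
Definition Ccadd f g : Ccfun G := CcFun (CcD f g).
Definition Ccscale (a : R[i]) f : Ccfun G := CcFun (CcZ a (ccP f)).
Definition Ccopp f : Ccfun G := Ccscale (-1) f.
Definition Ccconv f g : Ccfun G := CcFun (Cc_conv (ccP f) (ccP g)).
Definition Ccstar f : Ccfun G := CcFun (Cc_star (ccP f)).
Definition Ccstar_red f : Ccfun G := CcFun (Cc_star_red (ccP f)).

Lemma CcaddA : associative Ccadd.
Proof. by move=> f g h; apply: Ccfun_eq => x /=; rewrite addrA. Qed.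
Lemma CcaddC : commutative Ccadd.
Proof. by move=> f g; apply: Ccfun_eq => x /=; rewrite addrC. Qed.
Lemma Ccadd0 : left_id Cczero Ccadd.
Proof. by move=> f; apply: Ccfun_eq => x /=; rewrite add0r. Qed.
Lemma CcaddN : left_inverse Cczero Ccopp Ccadd.
Proof. by move=> f; apply: Ccfun_eq => x /=; rewrite mulN1r addNr. Qed.

HB.instance Definition _ :=
  GRing.isZmodule.Build (Ccfun G) CcaddA CcaddC Ccadd0 CcaddN.

Lemma CcscaleA a b f : Ccscale a (Ccscale b f) = Ccscale (a * b) f.
Proof. by apply: Ccfun_eq => x /=; rewrite mulrA. Qed.
Lemma Ccscale1 : left_id 1 Ccscale.
Proof. by move=> f; apply: Ccfun_eq => x /=; rewrite mul1r. Qed.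
Lemma CcscaleDr : right_distributive Ccscale +%R.
Proof. by move=> a f g; apply: Ccfun_eq => x /=; rewrite mulrDr. Qed.
Lemma CcscaleDl f : {morph Ccscale^~ f : a b / a + b}.
Proof. by move=> a b; apply: Ccfun_eq => x /=; rewrite mulrDl. Qed.

HB.instance Definition _ := GRing.Zmodule_isLmodule.Build R[i] (Ccfun G)
  CcscaleA Ccscale1 CcscaleDr CcscaleDl.

Lemma Ccfun_linE (a : R[i]) f g x : (a *: f + g) x = (a : CC R) * f x + g x.
Proof. by []. Qed.

Lemma Ccconv_linl (a : R[i]) f g h :
  Ccconv (a *: f + g) h = a *: Ccconv f h + Ccconv g h.
Proof.
apply: Ccfun_eq => x; rewrite [RHS]/= [LHS]convE !convE.
rewrite -(fint_lin (unit_src x) _ (fiberCc_conv x (ccP f) (ccP h)) (fiberCc_conv x (ccP g) (ccP h))).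
by apply: eq_fint => y _; rewrite Ccfun_linE !mulrDl !mulrA.
Qed.

Lemma Ccconv_linr (a : R[i]) f g h :
  Ccconv h (a *: f + g) = a *: Ccconv h f + Ccconv h g.
Proof.
apply: Ccfun_eq => x; rewrite [RHS]/= [LHS]convE !convE.
rewrite -(fint_lin (unit_src x) _ (fiberCc_conv x (ccP h) (ccP f)) (fiberCc_conv x (ccP h) (ccP g))).
by apply: eq_fint => y _; rewrite Ccfun_linE mulrDr mulrDl mulrCA !mulrA.
Qed.

Lemma Ccstar_lin (a : R[i]) f g : Ccstar (a *: f + g) = a^*%C *: Ccstar f + Ccstar g.
Proof.
by apply: Ccfun_eq => x /=; rewrite /star /= mulrDl rmorphD -mulrA rmorphM.
Qed.

Lemma Ccstar_red_lin (a : R[i]) f g :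
  Ccstar_red (a *: f + g) = a^*%C *: Ccstar_red f + Ccstar_red g.
Proof.
apply: Ccfun_eq => x /=; rewrite /star_red.
have /= -> := congr1 (fun k : Ccfun G => k x) (Ccstar_lin a f g).
by rewrite mulrDr mulrCA.
Qed.

(** * Completion of C_c(G) for a C*-seminorm *)

Section CompletionExists.
Variables (N : (G -> CC R) -> \bar R) (adj : (G -> CC R) -> (G -> CC R)).
Variables (Ccadj : Ccfun G -> Ccfun G) (nu : Ccfun G -> R).
Hypothesis adjE : forall f, ccval (Ccadj f) = adj f.
Hypothesis adj_lin : forall (a : R[i]) f g, Ccadj (a *: f + g) = a^*%C *: Ccadj f + Ccadj g.
Hypothesis nuP : cstar_seminorm Ccconv Ccadj nu.
Hypothesis nuE : forall f, N f = (nu f)%:E.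

Definition Cc_pre_cstar : pre_cstar R := PreCstar
  (csn_ge0 nuP) (csnD nuP) (csnZ nuP) Ccconv_linl Ccconv_linr adj_lin
  (csnM nuP) (csn_adj nuP) (csnA nuP) (csn_adjM nuP) (csn_adjK nuP).

Definition Cc_emb (f : G -> CC R) : completion_cstar Cc_pre_cstar :=
  if pselect (Cc f) is left cf then @cemb R Cc_pre_cstar (CcFun cf) else 0.

Lemma Cc_embE (f : Ccfun G) : Cc_emb f = @cemb R Cc_pre_cstar f.
Proof.
rewrite /Cc_emb; case: pselect => [cf|]; last by move/(_ (ccP f)).
by congr cemb; exact: Ccfun_eq.
Qed.

Lemma Cc_emb_completion : is_completion N adj Cc_emb.
Proof.
split.
- move=> a f g cf cg.
  rewrite -[a *: f + g]/(ccval (a *: CcFun cf + CcFun cg)) -[f]/(ccval (CcFun cf)) -[g]/(ccval (CcFun cg)).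
  by rewrite !Cc_embE (@cemb_lin R Cc_pre_cstar).
- move=> f g cf cg; split; first exact: Cc_conv.
  rewrite -[conv f g]/(ccval (Ccconv (CcFun cf) (CcFun cg))) -[f]/(ccval (CcFun cf)) -[g]/(ccval (CcFun cg)).
  by rewrite !Cc_embE (@cemb_mul R Cc_pre_cstar).
- move=> f cf; rewrite -[f]/(ccval (CcFun cf)) -adjE; split; first exact: ccP.
  by rewrite !Cc_embE (@cemb_adj R Cc_pre_cstar).
- move=> f cf; rewrite -[f]/(ccval (CcFun cf)) Cc_embE nuE.
  by rewrite (@nrm_cemb R Cc_pre_cstar).
- have -> : Cc_emb @` @Cc R G = range (@cemb R Cc_pre_cstar).
    apply/seteqP; split => [_ [f cf <-]|_ [f _ <-]].
      by exists (CcFun cf) => //; rewrite -Cc_embE.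
    by exists f; [exact: ccP|rewrite Cc_embE].
  exact: cemb_dense.
Qed.

End CompletionExists.
End CcModule.

(** * The maximal norm *)

Section HilbertForm.
Variables (R : realType) (H : hilbert R).
Implicit Types (v w x y z : H).
Local Notation dot := (hdot H : H -> H -> CC R).

Lemma hdot_lin (a : R[i]) x y z : dot (a *: x + y) z = (a : CC R) * dot x z + dot y z.
Proof. by rewrite linearPl. Qed.

Lemma hdotC x y : dot y x = (dot x y)^*%C.
Proof. by rewrite (@hermC _ false Num.Def.conjC _ (hdot H)) expr0 mul1r. Qed.

Lemma hdot_nrm x : dot x x = ((nrm x ^+ 2)%:C : CC R).
Proof. by rewrite hdotE nrmE -rmorphXn. Qed.

End HilbertForm.

Section MaximalNorm.
Variables (R : realType) (G : twisted_groupoid R).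
Implicit Types (f g : Ccfun G).

Lemma nI_dpow_le (adj : Ccfun G -> Ccfun G) f n : nI (adj f) <= nI f ->
  nI (dpow (@Ccconv R G) adj f n) <= (nI f ^+ 2) ^+ (2 ^ n).
Proof.
move=> adjf.
elim: n => [|n IH] /=.
  rewrite expn0 expr1; apply: le_trans (nI_conv (ccP _) (ccP f)) _.
  by rewrite expr2 ler_wpM2r ?nI_ge0//; exact: ccP.
set p := dpow _ _ _ _ in IH *; apply: le_trans (nI_conv (ccP p) (ccP p)) _.
rewrite expnS mulnC exprM expr2 ler_pM ?nI_ge0//; exact: ccP.
Qed.

Section Representation.
Variables (H : hilbert R) (pi : (G -> CC R) -> {linear H -> H}).
Hypothesis piP : is_representation pi.
Local Notation dot := (hdot H : H -> H -> CC R).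
Local Notation rho := (fun (f : Ccfun G) (v : H) => pi f v).

Lemma representation_pre : pre_representation (@Ccconv R G) (@Ccstar R G) dot rho.
Proof.
split.
- exact: hdot_lin.
- exact: hdotC.
- by move=> x; rewrite hdot_nrm /= sqr_ge0.
- by move=> a f g v; rewrite -(rep_linear piP _ _ (ccP f) (ccP g)).
- by move=> a f v w; rewrite linearP.
- by move=> f g v; exact: (rep_conv piP v (ccP f) (ccP g)).
- by move=> f v w; exact: (rep_star piP v w (ccP f)).
Qed.

Lemma semi_nrm (v : H) : semi dot v = nrm v.
Proof. by rewrite /semi hdot_nrm /= sqrtr_sqr ger0_norm// nrm_ge0. Qed.

Lemma rep_bound : exists M : R, forall f (v : H), nrm (pi f v) <= M * nI f * nrm v.
Proof.
have [M MP] := rep_normI piP; exists `|M| => f v.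
have [->|v0] := eqVneq v 0; first by rewrite linear0 nrm0 mulr0.
have v1 : 0 < nrm v.
  by rewrite lt_def nrm_ge0 andbT; apply/eqP => /nrm0_eq0/eqP; rewrite (negbTE v0).
have w1 : nrm (((nrm v)^-1)%:C *: v) <= 1.
  by rewrite nrmZ nrm_real ger0_norm ?invr_ge0 ?nrm_ge0// mulVf// gt_eqF.
have : ((nrm (pi f (((nrm v)^-1)%:C *: v)))%:E <= (M * nI f)%:E)%E.
  rewrite EFinM -normIE; last exact: ccP.
  apply: le_trans (MP f (ccP f)); apply: ereal_sup_ubound.
  by exists (((nrm v)^-1)%:C *: v).
rewrite lee_fin linearZ nrmZ nrm_real ger0_norm ?invr_ge0 ?nrm_ge0// mulrC ler_pdivrMr// => h.
apply: le_trans h _; rewrite ler_wpM2r ?nrm_ge0// ler_wpM2r ?nI_ge0 ?ler_norm//.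
exact: ccP.
Qed.

(** The bound [M] of the representation goes into the constant of [semi_rho_bound], where the growth
    rate does not see it; the rate is that of [normI], which is submultiplicative and not increased
    by [star]. *)
Lemma representation_le_nI f (v : H) : semi dot (pi f v) <= nI f * semi dot v.
Proof.
have [M MP] := rep_bound.
have nf := nI_ge0 (ccP f).
have K0 : 0 <= nI f ^+ 2 by rewrite sqr_ge0.
have := @semi_rho_bound _ _ _ _ _ _ _ representation_pre f v (`|M| * nrm v) _ K0.
rewrite -exprMn => B.
rewrite -ler_sqr ?nnegrE ?semi_ge0 ?mulr_ge0 ?semi_ge0//; apply: B => n.
set p := dpow _ _ _ _; rewrite semi_nrm; apply: le_trans (MP p v) _.
have h := nI_dpow_le n (nI_star (ccP f) : nI (Ccstar f) <= nI f); rewrite -/p in h.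
have p0 : 0 <= nI p by apply: nI_ge0; exact: ccP.
have -> : M * nI p * nrm v = M * (nI p * nrm v) by rewrite mulrA.
apply: (@le_trans _ _ (`|M| * (nI p * nrm v))).
  by rewrite ler_wpM2r ?ler_norm// mulr_ge0// nrm_ge0.
rewrite -mulrA ler_wpM2l// mulrC ler_wpM2l ?nrm_ge0//.
Qed.

Definition rep_seminorm f : R := opn dot rho f.

Lemma rep_seminormP : cstar_seminorm (@Ccconv R G) (@Ccstar R G) rep_seminorm.
Proof. exact: (cstar_seminorm_opn representation_pre representation_le_nI). Qed.

Lemma rep_seminorm_le f : rep_seminorm f <= nI f.
Proof.
apply: (opn_le representation_pre representation_le_nI); first by apply: nI_ge0; exact: ccP.
by move=> v; exact: representation_le_nI.
Qed.

Lemma opnormE f : opnorm (pi f) = (rep_seminorm f)%:E.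
Proof.
rewrite /opnorm /rep_seminorm /opn -ereal_sup_EFin.
- congr ereal_sup; apply/seteqP; split.
    by move=> _ [v /= v1 <-]; exists (nrm (pi f v)) => //; exists v; rewrite /= ?semi_nrm.
  by move=> _ [_ [v /= v1 <-] <-]; exists v; rewrite /= -?semi_nrm.
- exists (nI f) => _ [v /= v1 <-]; apply: le_trans (representation_le_nI f v) _.
  by rewrite -[leRHS]mulr1 ler_wpM2l// nI_ge0//; exact: ccP.
- exists (semi dot (pi f 0)), 0 => //=; by rewrite semi_nrm nrm0.
Qed.

End Representation.

Definition rep_seminorms : set (Ccfun G -> R) :=
  [set nu | exists (H : hilbert R) (pi : (G -> CC R) -> {linear H -> H}),
     is_representation pi /\ nu = rep_seminorm pi].

Definition max_seminorm := sup_seminorm rep_seminorms.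

Lemma max_seminormP : cstar_seminorm (@Ccconv R G) (@Ccstar R G) max_seminorm.
Proof.
apply: (@cstar_seminorm_sup _ _ _ _ _ (fun f => nI f)).
  by move=> nu [H [pi [piP ->]]]; exact: rep_seminormP.
by move=> nu f [H [pi [piP ->]]]; exact: rep_seminorm_le.
Qed.

End MaximalNorm.

(** * The complex line as a Hilbert space *)

Lemma complex_complete (R : realType) (F : set_system (CC R)) :
  ProperFilter F -> cauchy F -> cvg F.
Proof.
move=> FF Fc.
have part (p : CC R -> R) : (forall z w, `|p z - p w| <= nrm (z - w)) ->
    exists l : R, p @ F --> l.
  move=> lip; apply/(@cvg_ex R); apply/(@cauchy_cvgP R)/(@cauchyP R R) => e e0.
  have e0' : (0 : R[i]) < e%:C by rewrite ltcR.
  have [z Fz] := (cauchyP F).1 Fc _ e0'; exists (p z).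
  move: Fz; apply: (@filterS _ F) => w; rewrite -!ball_normE /= nrmE ltcR.
  exact: le_lt_trans (lip _ _).
have [a aP] := part (fun z => complex.Re z) (fun z w => ltac:(by rewrite -raddfB; exact: nrm_Re)).
have [b bP] := part (fun z => complex.Im z) (fun z w => ltac:(by rewrite -raddfB; exact: nrm_Im)).
apply/cvg_ex; exists (a +i* b); apply/cvg_nrmP => e e0.
have e2 : 0 < e / 2 by rewrite divr_gt0.
have /cvgrPdist_lt/(_ _ e2) h1 := aP; have /cvgrPdist_lt/(_ _ e2) h2 := bP.
apply: (@filterS2 _ F _ _ _ _ _ h1 h2) => z /= z1 z2.
by apply: le_lt_trans (nrm_le_ReIm _) _; rewrite !raddfB (splitr e) ltrD.
Qed.

(* The regular module R[i]^o cannot receive a completeness instance of its own,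
   the head symbol being shared with the regular module of a realType. *)
Definition cplane (R : realType) : Type := CC R.
HB.instance Definition _ (R : realType) := NormedModule.copy (cplane R) (CC R).
HB.instance Definition _ (R : realType) :=
  Uniform_isComplete.Build (cplane R) (@complex_complete R).

Section ComplexHilbert.
Variable R : realType.

Definition cdot (z w : cplane R) : R[i] := (z : CC R) * ((w : R[i])^*)%C.

Lemma cdot_bilinear : bilinear_for *%R (Num.Def.conjC \; *%R) cdot.
Proof.
split=> [w a x y|w a x y]; rewrite /cdot /=.
  by rewrite mulrDl mulrA.
by rewrite rmorphD rmorphM mulrDr mulrCA.
Qed.

HB.instance Definition _ :=
  bilinear_isBilinear.Build R[i] (cplane R) (cplane R) R[i] *%R (Num.Def.conjC \; *%R) cdot cdot_bilinear.

Lemma cdot_herm x y : cdot x y = (-1) ^+ false * Num.Def.conjC (cdot y x).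
Proof.
rewrite expr0 mul1r; change ((x : CC R) * (y^*)%C = ((y : CC R) * (x^*)%C)^*%C).
by rewrite rmorphM /= conjcK mulrC.
Qed.

HB.instance Definition _ := isHermitianSesquilinear.Build R[i] (cplane R) false Num.Def.conjC cdot cdot_herm.

Lemma cdot_gt0 (x : cplane R) : x != 0 -> 0 < cdot x x.
Proof.
move=> x0; rewrite /cdot mul_conjr ltcR exprn_gt0// lt_def nrm_ge0 andbT.
by apply/eqP => /nrm0_eq0/eqP; rewrite (negbTE x0).
Qed.

HB.instance Definition _ := isDotProduct.Build R[i] (cplane R) cdot cdot_gt0.

Lemma cdotE (x : cplane R) : cdot x x = `|x| ^+ 2.
Proof. by rewrite /cdot mul_conjr nrmE -rmorphXn. Qed.

(** This line carries the zero representation and, for spaces, the point evaluations. *)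
Definition complex_hilbert : hilbert R := @Hilbert R (cplane R) cdot cdotE.

End ComplexHilbert.

Section MaximalCompletion.
Variables (R : realType) (G : twisted_groupoid R).

(** It makes the family of all representations nonempty, so that the supremum [norm_max] is
    nonnegative and not minus infinity. *)
Definition zero_representation (f : G -> CC R) :
  {linear complex_hilbert R -> complex_hilbert R} := \0.

Lemma zero_representationP : is_representation zero_representation.
Proof.
split => //=.
- by move=> f _; exact: cst_continuous.
- by move=> a f g v _ _; rewrite scaler0 addr0.
- by move=> f v w _; rewrite /= linear0l linear0r.
- exists 0 => f cf; rewrite mul0e; apply: ge_ereal_sup => _ [v _ <-] /=.
  by rewrite nrm0.
Qed.

Lemma norm_maxE (f : Ccfun G) : norm_max f = (max_seminorm f)%:E.
Proof.
have H1 : (norm_max f <= (max_seminorm f)%:E)%E.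
  apply: ge_ereal_sup => _ [H [pi [piP ->]]]; rewrite (opnormE piP) lee_fin.
  apply: (@sup_seminorm_ub _ _ _ (fun f : Ccfun G => nI f)); last by exists H, pi.
  by move=> nu g [H' [pi' [pi'P ->]]]; exact: rep_seminorm_le.
have H0 : (0 <= norm_max f)%E.
  apply: le_trans (_ : opnorm (zero_representation f) <= _)%E; last first.
    apply: ereal_sup_ubound; exists (complex_hilbert R), zero_representation.
    by split => //; exact: zero_representationP.
  rewrite (opnormE zero_representationP) lee_fin.
  exact: (csn_ge0 (rep_seminormP zero_representationP)).
have fin : norm_max f \is a fin_num.
  by rewrite ge0_fin_numE//; apply: le_lt_trans H1 _; rewrite ltry.
apply/eqP; rewrite eq_le H1/= -(fineK fin) lee_fin.
apply: sup_seminorm_le.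
- exact: fine_ge0.
- move=> nu [H [pi [piP ->]]]; rewrite -lee_fin fineK// -opnormE//.
  by apply: ereal_sup_ubound; exists H, pi.
Qed.

Definition max_cstar : cstar_algebra R :=
  completion_cstar (Cc_pre_cstar (@Ccstar_lin R G) (max_seminormP G)).
Definition max_emb : (G -> CC R) -> max_cstar :=
  Cc_emb (@Ccstar_lin R G) (max_seminormP G).

Lemma max_completion : is_completion (@norm_max R G) (@star R G) max_emb.
Proof. by apply: Cc_emb_completion => // f; exact: norm_maxE. Qed.

End MaximalCompletion.

(** * The reduced norm *)

Section ReducedNorm.
Variables (R : realType) (G : twisted_groupoid R).
Implicit Types (f g h : Ccfun G) (u x y : G).

Lemma nI_star_red f : nI (star_red f) <= nI f.
Proof.
have -> : nI (star_red f) = nI (star f); last exact: nI_star (ccP f).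
have E x : nrm (star_red f x) = nrm (star f x).
  rewrite /star_red nrmM nrm_conj nrm_twist ?mul1r//.
  by rewrite src_rng rng_rng.
rewrite /nI /normI; congr (fine (maxe (ereal_sup (_ `|` _)) (ereal_sup (_ `|` _))));
  by apply/seteqP; split => _ [v uv <-]; exists v => //; apply: eq_integral => x _; rewrite E.
Qed.

Lemma fiberCc_pairing u f g : fiberCc u (fun y => f (inv y) * (g (inv y))^*%C).
Proof.
have cf := Cc_fiberCc u (Cc_inv (ccP f)).
have cg := fiberCc_conj (Cc_fiberCc u (Cc_inv (ccP g))).
exact: (fiberCcM cf (proj1 cg)).
Qed.

Lemma nrm_conv_le f g x (M : R) : (forall y, nrm (g y) <= M) ->
  nrm (conv f g x) <= M * nI f.
Proof.
move=> gM; have M0 : 0 <= M by apply: le_trans (gM x); exact: nrm_ge0.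
have us := unit_src x; have c := fiberCc_conv x (ccP f) (ccP g).
have cf := fiberCc_translate (Cc_fiberCc (rng x) (ccP f)).
rewrite convE; apply: le_trans (nrm_fint_le us c) _.
apply: (@le_trans _ _ (fnorm1 (src x) (fun y => M%:C * f (mul x y)))).
  apply: (fnorm1_le us c (fiberCcZ M%:C cf)) => y yx.
  rewrite !nrmM nrm_real (ger0_norm M0) nrm_twist ?mulr1; last first.
    by rewrite src_mul ?rng_inv// yx.
  by rewrite mulrC ler_wpM2r ?nrm_ge0.
rewrite (fnorm1Z us M%:C cf) nrm_real (ger0_norm M0) ler_wpM2l//.
rewrite -(fnorm1_invariant (Cc_fiberCc (rng x) (ccP f))).
by have [] := nI_ub (unit_rng x) (ccP f).
Qed.

Section Unit.
Variables (u : G) (uu : units u).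

Lemma pairingC f g : pairing u g f = (pairing u f g)^*%C.
Proof.
rewrite /pairing -(fint_conj uu (fiberCc_pairing u f g)).
by apply: eq_fint => y _; rewrite rmorphM /= conjcK mulrC.
Qed.

Lemma pairing_sqr f : pairing u f f =
  ((\int[haar u]_(y in rfiber u) (nrm (f (inv y)) ^+ 2))%:C : CC R).
Proof.
transitivity (fint u (fun y => ((nrm (f (inv y)) ^+ 2)%:C : CC R))).
  by apply: eq_fint => y _; rewrite mul_conjr.
apply: complexE => //=; rewrite /Rintegral integral0_eq//.
Qed.

(** This is Ind(delta_u) restricted to C_c(G), seen inside L^2 of the fibre; functions that vanish
    on the fibre are null vectors. [Ind_normE] shows that the restriction has the same norm. *)
Lemma regular_pre_representation : pre_representation (@Ccconv R G) (@Ccstar_red R G)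
  (fun f g => pairing u f g) (@Ccconv R G).
Proof.
split.
- move=> a f g h; rewrite /pairing.
  rewrite -(fint_lin uu a (fiberCc_pairing u f h) (fiberCc_pairing u g h)).
  by apply: eq_fint => y _; rewrite Ccfun_linE mulrDl mulrA.
- exact: pairingC.
- by move=> f; rewrite pairing_sqr /=; apply: Rintegral_ge0 => x _; rewrite sqr_ge0.
- exact: Ccconv_linl.
- by move=> a f v w; exact: Ccconv_linr.
- by move=> f g v; apply: Ccfun_eq => x /=; rewrite (convA (ccP f) (ccP g) (ccP v)).
- move=> f v w.
  have := pairing_adjoint uu (ccP f) (ccP w) (ccP v).
  rewrite -[conv f w]/(ccval (Ccconv f w)) -[conv (star_red f) v]/(ccval (Ccconv (Ccstar_red f) v)).
  by rewrite (pairingC v) (pairingC (Ccconv (Ccstar_red f) v)) => /(congr1 (fun z : CC R => (z^*)%C)); rewrite !conjcK.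
Qed.

Local Notation semi := (semi (fun f g : Ccfun G => pairing u f g)).

Lemma semi_sqrE f : semi f ^+ 2 = \int[haar u]_(y in rfiber u) (nrm (f (inv y)) ^+ 2).
Proof. by rewrite (semi_sqr regular_pre_representation) pairing_sqr. Qed.

Lemma semi_sqr_le f (M : R) : (forall x, nrm (f x) <= M) -> semi f ^+ 2 <= M * fnorm1 u (fun x => f (inv x)).
Proof.
move=> fM; have M0 : 0 <= M by apply: le_trans (fM u); exact: nrm_ge0.
rewrite (semi_sqr regular_pre_representation); apply: le_trans (ler_norm _) _; apply: le_trans (nrm_Re _) _.
apply: le_trans (nrm_fint_le uu (fiberCc_pairing u f f)) _.
have cf := Cc_fiberCc u (Cc_inv (ccP f)).
apply: le_trans (fnorm1_le uu (fiberCc_pairing u f f) (fiberCcZ M%:C cf) _) _.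
  move=> y _; rewrite !nrmM nrm_conj nrm_real (ger0_norm M0).
  by rewrite ler_wpM2r ?nrm_ge0.
by rewrite (fnorm1Z uu M%:C cf) nrm_real (ger0_norm M0).
Qed.

(** An a priori bound for the powers [p] of [f] comes from estimating the squared L^2 norm of
    [p * v] by its supremum times its L^1 norm: it is at most [M * nI v * nI p ^+ 2], where [M]
    bounds [v]. This is linear growth of the L^2 norm in [nI p], as [semi_rho_bound] requires. *)
Lemma regular_le_nI f v : semi (Ccconv f v) <= nI f * semi v.
Proof.
have [M M0 vM] := Cc_bounded (ccP v).
have nf := nI_ge0 (ccP f); have nv := nI_ge0 (ccP v).
have K0 : 0 <= nI f ^+ 2 by rewrite sqr_ge0.
have := @semi_rho_bound _ _ _ _ _ _ _ regular_pre_representation f v (Num.sqrt (M * nI v)) _ K0.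
rewrite -exprMn => B.
rewrite -ler_sqr ?nnegrE ?semi_ge0 ?mulr_ge0 ?semi_ge0//; apply: B => n.
have := nI_dpow_le n (nI_star_red f : nI (Ccstar_red f) <= nI f).
set p := dpow _ _ _ _ => h.
have p0 : 0 <= nI p by apply: nI_ge0; exact: ccP.
apply: (@le_trans _ _ (Num.sqrt (M * nI v) * nI p)); last by rewrite ler_wpM2l ?sqrtr_ge0.
rewrite -ler_sqr ?nnegrE ?semi_ge0 ?mulr_ge0 ?sqrtr_ge0// exprMn [X in _ <= X * _]sqr_sqrtr ?mulr_ge0//.
apply: le_trans (semi_sqr_le (M := M * nI p) _) _.
  by move=> x; exact: nrm_conv_le.
have -> : M * nI v * nI p ^+ 2 = (M * nI p) * (nI v * nI p) by rewrite expr2 mulrACA.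
rewrite ler_wpM2l ?mulr_ge0//.
apply: le_trans (fnorm1_conv_inv uu (ccP p) (ccP v) p0 _) _.
  by move=> w uw; have [] := nI_ub uw (ccP p).
by rewrite ler_wpM2r//; have [] := nI_ub uu (ccP v).
Qed.

Definition regular_seminorm f : R :=
  opn (fun f g : Ccfun G => pairing u f g) (@Ccconv R G) f.

Lemma regular_seminormP : cstar_seminorm (@Ccconv R G) (@Ccstar_red R G) regular_seminorm.
Proof. exact: (cstar_seminorm_opn regular_pre_representation regular_le_nI). Qed.

Lemma regular_seminorm_le f : regular_seminorm f <= nI f.
Proof.
apply: (opn_le regular_pre_representation regular_le_nI); first by apply: nI_ge0; exact: ccP.
by move=> v; exact: regular_le_nI.
Qed.

Lemma regular_seminorm_ub f v : semi (Ccconv f v) <= regular_seminorm f * semi v.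
Proof. exact: (opn_ub regular_pre_representation regular_le_nI). Qed.

End Unit.

Definition regular_seminorms : set (Ccfun G -> R) :=
  [set nu | exists2 u, units u & nu = regular_seminorm u].

Definition red_seminorm := sup_seminorm regular_seminorms.

Lemma red_seminormP : cstar_seminorm (@Ccconv R G) (@Ccstar_red R G) red_seminorm.
Proof.
apply: (@cstar_seminorm_sup _ _ _ _ _ (fun f => nI f)).
  by move=> nu [u uu ->]; exact: regular_seminormP.
by move=> nu f [u uu ->]; exact: regular_seminorm_le.
Qed.

Lemma red_seminorm_ub u f : units u -> regular_seminorm u f <= red_seminorm f.
Proof.
move=> uu; apply: (@sup_seminorm_ub _ _ _ (fun f => nI f)); last by exists u.
by move=> nu g [v uv ->]; exact: regular_seminorm_le.
Qed.

Lemma red_seminorm_le_nI f : red_seminorm f <= nI f.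
Proof.
apply: sup_seminorm_le; first exact: nI_ge0 (ccP f).
by move=> nu [v uv ->]; exact: regular_seminorm_le.
Qed.

End ReducedNorm.

(** * Density of C_c in L^2 of a Radon measure *)

Section L2Density.
Import HBNNSimple.
Variables (R : realType) (T : topologicalType) (u : T).
Variable m : {measure set borel u -> \bar R}.
Hypothesis (lcT : locally_compact [set: T]) (hT : hausdorff_space T).
Hypothesis mR : is_radon m.
Implicit Types (h g k : borel u -> R).

Definition square_integral h : \bar R := (\int[m]_x (h x ^+ 2)%:E)%E.

Lemma measurable_square h : measurable_fun setT h ->
  measurable_fun setT (fun x => (h x ^+ 2)%:E).
Proof. by move=> mh; apply/measurable_EFinP; apply: measurable_funX. Qed.

Lemma square_integralD_le h g : measurable_fun setT h -> measurable_fun setT g ->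
  (square_integral (h \+ g)%R <= 2%:E * square_integral h + 2%:E * square_integral g)%E.
Proof.
move=> mh mg; have mh2 := measurable_square mh; have mg2 := measurable_square mg.
rewrite /square_integral -!ge0_integralZl_EFin//; last 2 first.
  by move=> x _; rewrite lee_fin sqr_ge0.
  by move=> x _; rewrite lee_fin sqr_ge0.
rewrite -ge0_integralD//; last 4 first.
- by move=> x _; rewrite -EFinM lee_fin mulr_ge0// sqr_ge0.
- exact: measurable_funeM.
- by move=> x _; rewrite -EFinM lee_fin mulr_ge0// sqr_ge0.
- exact: measurable_funeM.
apply: ge0_le_integral => //.
- by move=> x _; rewrite lee_fin sqr_ge0.
- by apply: measurable_square; exact: measurable_funD.
- by apply: emeasurable_funD; exact: measurable_funeM.
move=> x _; rewrite -!EFinM -EFinD lee_fin /=.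
by have := sqr_ge0 (h x - g x); move: (h x) (g x) => a b; nra.
Qed.

Lemma square_integralZ (a : R) h : measurable_fun setT h ->
  square_integral (fun x => a * h x) = ((a ^+ 2)%:E * square_integral h)%E.
Proof.
move=> mh; rewrite /square_integral -ge0_integralZl_EFin ?sqr_ge0//; last 2 first.
- by move=> x _; rewrite lee_fin sqr_ge0.
- exact: measurable_square.
by apply: eq_integral => x _; rewrite exprMn EFinM.
Qed.

Definition test_function k := continuous (k : T -> R) /\ compact (closure [set x : T | k x != 0]).

Lemma test_measurable k : test_function k -> measurable_fun setT k.
Proof.
move=> [ck _]; apply: (@within_continuous_measurable R T u setT k); first exact: closedT.
exact: continuous_subspaceT.
Qed.

Definition approximable h := forall e : R, 0 < e -> exists2 k, test_function k &
  (square_integral (fun x => h x - k x)%R < e%:E)%E.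

Lemma approximable_lim h : measurable_fun setT h -> (forall e : R, 0 < e ->
   exists g, [/\ measurable_fun setT g, approximable g & (square_integral (fun x => (h x - g x))%R < e%:E)%E]) ->
  approximable h.
Proof.
move=> mh H e e0; have e4 : 0 < e / 4 by rewrite divr_gt0.
have [g [mg ag hg]] := H _ e4; have [k tk gk] := ag _ e4; exists k => //.
have mk := test_measurable tk.
have -> : (fun x => h x - k x) = ((fun x => h x - g x) \+ (fun x => g x - k x))%R.
  by apply/funext => x /=; rewrite subrKA.
apply: le_lt_trans (square_integralD_le _ _) _; [exact: measurable_funB|exact: measurable_funB|].
have -> : e%:E = (2%:E * (e / 4)%:E + 2%:E * (e / 4)%:E)%E by rewrite -!EFinM -EFinD; congr EFin; field.
by rewrite lteD// lte_pmul2l.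
Qed.

Lemma approximableD h g : measurable_fun setT h -> measurable_fun setT g ->
  approximable h -> approximable g -> approximable (fun x => h x + g x).
Proof.
move=> mh mg ah ag e e0; have e4 : 0 < e / 4 by rewrite divr_gt0.
have [k tk hk] := ah _ e4; have [l tl gl] := ag _ e4.
have mk := test_measurable tk; have ml := test_measurable tl.
exists (fun x => k x + l x).
  split; first by move=> x; exact: (cvgD (tk.1 x) (tl.1 x)).
  have cC := compactU tk.2 tl.2.
  apply: (subclosed_compact (@closed_closure _ _) cC).
  rewrite -closureU; apply: closure_subset => x /=; apply: contra_neqP => /not_orP[/negP + /negP].
  by rewrite !negbK => /eqP -> /eqP ->; rewrite addr0.
have -> : (fun x => h x + g x - (k x + l x)) = ((fun x => h x - k x) \+ (fun x => g x - l x))%R.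
  by apply/funext => x /=; rewrite opprD addrACA.
apply: le_lt_trans (square_integralD_le _ _) _; [exact: measurable_funB|exact: measurable_funB|].
have -> : e%:E = (2%:E * (e / 4)%:E + 2%:E * (e / 4)%:E)%E by rewrite -!EFinM -EFinD; congr EFin; field.
by rewrite lteD// lte_pmul2l.
Qed.

Lemma approximable0 : approximable (fun=> 0).
Proof.
move=> e e0; exists (fun=> 0).
  split; first exact: cst_continuous.
  rewrite (_ : [set _ | _] = set0) ?closure0; first exact: compact0.
  by apply/seteqP; split => // x /=; rewrite eqxx.
rewrite /square_integral integral0_eq ?lte_fin// => x _.
by rewrite subr0 expr0n.
Qed.

Lemma approximableZ (a : R) h : measurable_fun setT h -> approximable h ->
  approximable (fun x => a * h x).
Proof.
move=> mh ah e e0; have [->|a0] := eqVneq a 0.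
  have [k tk hk] := approximable0 e0; exists k => //.
  by under eq_fun do rewrite mul0r.
have a2 : 0 < a ^+ 2 by rewrite exprn_even_gt0.
have [k tk hk] := ah _ (divr_gt0 e0 a2); exists (fun x => a * k x).
  split; first by move=> x; apply: cvgM; [exact: cvg_cst|exact: tk.1].
  apply: (subclosed_compact (@closed_closure _ _) tk.2); apply: closure_subset => x /=.
  by apply: contra => /eqP ->; rewrite mulr0.
have mk := test_measurable tk.
under eq_fun do rewrite -mulrBr.
rewrite square_integralZ; last exact: measurable_funB.
have -> : e%:E = ((a ^+ 2)%:E * (e / a ^+ 2)%:E)%E.
  by rewrite -EFinM; congr EFin; field; rewrite a0.
by rewrite lte_pmul2l.
Qed.

(** Inner regularity is available for open sets, so [K] exhausts [U] and may leave [B]. Still the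
    cutoff agrees with the indicator on [B] intersected with [K] and outside [U], and the rest of
    [U] is covered by the small sets [U] minus [B] and [U] minus [K]. *)
Lemma approximable_indic (B : set (borel u)) : measurable B -> (m B < +oo)%E ->
  approximable (\1_B).
Proof.
move=> mB fB e e0; have e2 : 0 < e / 2 by rewrite divr_gt0.
have finB : m B \is a fin_num by rewrite ge0_fin_numE.
have [U [oU BU] UB] : exists2 U : set T, open U /\ B `<=` U & (m U < m B + (e / 2)%:E)%E.
  have : (m B < m B + (e / 2)%:E)%E by rewrite lteDl// lte_fin.
  rewrite {1}(radon_outer mR mB) => /ereal_inf_lt[_ [U [oU BU] <-] UB].
  by exists U.
have mU : measurable (U : set (borel u)) by exact: sub_sigma_algebra.
have fU : (m U < +oo)%E by apply: lt_trans UB _; rewrite -(fineK finB) -EFinD ltry.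
have finU : m U \is a fin_num by rewrite ge0_fin_numE.
have [K [cK KU] UK] : exists2 K : set T, compact K /\ K `<=` U & (m U - (e / 2)%:E < m K)%E.
  have : (m U - (e / 2)%:E < m U)%E by rewrite lteBlDr// lteDl// lte_fin.
  rewrite {2}(radon_inner mR oU) => /ereal_sup_gt[_ [K [cK KU] <-] UK].
  by exists K.
have mK : measurable (K : set (borel u)) by exact: compact_measurable_borel.
have [k [ck k01 kK cs kU]] := @compact_cutoff R T lcT hT K U cK oU KU.
exists (k : borel u -> R) => //.
have mk : measurable_fun setT (k : borel u -> R) by exact: test_measurable.
have mUK : measurable (U `\` (B `&` K) : set (borel u)) by apply: measurableD => //; exact: measurableI.
have le : (square_integral (fun x => \1_B x - k x)%R <= m (U `\` (B `&` K) : set (borel u)))%E.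
  have -> : m (U `\` (B `&` K) : set (borel u)) = (\int[m]_x (\1_(U `\` (B `&` K) : set (borel u)) x)%:E)%E.
    by rewrite integral_indic// setIT.
  apply: ge0_le_integral => //.
  - by move=> x _; rewrite lee_fin sqr_ge0.
  - by apply: measurable_square; apply: measurable_funB => //; exact: measurable_indic.
  - by apply/measurable_EFinP; exact: measurable_indic.
  move=> x _; rewrite lee_fin !indicE.
  have k0 : ~ U x -> k x = 0.
    by move=> nU; apply/eqP; apply: contra_notT nU => kx; apply: kU; exact: subset_closure.
  have /andP[kx0 kx1] := k01 x.
  have [xB|xB] := boolP (x \in B); have [xK|xK] := boolP (x \in (U `\` (B `&` K) : set (borel u))) => /=.
  - by nra.
  - have Kx : K x.
      apply: contrapT => nK; move/negP: xK; apply; rewrite inE; split.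
        by apply: BU; rewrite -inE.
      by case.
    by rewrite kK// subrr expr0n.
  - by nra.
  - rewrite k0 ?subrr ?expr0n// => Ux; move/negP: xK; apply; rewrite inE; split => //.
    by case; rewrite -inE (negbTE xB).
apply: le_lt_trans le _.
apply: (@le_lt_trans _ _ (m (U `\` B : set (borel u)) + m (U `\` K : set (borel u)))%E).
  rewrite setDIr; apply: measureU2; exact: measurableD.
have -> : e%:E = ((e / 2)%:E + (e / 2)%:E)%E by rewrite -EFinD -splitr.
have mD (A : set (borel u)) : measurable A -> A `<=` U -> m (U `\` A : set (borel u)) = (m U - m A)%E.
  by move=> mA AU; rewrite measureD// setIidr.
rewrite (mD _ mB BU) (mD _ mK KU).
have finK : m K \is a fin_num.
  by rewrite ge0_fin_numE//; apply: le_lt_trans fU; apply: le_measure; rewrite ?inE.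
apply: lteD; first by rewrite lteBlDl.
by rewrite lteBlDl// addeC -lteBlDl// -?lteBlDr// lteBlDl.
Qed.

(** Simple functions increase to [h], and the squared differences are dominated by the square of
    [h]. Each simple function is approximable because its nonzero levels have finite measure. *)
Lemma approximable_nonneg h : measurable_fun setT h -> (forall x, 0 <= h x) ->
  (square_integral h < +oo)%E -> approximable h.
Proof.
move=> mh h0 fh.
have mh' : measurable_fun setT (EFin \o h) by exact/measurable_EFinP.
have h0' x : setT x -> (0 <= (EFin \o h) x)%E by move=> _; rewrite lee_fin.
pose g := nnsfun_approx measurableT mh'.
have gh n x : g n x <= h x.
  by rewrite -lee_fin /g nnsfun_approxE; exact: (le_approx n h0' I).
have ag n : approximable (g n).
  have -> : (g n : borel u -> R) = fun x => \sum_(y \in range (g n)) (y * \1_(g n @^-1` [set y]) x).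
    by apply/funext => x; exact: fimfunE.
  have fin : finite_set (range (g n)) by exact: fimfunP.
  under eq_fun do rewrite fsbig_finite//=.
  have mg y : measurable (g n @^-1` [set y]) by exact: measurable_sfunP.
  suff H s : measurable_fun setT (fun x => \sum_(y <- s) (y * \1_(g n @^-1` [set y]) x)) /\
      approximable (fun x => \sum_(y <- s) (y * \1_(g n @^-1` [set y]) x)) by exact: (H _).2.
  elim: s => [|y s [IH1 IH2]].
    by under eq_fun do rewrite big_nil; split; [exact: measurable_cst|exact: approximable0].
  under eq_fun do rewrite big_cons.
  have my : measurable_fun setT (fun x : borel u => y * \1_(g n @^-1` [set y]) x).
    by apply: measurable_funM => //; exact: measurable_indic.
  split; first exact: measurable_funD.
  apply: approximableD => //.
  have [->|y0] := eqVneq y 0.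
    by under eq_fun do rewrite mul0r; exact: approximable0.
  apply: approximableZ; first exact: measurable_indic.
  apply: approximable_indic => //.
  have y2 : 0 < y ^+ 2 by rewrite exprn_even_gt0.
  (* Chebyshev's inequality: on the level [y] of [g n] the function [h] is at least [y]. *)
  have : ((y ^+ 2)%:E * m (g n @^-1` [set y]) <= square_integral h)%E.
    rewrite -[X in m X]setIT -integral_indic//.
    have y2' := ltW y2; rewrite -ge0_integralZl_EFin//; last by apply/measurable_EFinP; exact: measurable_indic.
    apply: ge0_le_integral => //.
    - by move=> x _; rewrite -EFinM lee_fin mulr_ge0// ltW.
    - by apply: measurable_funeM; apply/measurable_EFinP; exact: measurable_indic.
    - exact: measurable_square.
    move=> x _; rewrite -EFinM lee_fin indicE; case: (boolP (x \in _)); last by rewrite mulr0 sqr_ge0.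
    by rewrite inE /= => gy; rewrite mulr1 -gy ler_sqr ?nnegrE.
  move/le_lt_trans => /(_ _ fh); case: (m _) (measure_ge0 m (g n @^-1` [set y])) => [r _ _|_|//]; first exact: ltry.
  by rewrite gt0_muley ?lte_fin.
apply: approximable_lim => // e e0.
have : (\int[m]_x ((h x - g n x) ^+ 2)%:E @[n --> \oo] --> \int[m]_x (cst 0%E x))%E.
  apply: (@dominated_cvg _ _ _ m setT measurableT (fun n x => ((h x - g n x) ^+ 2)%:E) (cst 0%E)
     (fun x => (h x ^+ 2)%:E)).
  - by move=> n; apply: measurable_square; apply: measurable_funB.
  - move=> x _; have := @cvg_nnsfun_approx _ _ _ _ measurableT _ mh' h0' x I.
    move/fine_cvgP => [_ /= gx].
    have : (h x - g n x) ^+ 2 @[n --> \oo] --> (h x - h x) ^+ 2.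
      by rewrite !expr2; apply: cvgM; (apply: cvgB; [exact: cvg_cst|exact: gx]).
    by rewrite subrr expr0n => c; apply: cvg_EFin => //; exact: nearW.
  - by [].
  - apply/integrableP; split; first exact: measurable_square.
    by under eq_integral do rewrite gee0_abs ?lee_fin ?sqr_ge0//.
  - move=> n x _; rewrite gee0_abs ?lee_fin ?sqr_ge0// ler_sqr ?nnegrE// ?subr_ge0//.
    by rewrite gerBl.
rewrite integral0 => /fine_cvgP[fin /cvgrPdist_lt/(_ _ e0) lt].
have [n [/= fn ltn]] := filter_ex (filterI fin lt).
exists (g n); split => //.
by rewrite /square_integral -(fineK fn) lte_fin; move: ltn; rewrite sub0r normrN; exact: le_lt_trans (ler_norm _).
Qed.

Lemma radon_l2_dense h : measurable_fun setT h -> (square_integral h < +oo)%E ->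
  approximable h.
Proof.
move=> mh fh.
have part h' : measurable_fun setT h' -> (forall x, 0 <= h' x) -> (forall x, h' x <= `|h x|) -> approximable h'.
  move=> mh' h0 hh; apply: approximable_nonneg => //; apply: le_lt_trans fh.
  apply: ge0_le_integral => //.
  - by move=> x _; rewrite lee_fin sqr_ge0.
  - exact: measurable_square.
  - exact: measurable_square.
  by move=> x _; rewrite lee_fin -[h x ^+ 2]real_normK ?num_real// ler_sqr ?nnegrE.
have mp := measurable_funrpos mh; have mn := measurable_funrneg mh.
have -> : h = fun x => h^\+ x + (-1) * h^\- x.
  apply/funext => x; rewrite mulN1r.
  by have := congr1 (fun k => k x) (funrposBneg h) => /= <-.
apply: approximableD => //; first by apply: measurable_funM.
  apply: part => //.
  by move=> x; rewrite /funrpos ge_max ler_norm normr_ge0.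
apply: approximableZ => //.
apply: part => //.
by move=> x; rewrite /funrneg ge_max normr_ge0 andbT -normrN ler_norm.
Qed.

End L2Density.

(** * Square-integrable complex functions *)

Section SquareIntegrable.
Variables (R : realType) (d : measure_display) (T : measurableType d).
Variables (mu : {measure set T -> \bar R}) (D : set T).
Hypothesis mD : measurable D.
Implicit Types (f g : T -> CC R).

Definition cmeasurable f := measurable_fun D (fun x => complex.Re (f x)) /\
  measurable_fun D (fun x => complex.Im (f x)).

Definition qint f : \bar R := (\int[mu]_(x in D) (nrm (f x) ^+ 2)%:E)%E.

Lemma cmeasurableM f g : cmeasurable f -> cmeasurable g -> cmeasurable (fun x => f x * g x).
Proof.
move=> [f1 f2] [g1 g2]; split.
  rewrite (_ : (fun x => _) = fun x => complex.Re (f x) * complex.Re (g x) -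
      complex.Im (f x) * complex.Im (g x)); last by apply/funext => x; case: (f x) (g x) => [a b] [].
  by apply: measurable_funB; apply: measurable_funM.
rewrite (_ : (fun x => _) = fun x => complex.Re (f x) * complex.Im (g x) +
    complex.Im (f x) * complex.Re (g x)); last by apply/funext => x; case: (f x) (g x) => [a b] [].
by apply: measurable_funD; apply: measurable_funM.
Qed.

Lemma cmeasurableB f g : cmeasurable f -> cmeasurable g -> cmeasurable (fun x => f x - g x).
Proof.
move=> [f1 f2] [g1 g2]; split.
  by under eq_fun do rewrite raddfB; exact: measurable_funB.
by under eq_fun do rewrite raddfB; exact: measurable_funB.
Qed.

Lemma cmeasurable_nrm2 f : cmeasurable f -> measurable_fun D (fun x => nrm (f x) ^+ 2).
Proof.
move=> [f1 f2]; under eq_fun do rewrite nrm_sqr.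
by apply: measurable_funD; apply: measurable_funX.
Qed.

Lemma cmeasurable_nrm f : cmeasurable f -> measurable_fun D (fun x => nrm (f x)).
Proof.
move=> /cmeasurable_nrm2 mf.
rewrite (_ : (fun x => _) = Num.sqrt \o (fun x => nrm (f x) ^+ 2)).
  apply: measurableT_comp => //; apply: continuous_measurable_fun; exact: sqrt_continuous.
by apply/funext => x /=; rewrite sqrtr_sqr ger0_norm// nrm_ge0.
Qed.

Let mE (h : T -> R) : measurable_fun D h -> measurable_fun D (fun x => (h x)%:E).
Proof. by move=> mh; apply/measurable_EFinP. Qed.

Lemma qint_ge0 f : (0 <= qint f)%E.
Proof. by apply: integral_ge0 => x _; rewrite lee_fin sqr_ge0. Qed.

Lemma qint_le_lin f g (h : T -> R) (a b : R) : cmeasurable f -> cmeasurable g -> measurable_fun D h ->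
  0 <= a -> 0 <= b -> (forall x, D x -> 0 <= h x) ->
  (forall x, D x -> h x <= a * nrm (f x) ^+ 2 + b * nrm (g x) ^+ 2) ->
  (\int[mu]_(x in D) (h x)%:E <= a%:E * qint f + b%:E * qint g)%E.
Proof.
move=> mf mg mh a0 b0 h0 hfg.
have mf2 := mE (cmeasurable_nrm2 mf); have mg2 := mE (cmeasurable_nrm2 mg).
rewrite /qint -!ge0_integralZl_EFin//; last 2 first.
  by move=> x _; rewrite lee_fin sqr_ge0.
  by move=> x _; rewrite lee_fin sqr_ge0.
rewrite -ge0_integralD//; last 4 first.
- by move=> x _; rewrite -EFinM lee_fin mulr_ge0// sqr_ge0.
- exact: measurable_funeM.
- by move=> x _; rewrite -EFinM lee_fin mulr_ge0// sqr_ge0.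
- exact: measurable_funeM.
apply: ge0_le_integral => //.
- exact: mE.
- by apply: emeasurable_funD; exact: measurable_funeM.
Qed.

(** Young's inequality with a weight: a small [t] keeps the coefficient of the main term [f] close
    to 1, at the price of a large coefficient for the perturbation [g]. *)
Lemma qintD_le f g (h : T -> CC R) (t : R) : cmeasurable f -> cmeasurable g -> cmeasurable h -> 0 < t ->
  (forall x, D x -> nrm (h x) <= nrm (f x) + nrm (g x)) ->
  (qint h <= (1 + t)%:E * qint f + (1 + t^-1)%:E * qint g)%E.
Proof.
move=> mf mg mh t0 hfg; have t1 : 0 < t^-1 by rewrite invr_gt0.
apply: qint_le_lin => //; [exact: cmeasurable_nrm2|lra|lra|by move=> x _; rewrite sqr_ge0|].
move=> x /hfg hx; apply: (@le_trans _ _ ((nrm (f x) + nrm (g x)) ^+ 2)).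
  by rewrite ler_sqr ?nnegrE ?addr_ge0 ?nrm_ge0.
rewrite -subr_ge0; move: (nrm (f x)) (nrm (g x)) => a b.
have -> : (1 + t) * a ^+ 2 + (1 + t^-1) * b ^+ 2 - (a + b) ^+ 2 = t^-1 * (t * a - b) ^+ 2.
  by field; rewrite gt_eqF.
by rewrite mulr_ge0 ?sqr_ge0// ltW.
Qed.

Section Product.
Variables (f g : T -> CC R).
Hypothesis (mf : cmeasurable f) (mg : cmeasurable g).
Hypothesis (ff : (qint f < +oo)%E) (fg : (qint g < +oo)%E).

Let prod_le (t : R) : 0 < t -> (\int[mu]_(x in D) (nrm (f x * g x))%:E <=
  (t / 2)%:E * qint f + (t^-1 / 2)%:E * qint g)%E.
Proof.
move=> t0; have t1 : 0 < t^-1 by rewrite invr_gt0.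
apply: qint_le_lin => //; [by apply: cmeasurable_nrm; exact: cmeasurableM|lra|lra|by move=> x _; rewrite nrm_ge0|].
move=> x _; rewrite nrmM -subr_ge0; move: (nrm (f x)) (nrm (g x)) => a b.
have -> : t / 2 * a ^+ 2 + t^-1 / 2 * b ^+ 2 - a * b = t^-1 / 2 * (t * a - b) ^+ 2.
  by field; rewrite gt_eqF.
by rewrite mulr_ge0 ?sqr_ge0// divr_ge0// ltW.
Qed.

Lemma qint_cintegrableM : cintegrable mu D (fun x => f x * g x).
Proof.
have [m1 m2] := cmeasurableM mf mg.
have fin : (\int[mu]_(x in D) (nrm (f x * g x))%:E < +oo)%E.
  apply: le_lt_trans (prod_le ltr01) _.
  by apply: lte_add_pinfty; rewrite lte_mul_pinfty// lee_fin// ?invr1 mul1r.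
have mn : measurable_fun D (fun x => (nrm (f x * g x))%:E).
  by apply: mE; apply: cmeasurable_nrm; exact: cmeasurableM.
split; apply/integrableP; (split; first exact: mE); apply: le_lt_trans fin;
  apply: ge0_le_integral => //; try (by move=> x _; rewrite abse_ge0);
  try (by apply: measurableT_comp => //; exact: mE) => x _.
  by move=> x _ /=; rewrite lee_fin nrm_Re.
by move=> x _ /=; rewrite lee_fin nrm_Im.
Qed.

(** Cauchy-Schwarz with its parameter left free, from [a b <= t a^2 / 2 + b^2 / (2 t)]. *)
Lemma nrm_cintegralM_le (t : R) : 0 < t -> nrm (cintegral mu D (fun x => f x * g x)) <=
  (t / 2) * fine (qint f) + (t^-1 / 2) * fine (qint g).
Proof.
move=> t0; apply: le_trans (nrm_cintegral_le mD qint_cintegrableM) _.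
have finf : qint f \is a fin_num by rewrite ge0_fin_numE ?qint_ge0.
have fing : qint g \is a fin_num by rewrite ge0_fin_numE ?qint_ge0.
have := prod_le t0; rewrite -(fineK finf) -(fineK fing) -!EFinM -EFinD.
have i0 : (0 <= \int[mu]_(x in D) (nrm (f x * g x))%:E)%E.
  by apply: integral_ge0 => x _; rewrite lee_fin nrm_ge0.
move=> h; rewrite -lee_fin /Rintegral [X in (X <= _)%E]fineK//.
by rewrite ge0_fin_numE//; apply: le_lt_trans h _; exact: ltry.
Qed.

End Product.
End SquareIntegrable.

(** * The regular representations on L^2 *)

Section RegularRepresentation.
Variables (R : realType) (G : twisted_groupoid R) (u : G).
Hypothesis uu : units u.
Implicit Types (xi eta : G -> CC R) (f g : Ccfun G).

Local Notation semi := (semi (fun f g : Ccfun G => pairing u f g)).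
Local Notation meas := (@cmeasurable R _ (borel u) (rfiber u)).
Local Notation q := (@qint R _ (borel u) (haar u) (rfiber u)).

Let mr : measurable (rfiber u : set (borel u)) := @measurable_rfiber R G u u.

Lemma inv_measurable : measurable_fun setT (inv : borel u -> borel u).
Proof.
apply: (@measurability _ _ (borel u) (borel u) setT _ (open : set (set (pointed_at u)))) => //.
move=> _ [B oB <-]; rewrite setTI; apply: sub_sigma_algebra.
by apply: (@open_comp G G inv B) oB => x _; exact: inv_continuous.
Qed.

Lemma sfiber_inv : inv @^-1` sfiber u = rfiber u :> set G.
Proof. by apply/seteqP; split => x; rewrite /sfiber /rfiber /= src_inv. Qed.

Lemma measurable_sfiber : measurable (sfiber u : set (borel u)).
Proof.
have -> : sfiber u = setT `&` inv @^-1` (rfiber u).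
  by rewrite setTI; apply/seteqP; split => x; rewrite /sfiber /rfiber /= rng_inv.
exact: inv_measurable.
Qed.

Lemma measurable_comp_inv (h : G -> R) : measurable_fun (sfiber u : set (borel u)) (h : borel u -> R) ->
  measurable_fun (rfiber u : set (borel u)) ((fun y => h (inv y)) : borel u -> R).
Proof.
move=> mh; apply: (@measurable_comp _ _ _ _ _ _ (sfiber u : set (borel u)) h _ (inv : borel u -> borel u)) => //.
- exact: measurable_sfiber.
- by move=> _ [x xu <-]; rewrite /sfiber /= src_inv.
- by apply: (measurable_funS _ _ inv_measurable).
Qed.

Lemma l2normE xi : @cmeasurable R _ (borel u) (sfiber u) xi ->
  l2norm u xi = ((q (fun y => xi (inv y))) `^ 2^-1)%E.
Proof.
move=> mxi; rewrite /l2norm /haar_inv ge0_integral_pushforward.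
- by rewrite sfiber_inv.
- exact: inv_measurable.
- exact: measurable_sfiber.
- by apply/measurable_EFinP; apply: (cmeasurable_nrm2 mxi).
- by move=> x _; rewrite lee_fin sqr_ge0.
Qed.

Lemma fiberCc_measurable xi : fiberCc u xi -> meas xi.
Proof.
move=> [cxi _]; split; apply: within_continuous_measurable; try exact: closed_rfiber.
  exact: within_continuous_Re.
exact: within_continuous_Im.
Qed.

Lemma fiberCc_qint xi : fiberCc u xi -> (q xi < +oo)%E.
Proof.
move=> cxi; have c2 := fiberCcM cxi (proj1 (fiberCc_conj cxi)).
have /cintegrable_nrm := fiberCc_integrable uu c2.
move=> /(_ mr) /integrableP[_]; apply: le_lt_trans.
rewrite le_eqVlt; apply/orP; left; apply/eqP; apply: eq_integral => x _.
by rewrite /= nrmM nrm_conj -expr2 ger0_norm// sqr_ge0.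
Qed.

Lemma fiberCc_inv f : fiberCc u (fun y => f (inv y)).
Proof. exact: Cc_fiberCc (Cc_inv (ccP f)). Qed.

Lemma semi_qint f : ((semi f ^+ 2)%:E = q (fun y => f (inv y)))%E.
Proof.
rewrite semi_sqrE// /Rintegral fineK// ge0_fin_numE; first exact: fiberCc_qint (fiberCc_inv f).
exact: qint_ge0.
Qed.

Lemma Cc_measurable_sfiber xi : continuous xi -> @cmeasurable R _ (borel u) (sfiber u) xi.
Proof.
move=> cx.
have cs : closed (sfiber u).
  exact: closed_equalizer (@arrow_hausdorff G) (@src_continuous R G) (@cst_continuous _ _ u).
have wx : {within sfiber u, continuous xi} by exact: continuous_subspaceT.
split; apply: within_continuous_measurable; try exact: cs.
  exact: within_continuous_Re.
exact: within_continuous_Im.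
Qed.

Lemma l2norm_semi f : l2norm u f = (semi f)%:E.
Proof.
rewrite (l2normE (Cc_measurable_sfiber (proj1 (ccP f)))) -semi_qint poweR_EFin.
by rewrite powR12_sqrt ?sqr_ge0// sqrtr_sqr ger0_norm// semi_ge0.
Qed.

Lemma Cc_L2 f : L2 u f.
Proof.
have [m1 m2] := Cc_measurable_sfiber (proj1 (ccP f)).
by split => //; rewrite l2norm_semi ltry.
Qed.

Lemma eq_l2norm xi eta : (forall x, src x = u -> xi x = eta x) -> l2norm u xi = l2norm u eta.
Proof.
move=> e; rewrite /l2norm; congr (_ `^ _)%E.
rewrite /integral (_ : _ \_ _ = (fun x : borel u => (nrm (eta x) ^+ 2)%:E) \_ (sfiber u))//.
by apply/eq_restrictP => x; rewrite inE => xu; rewrite e.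
Qed.

Lemma IndE f g x : src x = u -> Ind u f g x = conv f g x.
Proof. by move=> xu; rewrite convE xu. Qed.

Lemma fiberCc_kernel f x : src x = u ->
  fiberCc u (fun y => f (mul x y) * twist (mul x y) (inv y)).
Proof.
move=> xu.
have c := fiberCc_translate (Cc_fiberCc (rng x) (ccP f)); rewrite xu in c.
apply: (fiberCcM c); apply: within_continuous_twist.
- by apply: within_continuous_mul => [||z zu]; [exact: within_continuous_cst|exact: within_continuous_id|rewrite xu].
- by apply: within_continuous_inv; exact: within_continuous_id.
- by move=> z zu; rewrite src_mul ?rng_inv// xu.
Qed.

Lemma Ind_kernel f xi x : Ind u f xi x = cintegral (haar u) (rfiber u)
  (fun y : borel u => f (mul x y) * twist (mul x y) (inv y) * xi (inv y)).
Proof. by apply: eq_cintegral => y _; rewrite mulrAC. Qed.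

Lemma qint_inv_lty xi : L2 u xi -> meas (fun y => xi (inv y)) /\ (q (fun y => xi (inv y)) < +oo)%E.
Proof.
move=> [m1 m2]; rewrite (l2normE (conj m1 m2)) => /lty_poweRy fin; split.
  by split; [exact: measurable_comp_inv m1|exact: measurable_comp_inv m2].
by apply: fin; rewrite invr_eq0.
Qed.

Lemma test_function_Cc (k : borel u -> R) : test_function k -> Cc (fun x : G => (k x)%:C : CC R).
Proof.
move=> [ck cs]; split.
  move=> x; apply: (@continuous_comp G R (CC R) k); first exact: ck.
  exact: real_complex_continuous.
by under eq_set do rewrite (inj_eq (@complexI R) (k _) 0).
Qed.

Lemma L2_dense xi : L2 u xi -> forall e : R, 0 < e ->
  exists eta : Ccfun G, (q (fun y => xi (inv y) - eta (inv y))%R < e%:E)%E.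
Proof.
move=> /qint_inv_lty[[m1 m2] fin] e e0; have e2 : 0 < e / 2 by rewrite divr_gt0.
have approx (p : CC R -> R) : (forall z, `|p z| <= nrm z) ->
    measurable_fun (rfiber u : set (borel u)) (fun y : borel u => p (xi (inv y))) ->
    exists2 k : borel u -> R, test_function k & ((\int[haar u]_(y in rfiber u) ((p (xi (inv y)) - k y) ^+ 2)%:E) < (e / 2)%:E)%E.
  (* [radon_l2_dense] concerns functions on the whole of [G]; the component is therefore extended by
     zero off the fibre. *)
  move=> pn mp; pose h := ((fun y : borel u => p (xi (inv y))) \_ (rfiber u)) : borel u -> R.
  have mh : measurable_fun setT h by exact: (proj1 (measurable_restrictT _ mr) mp).
  have hE y : rng y = u -> h y = p (xi (inv y)).
    by move=> yu; rewrite /h patchE mem_set.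
  have fh : (square_integral (haar u) h < +oo)%E.
    apply: le_lt_trans fin; rewrite /square_integral /qint.
    rewrite [leRHS]integral_mkcond; apply: ge0_le_integral => //.
    - by move=> y _; rewrite lee_fin sqr_ge0.
    - exact: measurable_square.
    - apply: (proj1 (measurable_restrictT _ mr)); apply/measurable_EFinP.
      exact: (cmeasurable_nrm2 (conj m1 m2)).
    move=> y _; rewrite /h !patchE; case: ifPn => _.
      rewrite lee_fin -[leLHS]real_normK ?num_real// ler_sqr ?nnegrE ?nrm_ge0//.
    by rewrite expr0n.
  have [k tk hk] := @radon_l2_dense R G u (haar u) (@arrow_lc G) (@arrow_hausdorff G)
    (haar_radon (haarP G) uu) h mh fh _ e2.
  exists k => //; apply: le_lt_trans hk; rewrite /square_integral.
  rewrite (@eq_integral _ _ _ _ _ (fun y : borel u => ((h y - k y) ^+ 2)%:E)); last first.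
    by move=> y; rewrite inE => yu; rewrite hE.
  apply: ge0_subset_integral => //.
  - apply: measurable_square; apply: measurable_funB => //.
    exact: test_measurable tk.
  - by move=> y _; rewrite lee_fin sqr_ge0.
have [k1 tk1 hk1] := approx _ (@nrm_Re R) m1.
have [k2 tk2 hk2] := approx _ (@nrm_Im R) m2.
(* The test functions approximate [xi] composed with [inv], so they are composed with [inv] in
   turn. *)
exists (CcFun (Cc_inv (Cc_lin 'i (test_function_Cc tk2) (test_function_Cc tk1)))).
rewrite /qint (_ : (e%:E = (e / 2)%:E + (e / 2)%:E)%E); last by rewrite -EFinD -splitr.
apply: le_lt_trans (lteD hk1 hk2).
have mk1 := measurable_funTS (D := rfiber u : set (borel u)) (test_measurable tk1).
have mk2 := measurable_funTS (D := rfiber u : set (borel u)) (test_measurable tk2).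
rewrite -ge0_integralD//.
- rewrite le_eqVlt; apply/orP; left; apply/eqP; apply: eq_integral => y _.
  rewrite -EFinD; congr EFin; rewrite nrm_sqr /= invK.
  by case: (xi (inv y)) => a b /=; congr (_ ^+ 2 + _ ^+ 2); ring.
- by move=> y _; rewrite lee_fin sqr_ge0.
- by apply/measurable_EFinP; apply: measurable_funX; exact: measurable_funB.
- by move=> y _; rewrite lee_fin sqr_ge0.
- by apply/measurable_EFinP; apply: measurable_funX; exact: measurable_funB.
Qed.

Lemma cmeasurable_diff xi (eta : Ccfun G) : meas (fun y => xi (inv y)) ->
  meas (fun y => xi (inv y) - eta (inv y)).
Proof.
move=> mxi; apply: (cmeasurableB mxi).
exact: fiberCc_measurable (fiberCc_inv eta).
Qed.

(** For fixed [x] the kernel of Ind is compactly supported and continuous on the fibre, hence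
    square-integrable: convergence in L^2 gives convergence at each point. *)
Lemma Ind_sub_le f xi (eta : Ccfun G) x (t : R) : src x = u -> L2 u xi -> 0 < t ->
  (q (fun y => xi (inv y) - eta (inv y))%R < +oo)%E ->
  nrm (Ind u f xi x - conv f eta x) <=
    (t / 2) * fine (q (fun y => f (mul x y) * twist (mul x y) (inv y)))
    + (t^-1 / 2) * fine (q (fun y => xi (inv y) - eta (inv y))).
Proof.
move=> xu /qint_inv_lty[mxi fxi] t0 fd.
have ck := fiberCc_kernel f xu; have mk := fiberCc_measurable ck; have fk := fiberCc_qint ck.
have me := fiberCc_measurable (fiberCc_inv eta); have fe := fiberCc_qint (fiberCc_inv eta).
have := nrm_cintegralM_le mr mk (cmeasurable_diff eta mxi) fk fd t0.
congr (nrm _ <= _); rewrite -(IndE _ _ xu) !Ind_kernel.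
rewrite -(cintegralB mr (qint_cintegrableM mr mk mxi fk fxi) (qint_cintegrableM mr mk me fk fe)).
by apply: eq_cintegral => y _; rewrite mulrBr.
Qed.

(* If eta n tends to xi in L^2 then Ind u f (eta n) tends to Ind u f xi pointwise,
   and Fatou's lemma carries over the bound valid for the eta n in C_c(G). *)
Lemma Ind_bound f xi : L2 u xi -> (l2norm u xi <= 1)%E ->
  (l2norm u (Ind u f xi) <= (regular_seminorm u f)%:E)%E.
Proof.
move=> xi2 xi1; have [mxi fxi] := qint_inv_lty xi2.
pose N := regular_seminorm u f.
have N0 : 0 <= N by exact: csn_ge0 (regular_seminormP uu) _.
have q1 : (q (fun y => xi (inv y)) <= 1)%E.
  have [m1 m2 _] := xi2; move: xi1; rewrite (l2normE (conj m1 m2)) poweR12_sqrt ?qint_ge0//.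
  case: (q _) fxi (qint_ge0 (haar u) (rfiber u) (fun y => xi (inv y))) => [r _ r0|//|//].
  rewrite /sqrte !lee_fin => r1; rewrite -[r]sqr_sqrtr//.
  by rewrite expr_le1 ?sqrtr_ge0.
have approx (e : R) : 0 < e -> exists eta : nat -> Ccfun G,
    (forall n, (q (fun y => xi (inv y) - eta n (inv y))%R < (n.+1%:R^-1)%:E)%E) /\
    forall n, semi (eta n) ^+ 2 <= 1 + e.
  move=> e0; pose t := e / 2; have t0 : 0 < t by rewrite divr_gt0.
  have t1 : 0 < t^-1 by rewrite invr_gt0.
  (* [c] solves [(1 + t^-1) * c = t], so that [qintD_le] gives [1 + t + t], which is [1 + e]. *)
  pose c := t / (1 + t^-1); have c0 : 0 < c by rewrite divr_gt0// addr_gt0.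
  have dn n : 0 < Num.min c n.+1%:R^-1 by rewrite lt_min c0 invr_gt0 ltr0Sn.
  have /choice[eta etaP] := fun n => L2_dense xi2 (dn n).
  exists eta; split => n; have := etaP n.
    by move=> /lt_le_trans; apply; rewrite lee_fin ge_min lexx orbT.
  move=> /ltW h; rewrite -lee_fin semi_qint.
  have me := fiberCc_measurable (fiberCc_inv (eta n)).
  apply: le_trans (qintD_le (haar u) mr mxi (cmeasurable_diff (eta n) mxi) me t0 _) _.
    move=> y _; rewrite -[X in nrm X <= _](subKr (xi (inv y))).
    by apply: le_trans (nrmD _ _) _; rewrite nrmN.
  have -> : (1 + e)%:E = ((1 + t)%:E * 1%:E + (1 + t^-1)%:E * c%:E)%E.
    have cE : (1 + t^-1) * c = t by rewrite /c mulrCA divff ?mulr1// gt_eqF// addr_gt0.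
    by rewrite -!EFinM -EFinD cE; congr EFin; rewrite /t; field.
  have t0' := ltW t0; have t1' := ltW t1.
  apply: leeD; apply: lee_wpmul2l => //; rewrite ?lee_fin ?addr_ge0//.
  by apply: le_trans h _; rewrite lee_fin ge_min lexx.
have cvgI (eta : nat -> Ccfun G) : (forall n, (q (fun y => xi (inv y) - eta n (inv y))%R < (n.+1%:R^-1)%:E)%E) ->
    forall x, src x = u -> (conv f (eta n) x @[n --> \oo] --> (Ind u f xi x : CC R)).
  move=> etaP x xu; apply/cvg_nrmP => e e0.
  pose A := fine (q (fun y => f (mul x y) * twist (mul x y) (inv y))).
  have A0 : 0 <= A by apply: fine_ge0; exact: qint_ge0.
  (* This makes [t * A < e]; once the L^2 error is below [e * t], both terms of [Ind_sub_le] are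
     below [e / 2]. *)
  pose t := e / (A + 1); have t0 : 0 < t by rewrite divr_gt0// ltr_wpDl.
  have d0 : 0 < e * t by rewrite mulr_gt0.
  have := near_infty_natSinv_lt (PosNum d0); apply: filterS => n /= nt.
  have fd : (q (fun y => xi (inv y) - eta n (inv y))%R < +oo)%E by apply: lt_trans (etaP n) _; exact: ltry.
  apply: le_lt_trans (Ind_sub_le f xu xi2 t0 fd) _; rewrite -/A.
  have : fine (q (fun y => xi (inv y) - eta n (inv y))) < e * t.
    apply: lt_trans nt; rewrite -lte_fin fineK ?etaP// ge0_fin_numE//.
    exact: qint_ge0.
  have tA : t * A < e.
    by rewrite /t mulrAC ltr_pdivrMr ?ltr_wpDl// ltr_pM2l// ltrDl.
  set Q := fine _ => Qe; have : t^-1 * Q < e by rewrite mulrC ltr_pdivrMr.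
  by rewrite mulrAC [t^-1 / 2 * _]mulrAC; move: tA; move: (t * A) (t^-1 * Q) => a b; lra.
have cvgp (p : CC R -> R) (w : nat -> CC R) z : continuous p -> w @ \oo --> z ->
    p (w n) @[n --> \oo] --> p z by move=> cp cw; exact: (cvg_comp w p cw (cp z)).
(* Measurability is inherited from the continuous functions [conv f (eta n)], which converge
   pointwise on the fibre. *)
have mInd : @cmeasurable R _ (borel u) (sfiber u) (Ind u f xi).
  have [eta [etaP _]] := approx 1 ltr01; have cI := cvgI _ etaP.
  have mc n := Cc_measurable_sfiber (proj1 (ccP (Ccconv f (eta n)))).
  have ms := measurable_sfiber.
  split.
    apply: (measurable_fun_cvg (fun n => (mc n).1)) => x xu.
    exact: (cvgp _ _ _ (@Re_continuous R) (cI x xu)).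
  apply: (measurable_fun_cvg (fun n => (mc n).2)) => x xu.
  exact: (cvgp _ _ _ (@Im_continuous R) (cI x xu)).
rewrite l2normE//.
suff : (q (fun y => Ind u f xi (inv y)) <= (N ^+ 2)%:E)%E.
  rewrite poweR12_sqrt ?qint_ge0// => h.
  case: (q _) h (qint_ge0 (haar u) (rfiber u) (fun y => Ind u f xi (inv y))) => [r|//|//].
  rewrite /sqrte !lee_fin -/N => r1 r0; rewrite -[leRHS]ger0_norm// -sqrtr_sqr.
  by rewrite ler_wsqrtr.
apply/lee_addgt0Pr => e0 e0P.
(* So that [N ^+ 2 * (1 + e)] is at most [N ^+ 2 + e0]. *)
pose e := e0 / (N ^+ 2 + 1); have eP : 0 < e by rewrite divr_gt0// ltr_wpDl// sqr_ge0.
have [eta [etaP eta1]] := approx e eP; have cI := cvgI _ etaP.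
pose F n (y : borel u) := ((nrm (conv f (eta n) (inv y)) ^+ 2)%:E).
have mF n : measurable_fun (rfiber u : set (borel u)) (F n).
  apply/measurable_EFinP; apply: cmeasurable_nrm2.
  exact: fiberCc_measurable (fiberCc_inv (Ccconv f (eta n))).
have := @fatou _ (borel u) R (haar u) (rfiber u) mr F mF (fun n y _ => ltac:(by rewrite lee_fin sqr_ge0)).
rewrite (@eq_integral _ _ _ _ _ (fun y : borel u => ((nrm (Ind u f xi (inv y)) ^+ 2)%:E))); last first.
  move=> y; rewrite inE => yu; apply/esym.
  have yu' : src (inv y) = u by rewrite src_inv.
  have c : F n y @[n --> \oo] --> (nrm (Ind u f xi (inv y)) ^+ 2)%:E.
    apply: cvg_EFin; first exact: nearW.
    have cn : nrm (conv f (eta n) (inv y)) @[n --> \oo] --> nrm (Ind u f xi (inv y)).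
      exact: (cvgp (fun z : CC R => nrm z) (fun n => conv f (eta n) (inv y)) (Ind u f xi (inv y)) (@nrm_continuous R) (cI _ yu')).
    by rewrite /F /=; under eq_fun do rewrite expr2; rewrite expr2; exact: cvgM.
  rewrite is_cvg_limn_einfE; first exact/esym/cvg_lim.
  by apply/cvg_ex; eexists; exact: c.
move=> /le_trans; apply.
have bF n : (\int[haar u]_(y in rfiber u) F n y <= (N ^+ 2)%:E + e0%:E)%E.
  rewrite -[X in (X <= _)%E](semi_qint (Ccconv f (eta n))) -EFinD lee_fin.
  apply: (@le_trans _ _ ((N * semi (eta n)) ^+ 2)).
    by rewrite ler_sqr ?nnegrE ?mulr_ge0 ?semi_ge0//; exact: regular_seminorm_ub.
  rewrite exprMn; apply: le_trans (ler_wpM2l (sqr_ge0 N) (eta1 n)) _.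
  have e0' := ltW e0P; rewrite mulrDr mulr1 lerD2l /e mulrCA -[leRHS]mulr1 ler_wpM2l//.
  by rewrite ler_pdivrMr ?mul1r ?lerDl// ltr_wpDl// sqr_ge0.
rewrite limn_einf_lim; apply: lime_le; first exact: is_cvg_einfs.
apply: nearW => n; apply: le_trans (bF n); apply: ereal_inf_lbound.
by exists n => /=.
Qed.

Lemma Ind_normE f : Ind_norm u f = (regular_seminorm u f)%:E.
Proof.
apply/eqP; rewrite eq_le; apply/andP; split.
  by apply: ge_ereal_sup => _ [xi [xi2 xi1] <-]; exact: Ind_bound.
have fin : Ind_norm u f \is a fin_num.
  rewrite ge0_fin_numE.
    apply: le_lt_trans (ltry (regular_seminorm u f)).
    by apply: ge_ereal_sup => _ [xi [xi2 xi1] <-]; exact: Ind_bound.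
  apply: (@le_trans _ _ (l2norm u (Ind u f (0 : Ccfun G)))); first exact: poweR_ge0.
  apply: ereal_sup_ubound; exists (0 : Ccfun G) => //; split; first exact: Cc_L2.
  by rewrite l2norm_semi lee_fin (semi0 (regular_pre_representation uu)).
rewrite -(fineK fin) lee_fin.
apply: ge_sup; first by exists (semi (Ccconv f 0)), 0 => //=; rewrite (semi0 (regular_pre_representation uu)).
move=> _ [v /= v1 <-]; rewrite -lee_fin fineK//.
apply: ereal_sup_ubound; exists v; first by split; [exact: Cc_L2|rewrite l2norm_semi lee_fin].
by rewrite -l2norm_semi; apply: eq_l2norm => x xu; exact: IndE.
Qed.

End RegularRepresentation.

Section ReducedCompletion.
Variables (R : realType) (G : twisted_groupoid R).

Lemma norm_redE (f : Ccfun G) : norm_red f = (red_seminorm f)%:E.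
Proof.
have H1 : (norm_red f <= (red_seminorm f)%:E)%E.
  apply: ge_ereal_sup => _ [->|[u uu <-]]; first by rewrite lee_fin (csn_ge0 (red_seminormP G)).
  by rewrite (Ind_normE uu) lee_fin red_seminorm_ub.
have H0 : (0 <= norm_red f)%E by apply: ereal_sup_ubound; left.
have fin : norm_red f \is a fin_num.
  by rewrite ge0_fin_numE//; apply: le_lt_trans H1 _; rewrite ltry.
apply/eqP; rewrite eq_le H1/= -(fineK fin) lee_fin.
apply: sup_seminorm_le; first exact: fine_ge0.
move=> nu [u uu ->]; rewrite -lee_fin fineK// -Ind_normE//.
by apply: ereal_sup_ubound; right; exists u.
Qed.

Definition red_cstar : cstar_algebra R :=
  completion_cstar (Cc_pre_cstar (@Ccstar_red_lin R G) (red_seminormP G)).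
Definition red_emb : (G -> CC R) -> red_cstar :=
  Cc_emb (@Ccstar_red_lin R G) (red_seminormP G).

Lemma red_completion : is_completion (@norm_red R G) (@star_red R G) red_emb.
Proof. by apply: Cc_emb_completion => // f; exact: norm_redE. Qed.

End ReducedCompletion.

(** * Induced maps *)

Section InducedTransfer.
Variables (R : realType) (G H : twisted_groupoid R) (p : partial_morphism G H).
Variables (u : G) (v : H).
Hypothesis (uu : units u) (pu : p u = Some v).

Lemma pmor_rng x x' : p x = Some x' -> p (rng x) = Some (rng x').
Proof.
move=> px; have pi := pmor_inv (pmorP p) px.
have [|_] := pmor_mul (pmorP p) px pi; first by rewrite rng_inv.
by rewrite !mul_inv.
Qed.

Lemma pmor_src x x' : p x = Some x' -> p (src x) = Some (src x').
Proof. by move=> px; have := pmor_rng (pmor_inv (pmorP p) px); rewrite !rng_inv. Qed.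

Lemma pmor_inv_None x : p x = None -> p (inv x) = None.
Proof.
move=> px; case E : (p (inv x)) => [y|//].
by have := pmor_inv (pmorP p) E; rewrite invK px.
Qed.

Let M : set (borel u) := pdom p `&` rfiber u.

Lemma measurable_pdom_fiber : measurable M.
Proof.
apply: measurableI; last exact: measurable_rfiber.
by apply: sub_sigma_algebra; case: (pmor_dom (pmorP p)).
Qed.

(* The value v off the domain of p is arbitrary: it is only integrated over M. *)
Let g (x : borel u) : borel v := odflt v (p x).

Lemma measurable_odflt_pmor : measurable_fun setT g.
Proof.
have mK : measurable (pdom p : set (borel u)).
  by apply: sub_sigma_algebra; case: (pmor_dom (pmorP p)).
move=> _ B mB; rewrite setTI.
have -> : g @^-1` B = (ppreimage p B `|` (if v \in B then ~` pdom p else set0) : set (borel u)).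
  apply/seteqP; split => x; rewrite /g /=.
    case E : (p x) => [y|] /= Bx; first by left; exists y.
    by right; rewrite mem_set//= => -[y]; rewrite E.
  case=> [[y -> //]|]; case: ifPn => // /set_mem Bv nx.
  by case E : (p x) => [y|//]; case: nx; exists y.
apply: measurableU; first exact: borel_ppreimage.
by case: ifP => _ //; exact: measurableC.
Qed.

Let gmix := isMeasurableFun.Build _ _ _ _ _ measurable_odflt_pmor.
Let gpack : {mfun borel u >-> borel v} := HB.pack g gmix.

(** [pmor_haar] measures the whole preimage in [G]; its part off the fibre is null, [haar u] being
    supported there. *)
Let pushE (B : set (borel v)) : measurable B ->
  pushforward (mrestr (haar u) measurable_pdom_fiber) g B = haar v B.
Proof.
move=> mB; rewrite /pushforward /mrestr -(pmor_haar (pmorP p) uu pu mB).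
have -> : g @^-1` B `&` M = (ppreimage p B `&` rfiber u : set (borel u)).
  apply/seteqP; split => x; rewrite /M /g /=.
    by case=> + [[y py] xu]; rewrite py /= => By; split => //; exists y.
  by case=> -[y py By] xu; rewrite py /=; split => //; split => //; exists y.
have mp : measurable (ppreimage p B : set (borel u)) by exact: borel_ppreimage.
have mr : measurable (rfiber u : set (borel u)) := @measurable_rfiber R G u u.
rewrite [RHS](measureDI (haar u) mp mr).
rewrite [X in (_ = X + _)%E](_ : _ = 0%E) ?add0e//.
apply: (subset_measure0 _ _ _ (haar_support (haarP G) uu)) => //.
- exact: measurableD.
- exact: measurableC.
Qed.

(** The restriction of [haar u] to [M] has [haar v] as its image, so this is the change of variables
    formula; the part of the preimage outside [M] is null for the restricted measure. *)
Lemma ge0_integral_induced (h : borel v -> \bar R) : measurable_fun (rfiber v : set (borel v)) h ->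
  (forall y, rng y = v -> 0 <= h y)%E ->
  (\int[haar v]_(y in rfiber v) h y = \int[haar u]_(x in M) h (g x))%E.
Proof.
move=> mh h0; have mM := measurable_pdom_fiber.
have mv : measurable (rfiber v : set (borel v)) := @measurable_rfiber R H v v.
have Mg : M `<=` g @^-1` (rfiber v).
  move=> x [[y py] xu]; rewrite /g /= py /rfiber /=.
  by have := pmor_rng py; rewrite xu pu => -[].
have mg : measurable (g @^-1` (rfiber v : set (borel v))).
  by have := measurable_odflt_pmor measurableT mv; rewrite setTI.
pose m' := mrestr (haar u) mM.
transitivity (\int[m']_(x in g @^-1` (rfiber v)) h (g x))%E.
  rewrite -(ge0_integral_pushforward measurable_odflt_pmor m' mv mh); last first.
    by move=> y; rewrite inE => yv; exact: h0.
  apply: (@eq_measure_integral _ _ _ _ (pushforward m' gpack)) => B mB _.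
  by rewrite -pushE.
have mhg : measurable_fun (g @^-1` (rfiber v)) (fun x => h (g x)).
  apply: (measurable_comp mv) => //; first by move=> _ [x xv <-].
  exact: (measurable_funS _ _ measurable_odflt_pmor).
transitivity (\int[m']_(x in M) h (g x))%E; last first.
  apply: eq_measure_integral => B mB BM; change (haar u (B `&` M) = haar u B).
  by rewrite setIidl.
have null : m' (g @^-1` (rfiber v) `\` M) = 0%E.
  change (haar u ((g @^-1` (rfiber v) `\` M) `&` M) = 0%E).
  by rewrite setDKI measure0.
have mN : measurable (g @^-1` (rfiber v) `\` M : set (borel u)) by exact: measurableD.
rewrite (ge0_negligible_integral mN mg mhg _ null).
  by rewrite setDD setIidr.
move=> x; rewrite /= => xv; exact: h0.
Qed.

Let integral_induced (h : borel v -> R) : measurable_fun (rfiber v : set (borel v)) h ->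
  (\int[haar v]_(y in rfiber v) (h y)%:E = \int[haar u]_(x in M) (h (g x))%:E)%E.
Proof.
move=> /measurable_EFinP mh; rewrite [LHS]integralE [RHS]integralE.
congr (_ - _)%E.
  rewrite (ge0_integral_induced (measurable_funepos mh) (fun y _ => funepos_ge0 (EFin \o h) y)).
  by apply: eq_integral => x _; rewrite !funeposE.
rewrite (ge0_integral_induced (measurable_funeneg mh) (fun y _ => funeneg_ge0 (EFin \o h) y)).
by apply: eq_integral => x _; rewrite !funenegE.
Qed.

Lemma fint_induced (h : H -> CC R) : @cmeasurable R _ (borel v) (rfiber v) h ->
  fint v h = fint u (induced p h).
Proof.
move=> [m1 m2]; transitivity (cintegral (haar u) M (induced p h)).
  rewrite /fint /cintegral; congr (_ +i* _); rewrite /Rintegral integral_induced//;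
    congr fine; apply: eq_integral => x; rewrite inE => -[[y py] _];
    by rewrite /g /induced py.
apply/esym; apply: cintegral_subset; first by move=> x [].
move=> x xu nM; rewrite /induced; case E : (p x) => [y|//]; case: nM; split => //.
by exists y.
Qed.

Lemma fnorm1_induced (h : H -> CC R) : @cmeasurable R _ (borel v) (rfiber v) h ->
  fnorm1 v h = fnorm1 u (induced p h).
Proof.
move=> mh; have mn := cmeasurable_nrm mh.
have mc : @cmeasurable R _ (borel v) (rfiber v) (fun x => (nrm (h x))%:C).
  by split => //=; exact: measurable_cst.
have := fint_induced mc; rewrite fint_fnorm1 => /(congr1 (fun z : CC R => complex.Re z)) /= ->.
apply: eq_Rintegral => x _; rewrite /induced.
by case: (p x) => [y|]; rewrite ?nrm0.
Qed.

End InducedTransfer.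

Section Induced.
Variables (R : realType) (G H : twisted_groupoid R) (p : partial_morphism G H).
Implicit Types (f g : Ccfun H).

(** Properness makes the extension by zero continuous. If the open set [V] avoids 0, its preimage
    lies in the open domain. Otherwise the complement of [V] pulls back to the preimage under [p] of
    a closed part of the support of [f], which is compact and therefore closed in [G]. *)
Lemma Cc_induced (f : H -> CC R) : Cc f -> Cc (induced p f).
Proof.
move=> cf; apply: Cc_intro; last first.
  have [K cK Kf] := Cc_compact_support cf.
  exists (ppreimage p K); first exact: (pmor_proper (pmorP p)).
  move=> x nK; rewrite /induced; case E : (p x) => [y|//].
  by apply: Kf => Ky; apply: nK; exists y.
apply/continuousP => V oV.
have pre B : ~ B 0 -> induced p f @^-1` B = ppreimage p (f @^-1` B).
  move=> B0; apply/seteqP; split => x; rewrite /induced /=.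
    by case E : (p x) => [y|//] fy; exists y.
  by case=> y ->.
have [V0|V0] := pselect (V 0); last first.
  rewrite pre//; apply: (pmor_continuous (pmorP p)).
  by move/continuousP: cf.1; apply.
have -> : induced p f @^-1` V = ~` (induced p f @^-1` (~` V)) by rewrite -preimage_setC setCK.
rewrite (pre (~` V)); last exact.
apply: closed_openC; apply: (compact_closed (@arrow_hausdorff G)).
apply: (pmor_proper (pmorP p)); apply: (subclosed_compact _ cf.2).
  by rewrite preimage_setC; apply: open_closedC; move/continuousP: cf.1; apply.
move=> x fx; apply: subset_closure; apply/eqP => fx0; apply: fx.
by rewrite fx0.
Qed.

Definition Ccinduced f : Ccfun G := CcFun (Cc_induced (ccP f)).

Lemma Ccinduced_lin (a : R[i]) f g : Ccinduced (a *: f + g) = a *: Ccinduced f + Ccinduced g.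
Proof.
apply: Ccfun_eq => x; rewrite Ccfun_linE /= /induced.
by case: (p x) => [y|] /=; rewrite ?mulr0 ?addr0.
Qed.

Lemma Ccinduced_mul f g : Ccinduced (Ccconv f g) = Ccconv (Ccinduced f) (Ccinduced g).
Proof.
apply: Ccfun_eq => x; rewrite [LHS]/= [RHS]/= convE.
case px : (p x) => [x'|]; last first.
  (* The element [x] is the product of [mul x y] and [inv y]; were both in the domain of [p], so
     would be [x]. *)
  rewrite /induced px -[LHS](fint0 (src x)); apply: eq_fint => y yx.
  case E : (p (mul x y)) => [z|]; last by rewrite !mul0r.
  case E' : (p (inv y)) => [y'|]; last by rewrite mulr0 mul0r.
  have [|_] := pmor_mul (pmorP p) E E'; first by rewrite src_mul ?rng_inv.
  by rewrite mulK_inv// px.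
have ck := fiberCc_conv x' (ccP f) (ccP g).
transitivity (conv f g x'); first by rewrite /induced px.
rewrite [LHS]convE.
rewrite (fint_induced (unit_src x) (pmor_src px) (fiberCc_measurable ck)).
apply: eq_fint => y yx; rewrite /induced; case py : (p y) => [y'|]; last first.
  by rewrite (pmor_inv_None py) mulr0 mul0r.
have [e ->] := pmor_mul (pmorP p) px py (esym yx).
rewrite (pmor_inv (pmorP p) py); congr (_ * _).
apply/esym; apply: (pmor_twist (pmorP p)).
- by have [_ ->] := pmor_mul (pmorP p) px py (esym yx).
- exact: (pmor_inv (pmorP p) py).
- by rewrite src_mul ?rng_inv.
Qed.

Lemma induced_star (f : H -> CC R) : induced p (star f) = star (induced p f).
Proof.
apply/funext => x; rewrite /star /induced; case px : (p x) => [x'|].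
  have pi := pmor_inv (pmorP p) px.
  by rewrite pi (pmor_twist (pmorP p) px pi)// rng_inv.
by rewrite (pmor_inv_None px) mul0r conjc0.
Qed.

Lemma induced_star_red (f : H -> CC R) : induced p (star_red f) = star_red (induced p f).
Proof.
apply/funext => x; rewrite /star_red -induced_star /induced; case px : (p x) => [x'|].
  have pr := pmor_rng px.
  by rewrite (pmor_twist (pmorP p) pr pr)// src_rng rng_rng.
by rewrite mulr0.
Qed.

Lemma Ccinduced_star_red f : Ccinduced (Ccstar_red f) = Ccstar_red (Ccinduced f).
Proof. by apply: Ccfun_eq => x /=; rewrite induced_star_red. Qed.

Lemma induced_inv (f : H -> CC R) x : induced p f (inv x) = induced p (fun y => f (inv y)) x.
Proof.
rewrite /induced; case px : (p x) => [x'|]; first by rewrite (pmor_inv (pmorP p) px).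
by rewrite (pmor_inv_None px).
Qed.

(** The domain of [p] contains the range of each of its elements, so if it misses the unit [u] it
    misses the whole fibre, and the integral is zero. *)
Lemma fnorm1_induced_le u (f : H -> CC R) (B : R) : units u -> Cc f -> 0 <= B ->
  (forall v, units v -> fnorm1 v f <= B) -> fnorm1 u (induced p f) <= B.
Proof.
move=> uu cf B0 fB; case pu : (p u) => [v|].
  rewrite -(fnorm1_induced uu pu (fiberCc_measurable (Cc_fiberCc v cf))).
  by apply: fB; exact: (pmor_units uu pu).
rewrite (@eq_fnorm1 R G u (induced p f) (fun=> 0)).
  by rewrite /fnorm1 /Rintegral integral0_eq// => y _; rewrite nrm0.
move=> x xu; rewrite /induced; case px : (p x) => [y|//].
by have := pmor_rng px; rewrite xu pu.
Qed.

Lemma nI_induced f : nI (Ccinduced f) <= nI f.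
Proof.
apply: nI_le; [exact: ccP|exact: nI_ge0 (ccP f)| |] => u uu.
  apply: fnorm1_induced_le => //; [exact: ccP|exact: nI_ge0 (ccP f)|].
  by move=> v uv; have [] := nI_ub uv (ccP f).
rewrite (@eq_fnorm1 R G u _ (induced p (fun y => f (inv y)))); last by move=> x _; rewrite -induced_inv.
apply: fnorm1_induced_le => //; [exact: Cc_inv (ccP f)|exact: nI_ge0 (ccP f)|].
by move=> v uv; have [] := nI_ub uv (ccP f).
Qed.

End Induced.

Section InducedNorm.
Variables (R : realType) (G H : twisted_groupoid R) (p : partial_morphism G H).
Implicit Types (f g k h : Ccfun H).

Lemma representation_induced (E : hilbert R) (pi : (G -> CC R) -> {linear E -> E}) :
  is_representation pi -> is_representation (fun f : H -> CC R => pi (induced p f)).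
Proof.
move=> piP.
split.
- by move=> f cf; apply: (rep_bounded piP); exact: Cc_induced.
- move=> a f g v cf cg.
  rewrite -(rep_linear piP _ _ (Cc_induced p cf) (Cc_induced p cg)); congr (pi _ v).
  exact: (congr1 (fun k : Ccfun G => (k : G -> CC R)) (Ccinduced_lin p a (CcFun cf) (CcFun cg))).
- move=> f g v cf cg; rewrite -(rep_conv piP _ (Cc_induced p cf) (Cc_induced p cg)); congr (pi _ v).
  exact: (congr1 (fun k : Ccfun G => (k : G -> CC R)) (Ccinduced_mul p (CcFun cf) (CcFun cg))).
- by move=> f v w cf; rewrite induced_star; apply: (rep_star piP); exact: Cc_induced.
have [M MP] := rep_normI piP; exists `|M| => f cf.
have ci := Cc_induced p cf.
apply: le_trans (MP _ ci) _; rewrite !normIE// -!EFinM lee_fin.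
apply: (@le_trans _ _ (`|M| * nI (induced p f))).
  by rewrite ler_wpM2r ?ler_norm// nI_ge0.
by rewrite ler_wpM2l//; exact: (nI_induced p (CcFun cf)).
Qed.

Lemma norm_max_induced (f : H -> CC R) : (norm_max (induced p f) <= norm_max f)%E.
Proof.
apply: ge_ereal_sup => _ [E [pi [piP ->]]]; apply: ereal_sup_ubound.
by exists E, (fun f : H -> CC R => pi (induced p f)); split => //; exact: representation_induced.
Qed.

End InducedNorm.

Section ReducedInduced.
Variables (R : realType).

Section OneGroupoid.
Variable G : twisted_groupoid R.
Implicit Types (f g k h : Ccfun G) (u x y z : G).
Local Notation semi u := (semi (fun f g : Ccfun G => pairing u f g)).

Lemma nrm_conv_fnorm1 k h x (M : R) : (forall y, nrm (k y) <= M) ->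
  nrm (conv k h x) <= M * fnorm1 (src x) (fun y => h (inv y)).
Proof.
move=> kM; have M0 : 0 <= M by apply: le_trans (kM x); exact: nrm_ge0.
have us := unit_src x; have c := fiberCc_conv x (ccP k) (ccP h).
have ch := fiberCc_inv (src x) h.
rewrite convE; apply: le_trans (nrm_fint_le us c) _.
apply: (@le_trans _ _ (fnorm1 (src x) (fun y => M%:C * h (inv y)))).
  apply: (fnorm1_le us c (fiberCcZ M%:C ch)) => y yx.
  rewrite !nrmM nrm_real (ger0_norm M0) nrm_twist ?mulr1; last first.
    by rewrite src_mul ?rng_inv// yx.
  by rewrite ler_wpM2r ?nrm_ge0.
by rewrite (fnorm1Z us M%:C ch) nrm_real (ger0_norm M0).
Qed.

Lemma nrm_pairing_le u f g (M : R) : units u -> 0 <= M ->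
  (forall x, src x = u -> nrm (f x) <= M) ->
  nrm (pairing u f g) <= M * fnorm1 u (fun y => g (inv y)).
Proof.
move=> uu M0 fM; have cg := fiberCc_inv u g.
apply: le_trans (nrm_fint_le uu (fiberCc_pairing u f g)) _.
apply: (@le_trans _ _ (fnorm1 u (fun y => M%:C * g (inv y)))).
  apply: (fnorm1_le uu (fiberCc_pairing u f g) (fiberCcZ M%:C cg)) => y yu.
  rewrite !nrmM nrm_conj nrm_real (ger0_norm M0) ler_wpM2r ?nrm_ge0// fM//.
  by rewrite src_inv.
by rewrite (fnorm1Z uu M%:C cg) nrm_real (ger0_norm M0).
Qed.

(** The adjoint relation turns the squared norm into the pairing of [(Ccstar_red k * k) * xi] with
    [xi]; a uniform bound on the kernel leaves one L^1 norm of [xi] from the convolution and one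
    from the pairing. *)
Lemma semi_conv_le u k xi (M : R) : units u -> (forall x, nrm (Ccconv (Ccstar_red k) k x) <= M) ->
  semi u (Ccconv k xi) ^+ 2 <= M * fnorm1 u (fun y => xi (inv y)) ^+ 2.
Proof.
move=> uu kM; have P := regular_pre_representation uu.
have M0 : 0 <= M by apply: le_trans (kM u); exact: nrm_ge0.
have N0 : 0 <= fnorm1 u (fun y => xi (inv y)) by exact: fnorm1_ge0.
rewrite (semi_sqr P) -(pr_adj P) -(pr_mul P).
apply: le_trans (ler_norm _) _; apply: le_trans (nrm_Re _) _.
rewrite expr2 mulrA; apply: nrm_pairing_le => //; first by rewrite mulr_ge0.
by move=> x xu; rewrite -xu; exact: nrm_conv_fnorm1.
Qed.

Lemma fiberCc_cauchy_schwarz u (f g : G -> CC R) : units u -> fiberCc u f -> fiberCc u g ->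
  nrm (fint u (fun y => f y * g y)) ^+ 2 <=
  (\int[haar u]_(y in rfiber u) (nrm (f y) ^+ 2)) * (\int[haar u]_(y in rfiber u) (nrm (g y) ^+ 2)).
Proof.
move=> uu cf cg.
have [f' cf' ff'] := fiberCc_extension cf; have [g' cg' gg'] := fiberCc_extension cg.
have := @semi_cauchy_schwarz _ _ _ _ _ _ _ (regular_pre_representation uu)
  (CcFun (Cc_inv cf')) (CcFun (Cc_conj (Cc_inv cg'))).
rewrite -ler_sqr ?nnegrE ?nrm_ge0 ?mulr_ge0 ?semi_ge0// exprMn !semi_sqrE//.
congr (_ <= _); first congr (nrm _ ^+ 2).
  by apply: eq_fint => y yu /=; rewrite conjcK invK ff'// gg'.
congr (_ * _); apply: eq_Rintegral => y; rewrite inE => yu /=; rewrite ?nrm_conj invK.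
  by rewrite ff'.
by rewrite gg'.
Qed.

(** Cauchy-Schwarz on the fibre of [src x]. By left invariance the factor coming from [k] has its
    L^2 norm taken at the unit [rng x], and the factor [h] at [src x]; hence the hypothesis over all
    units. *)
Lemma nrm_conv_semi k h x (S : R) : (forall u, units u -> semi u k ^+ 2 <= S) ->
  (forall u, units u -> semi u h ^+ 2 <= S) -> nrm (Ccconv (Ccstar_red k) h x) <= S.
Proof.
move=> kS hS; have us := unit_src x; have ur := unit_rng x.
have S0 : 0 <= S by apply: le_trans (kS _ us); exact: sqr_ge0.
have cF := fiberCc_kernel (Ccstar_red k) (erefl (src x)).
have cH := fiberCc_inv (src x) h.
rewrite -ler_sqr ?nnegrE ?nrm_ge0//.
have -> : Ccconv (Ccstar_red k) h x = fint (src x) (fun y =>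
    (Ccstar_red k (mul x y) * twist (mul x y) (inv y)) * h (inv y)).
  by rewrite /= convE; apply: eq_fint => y _; rewrite mulrAC.
apply: le_trans (fiberCc_cauchy_schwarz us cF cH) _.
rewrite expr2; apply: ler_pM.
- by apply: Rintegral_ge0 => y _; rewrite sqr_ge0.
- by apply: Rintegral_ge0 => y _; rewrite sqr_ge0.
- apply: le_trans (kS _ ur); rewrite semi_sqrE//.
  pose w y := ((nrm (k (inv y)) ^+ 2)%:C : CC R).
  have cw : fiberCc (rng x) w.
    have c := fiberCc_inv (rng x) k; have c2 := fiberCcM c (proj1 (fiberCc_conj c)).
    rewrite (_ : w = fun y => k (inv y) * (k (inv y))^*%C)//.
    by apply/funext => y; rewrite mul_conjr.
  have := congr1 (fun z : CC R => complex.Re z) (fint_invariant cw) => /= e.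
  rewrite le_eqVlt; apply/orP; left; apply/eqP.
  rewrite /= e; apply: eq_Rintegral => y; rewrite inE => yu /=.
  rewrite nrmM nrm_twist ?mulr1; last by rewrite src_mul ?rng_inv// yu.
  rewrite /star_red /star !(nrmM, nrm_conj) !nrm_twist ?mulr1 ?mul1r ?rng_inv//.
  by rewrite src_rng rng_rng.
by rewrite -semi_sqrE//; exact: hS.
Qed.

Lemma red_dpow f n (K : R) : red_seminorm f ^+ 2 <= K ->
  red_seminorm (dpow (@Ccconv R G) (@Ccstar_red R G) f n) <= K ^+ (2 ^ n).
Proof.
move=> fK; have P := red_seminormP G.
elim: n => [|n IH] /=; first by rewrite expn0 expr1 (csn_adj P).
apply: le_trans (csnM P _ _) _; rewrite expnS mulnC exprM expr2.
by rewrite ler_pM ?(csn_ge0 P).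
Qed.

(** The power of index [n.+1] is the power of index [n] acting on itself as a vector, so its L^2
    norm gains at most a factor [K ^+ (2 ^ n)]. The L^2 norm at index 0 is bounded uniformly in [u],
    which makes [C] independent of the unit; dividing it by [K] fits the exponent at [n = 0]. *)
Lemma semi_dpow f (K : R) : 0 < K -> red_seminorm f ^+ 2 <= K ->
  exists2 C : R, 0 <= C & forall u n, units u ->
    semi u (dpow (@Ccconv R G) (@Ccstar_red R G) f n) <= C * K ^+ (2 ^ n).
Proof.
move=> K0 fK; set F := dpow _ _ f.
have [M M0 FM] := Cc_bounded (ccP (F 0%N)).
have MF : 0 <= M * nI (F 0%N) by rewrite mulr_ge0//; exact: nI_ge0 (ccP _).
exists (Num.sqrt (M * nI (F 0%N)) / K); first by rewrite divr_ge0 ?sqrtr_ge0 ?ltW.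
move=> u n uu; elim: n => [|n IH].
  rewrite expn0 expr1 divfK ?gt_eqF// -[leLHS]ger0_norm ?semi_ge0// -sqrtr_sqr ler_wsqrtr//.
  apply: le_trans (semi_sqr_le uu FM) _; rewrite ler_wpM2l//.
  by have [] := nI_ub uu (ccP (F 0%N)).
apply: le_trans (regular_seminorm_ub uu _ _) _.
rewrite expnS mulnC exprM expr2 mulrCA; apply: ler_pM => //.
- by rewrite (csn_ge0 (regular_seminormP uu)).
- exact: semi_ge0.
- by apply: le_trans (red_seminorm_ub _ uu) _; exact: red_dpow.
Qed.

End OneGroupoid.

Variables (G H : twisted_groupoid R) (p : partial_morphism G H).
Implicit Types (f : Ccfun H).

Lemma Ccinduced_dpow f n : dpow (@Ccconv R G) (@Ccstar_red R G) (Ccinduced p f) n =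
  Ccinduced p (dpow (@Ccconv R H) (@Ccstar_red R H) f n).
Proof.
by elim: n => [|n IH] /=; rewrite ?IH Ccinduced_mul ?Ccinduced_star_red.
Qed.

(* The kernel of the operator of (h^* * h) on L^2(G_u) is bounded by the supremum
   over H of |h^* * h|, which the L^2 norms of h over the fibres of H control:
   so the growth of the powers of f^* * f in the regular representations of H
   bounds their growth in that of G. *)
Lemma red_seminorm_induced f : red_seminorm (Ccinduced p f) <= red_seminorm f.
Proof.
have f0 : 0 <= red_seminorm f by exact: csn_ge0 (red_seminormP H) _.
apply: sup_seminorm_le => // nu [u uu ->].
have P := regular_pre_representation uu.
apply: (opn_le P (regular_le_nI uu)) => // xi.
rewrite -ler_sqr ?nnegrE ?semi_ge0 ?mulr_ge0 ?semi_ge0// exprMn.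
set N := fnorm1 u (fun y => xi (inv y)).
have N0 : 0 <= N by exact: fnorm1_ge0.
(* [K] lies strictly above the square of the reduced norm, which may be 0, because [semi_dpow] asks
   for a positive rate. *)
have le_K (K : R) : red_seminorm f ^+ 2 < K ->
    semi (fun f g : Ccfun G => pairing u f g) (Ccconv (Ccinduced p f) xi) ^+ 2 <=
    K * semi (fun f g : Ccfun G => pairing u f g) xi ^+ 2.
  move=> fK; have K0 : 0 < K by apply: le_lt_trans fK; exact: sqr_ge0.
  have [C C0 CP] := semi_dpow K0 (ltW fK).
  apply: (@semi_rho_bound _ _ _ _ _ _ _ P (Ccinduced p f) xi (C * N) _ (ltW K0)) => n.
  rewrite Ccinduced_dpow; set F := dpow _ _ f n.
  have K2 : 0 <= C * K ^+ (2 ^ n) by rewrite mulr_ge0// exprn_ge0// ltW.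
  rewrite -ler_sqr ?nnegrE ?semi_ge0//; last by rewrite mulrAC mulr_ge0.
  rewrite mulrAC exprMn; apply: semi_conv_le => // x.
  rewrite -Ccinduced_star_red -Ccinduced_mul /= /induced; case: (p x) => [y|].
    apply: (nrm_conv_semi (k := F) (h := F)) => v uv; rewrite ler_sqr ?nnegrE ?semi_ge0//;
      exact: CP.
  by rewrite nrm0 sqr_ge0.
set s := semi _ xi in le_K *; have s0 : 0 <= s ^+ 2 by exact: sqr_ge0.
(* Letting [K] decrease to the squared reduced norm removes the strict inequality. *)
apply/ler_addgt0Pr => e e0.
have e1 : 0 < e / (s ^+ 2 + 1) by rewrite divr_gt0// ltr_wpDl.
apply: le_trans (le_K (red_seminorm f ^+ 2 + e / (s ^+ 2 + 1)) _) _; first by rewrite ltrDl.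
rewrite mulrDl lerD2l mulrAC ler_pdivrMr ?ltr_wpDl// ler_wpM2l ?(ltW e0)//.
by rewrite lerDl.
Qed.

Lemma norm_red_induced (f : H -> CC R) : Cc f -> (norm_red (induced p f) <= norm_red f)%E.
Proof.
move=> cf; rewrite -[f]/(ccval (CcFun cf)) -[induced _ _]/(ccval (Ccinduced p (CcFun cf))).
by rewrite !norm_redE lee_fin; exact: red_seminorm_induced.
Qed.

End ReducedInduced.

(** * Extension to the completions *)

Section CstarContinuity.
Variable R : realType.
Implicit Types A B : cstar_algebra R.

Lemma lipschitz_continuous_nrm (V W : normedModType R[i]) (phi : V -> W) (L : R) :
  (forall x y, nrm (phi x - phi y) <= L * nrm (x - y)) -> continuous phi.
Proof.
move=> phiL x; apply/cvg_nrmP => e e0.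
have L1 : 0 < `|L| + 1 by rewrite ltr_wpDl.
have := (@cvg_nrmP R V V _ (nbhs_filter x) id x).1 cvg_id _ (divr_gt0 e0 L1).
apply: filterS => y; rewrite ltr_pdivlMr// => xy; apply: le_lt_trans (phiL _ _) _.
apply: le_lt_trans xy; rewrite mulrC ler_wpM2l ?nrm_ge0//.
by apply: le_trans (ler_norm _) _; rewrite lerDl.
Qed.

Lemma nrm_cmul A (x y : A) : nrm (cmul x y) <= nrm x * nrm y.
Proof. by have := cnorm_mul x y; rewrite !nrmE -rmorphM lecR. Qed.

Lemma nrm_cadj A (x : A) : nrm (cadj x) = nrm x.
Proof.
have le y : nrm y <= nrm (cadj y) :> R.
  have [->|y0] := eqVneq (nrm y) 0; first exact: nrm_ge0.
  have y1 : 0 < nrm y by rewrite lt_def y0 nrm_ge0.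
  rewrite -(ler_pM2r y1) -expr2; have := cnorm_adj y.
  rewrite !nrmE -rmorphXn => /complexI <-; exact: nrm_cmul.
by apply/eqP; rewrite eq_le le andbT -{2}[x]cadjK le.
Qed.

Lemma cmul_continuousl A (y : A) : continuous (fun x : A => cmul x y).
Proof.
apply: (@lipschitz_continuous_nrm A A _ (nrm y)) => x x'.
have -> : cmul x y - cmul x' y = cmul (x - x') y.
  by have := cmulDl (-1) x' x y; rewrite !scaleN1r addrC [- _ + cmul _ _]addrC => ->.
by rewrite mulrC; exact: nrm_cmul.
Qed.

Lemma cmul_continuousr A (x : A) : continuous (fun y : A => cmul x y).
Proof.
apply: (@lipschitz_continuous_nrm A A _ (nrm x)) => y y'.
have -> : cmul x y - cmul x y' = cmul x (y - y').
  by have := cmulDr (-1) y' y x; rewrite !scaleN1r addrC [- _ + cmul _ _]addrC => ->.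
exact: nrm_cmul.
Qed.

Lemma cadj_continuous A : continuous (@cadj R A).
Proof.
apply: (@lipschitz_continuous_nrm A A _ 1) => x y.
have -> : cadj x - cadj y = cadj (x - y).
  have := cadjD (-1) y x; rewrite scaleN1r addrC => ->.
  by rewrite rmorphN rmorph1 scaleN1r addrC.
by rewrite nrm_cadj mul1r.
Qed.

End CstarContinuity.

Section Extension.
Variables (R : realType) (G H : twisted_groupoid R) (p : partial_morphism G H).
Variables (N : forall G : twisted_groupoid R, (G -> CC R) -> \bar R).
Variables (adj : forall G : twisted_groupoid R, (G -> CC R) -> (G -> CC R)).
Hypothesis adj_induced : forall f : H -> CC R, Cc f -> induced p (adj f) = adj (induced p f).
Hypothesis N_induced : forall f : H -> CC R, Cc f -> (N (induced p f) <= N f)%E.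
Variables (A B : cstar_algebra R) (j : (H -> CC R) -> A) (k : (G -> CC R) -> B).
Hypothesis (jP : is_completion (@N H) (@adj H) j) (kP : is_completion (@N G) (@adj G) k).
Implicit Types f g : H -> CC R.

(** The set where the two maps agree is closed and contains a dense set. Every identity on the
    completions is reduced to C_c(G) in this way. *)
Lemma completion_eq (W : normedModType R[i]) (phi psi : A -> W) :
  continuous phi -> continuous psi -> (forall f, Cc f -> phi (j f) = psi (j f)) -> phi =1 psi.
Proof.
move=> cphi cpsi e x; apply: contrapT => ne.
have hW : hausdorff_space W by exact: norm_hausdorff.
have cl := closed_equalizer hW cphi cpsi.
have [|z [ne' [f cf fE]]] := compl_dense jP _ (closed_openC cl); first by exists x.
by apply: ne'; rewrite /= -fE e.
Qed.

Lemma completion_approx (a : A) (e : R) : 0 < e -> exists2 f, Cc f & nrm (a - j f) < e.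
Proof.
move=> e0; have e0' : (0 : R[i]) < e%:C by rewrite ltcR.
have [||z [+ [f cf fE]]] := compl_dense jP (O := ball a e%:C).
- by exists a; exact: ballxx.
- exact: ball_open.
by rewrite -fE -ball_normE /= nrmE ltcR => af; exists f.
Qed.

Lemma induced_lin (a : R[i]) f g : induced p (a *: f + g) = a *: induced p f + induced p g.
Proof.
apply/funext => x; rewrite /induced /= !fctE.
by case: (p x) => [y|] //; rewrite scaler0 addr0.
Qed.

Lemma completion_induced_contraction f g : Cc f -> Cc g ->
  nrm (k (induced p f) - k (induced p g)) <= nrm (j f - j g).
Proof.
move=> cf cg; have cif := Cc_induced p cf; have cig := Cc_induced p cg.
have cd : Cc ((-1 : R[i]) *: g + f) by exact: (Cc_lin (-1) cg cf).
have -> : k (induced p f) - k (induced p g) = k (induced p ((-1 : R[i]) *: g + f)).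
  by rewrite induced_lin (compl_linear kP)// scaleN1r addrC.
have -> : j f - j g = j ((-1 : R[i]) *: g + f).
  by rewrite (compl_linear jP)// scaleN1r addrC.
rewrite -lee_fin (compl_norm kP); last exact: Cc_induced.
by rewrite (compl_norm jP)//; exact: N_induced.
Qed.

(** The inequality for all [f] determines [b], since [j f] may be taken arbitrarily close to [a]. It
    yields the continuity and the extension property of the map [a |-> b] with no comparison of
    approximating sequences. *)
Lemma extension_point (a : A) : exists b : B, forall f, Cc f ->
  nrm (b - k (induced p f)) <= nrm (a - j f).
Proof.
have /choice[fn fnP] n : exists f, Cc f /\ nrm (a - j f) < n.+1%:R^-1.
  by have [f cf af] := @completion_approx a n.+1%:R^-1 ltac:(by rewrite invr_gt0); exists f.
pose b n := k (induced p (fn n)).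
have bf n f : Cc f -> nrm (b n - k (induced p f)) <= n.+1%:R^-1 + nrm (a - j f).
  move=> cf; apply: le_trans (completion_induced_contraction (fnP n).1 cf) _.
  rewrite -(subrKA a); apply: le_trans (nrmD _ _) _; rewrite lerD2r nrmB.
  exact: ltW (fnP n).2.
have small (e : R) : 0 < e -> \forall n \near \oo, n.+1%:R^-1 < e.
  by move=> e0; exact: (near_infty_natSinv_lt (PosNum e0)).
have cb : cauchy (b @ \oo).
  apply/(cauchyP (b @ \oo)) => eps /pos_complexE[e0 ->].
  move: (complex.Re eps) e0 => e e0; have e2 : 0 < e / 2 by rewrite divr_gt0.
  have sm := small _ e2; have [n ne] := filter_ex sm; exists (b n).
  suff : \forall m \near \oo, ball (b n) e%:C (b m) by [].
  move: sm; apply: filterS => m me; rewrite -ball_normE /= nrmE ltcR.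
  have := bf n _ (fnP m).1; rewrite -/(b m) => /le_lt_trans; apply.
  by rewrite (splitr e) ltrD//; exact: lt_trans (fnP m).2 me.
have /cvg_ex[l bl] : cvg (b @ \oo) by exact: cauchy_cvg.
exists l => f cf; apply/ler_addgt0Pr => e e0; have e2 : 0 < e / 2 by rewrite divr_gt0.
have /cvg_nrmP/(_ _ e2) cl := bl.
have [n [/= ln ne]] := filter_ex (filterI cl (small _ e2)).
rewrite -(subrKA (b n)); apply: le_trans (nrmD _ _) _.
have := bf n f cf; move: ln ne; move: (nrm _) (nrm _) (nrm _) (n.+1%:R^-1) => r s t w; lra.
Qed.

Lemma extension_exists : exists2 phi : A -> B, continuous phi &
  forall f, Cc f -> phi (j f) = k (induced p f).
Proof.
have /choice[phi phiP] := extension_point; exists phi.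
  apply: (@lipschitz_continuous_nrm R A B _ 1) => a a'; rewrite mul1r.
  apply/ler_addgt0Pr => e e0; have e2 : 0 < e / 2 by rewrite divr_gt0.
  have [f cf af] := completion_approx a e2.
  rewrite -(subrKA (k (induced p f))); apply: le_trans (nrmD _ _) _.
  have h1 := phiP a f cf; have h2 := phiP a' f cf.
  have h3 : nrm (a' - j f) <= nrm (a - a') + nrm (a - j f).
    by rewrite -(subrKA a); apply: le_trans (nrmD _ _) _; rewrite nrmB.
  rewrite [X in _ + X <= _]nrmB.
  move: h1 h2 h3 af; move: (nrm _) (nrm _) (nrm _) (nrm _) (nrm _) => r s t w v; lra.
move=> f cf; have := phiP (j f) f cf; rewrite subrr nrm0 => h.
apply/eqP; rewrite -subr_eq0; apply/eqP; apply: nrm0_eq0.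
by apply/eqP; rewrite eq_le h nrm_ge0.
Qed.

(** Identities in two variables are extended one variable at a time, so separate continuity of the
    operations is what enters. *)
Lemma extension_star_morphism (phi : A -> B) : continuous phi ->
  (forall f, Cc f -> phi (j f) = k (induced p f)) -> is_star_morphism phi.
Proof.
move=> cphi phij; split.
- move=> a x y.
  have cl (z : A) : continuous (fun x : A => phi (a *: x + z)).
    move=> w; apply: (@continuous_comp _ _ _ (fun x : A => a *: x + z) phi); last exact: cphi.
    by apply: cvgD; [exact: scaler_continuous|exact: cvg_cst].
  have cr (z : A) : continuous (fun y : A => phi (a *: z + y)).
    move=> w; apply: (@continuous_comp _ _ _ (fun y : A => a *: z + y) phi); last exact: cphi.
    by apply: cvgD; [exact: cvg_cst|exact: cvg_id].
  have cl' (z : B) : continuous (fun x : A => a *: phi x + z).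
    move=> w; apply: cvgD; last exact: cvg_cst.
    by apply: cvgZr; exact: cphi.
  have cr' (z : B) : continuous (fun y : A => z + phi y).
    by move=> w; apply: cvgD; [exact: cvg_cst|exact: cphi].
  apply: (completion_eq (cl y) (cl' (phi y))) => f cf.
  apply: (completion_eq (cr (j f)) (cr' (a *: phi (j f)))) => g cg.
  have cd : Cc (a *: f + g) by exact: (Cc_lin a cf cg).
  rewrite -(compl_linear jP)// !phij// induced_lin (compl_linear kP)//; exact: Cc_induced.
- move=> x y.
  have cl (z : A) : continuous (fun x : A => phi (cmul x z)).
    move=> w; apply: (@continuous_comp _ _ _ (fun x : A => cmul x z) phi); last exact: cphi.
    exact: cmul_continuousl.
  have cr (z : A) : continuous (fun y : A => phi (cmul z y)).
    move=> w; apply: (@continuous_comp _ _ _ (fun y : A => cmul z y) phi); last exact: cphi.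
    exact: cmul_continuousr.
  have cl' (z : B) : continuous (fun x : A => cmul (phi x) z).
    move=> w; apply: (@continuous_comp _ _ _ phi (fun x => cmul x z)); first exact: cphi.
    exact: cmul_continuousl.
  have cr' (z : B) : continuous (fun y : A => cmul z (phi y)).
    move=> w; apply: (@continuous_comp _ _ _ phi (fun x => cmul z x)); first exact: cphi.
    exact: cmul_continuousr.
  apply: (completion_eq (cl y) (cl' (phi y))) => f cf.
  apply: (completion_eq (cr (j f)) (cr' (phi (j f)))) => g cg.
  have [cfg <-] := compl_conv jP cf cg.
  have [_ e] := compl_conv kP (Cc_induced p cf) (Cc_induced p cg).
  rewrite !phij// -e; congr k.
  exact: (congr1 (fun h : Ccfun G => (h : G -> CC R)) (Ccinduced_mul p (CcFun cf) (CcFun cg))).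
- move=> x.
  have c1 : continuous (fun x : A => phi (cadj x)).
    move=> w; apply: (@continuous_comp _ _ _ (@cadj R A) phi); last exact: cphi.
    exact: cadj_continuous.
  have c2 : continuous (fun x : A => cadj (phi x)).
    move=> w; apply: (@continuous_comp _ _ _ phi (@cadj R B)); first exact: cphi.
    exact: cadj_continuous.
  apply: (completion_eq c1 c2) => f cf.
  have [caf <-] := compl_adj jP cf; have [_ e] := compl_adj kP (Cc_induced p cf).
  by rewrite !phij// -e adj_induced.
Qed.

End Extension.

Section AssociationFunctor.
Variable R : realType.
Variables (N : forall G : twisted_groupoid R, (G -> CC R) -> \bar R).
Variables (adj : forall G : twisted_groupoid R, (G -> CC R) -> (G -> CC R)).
Hypothesis adj_induced : forall (G H : twisted_groupoid R) (p : partial_morphism G H)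
  (f : H -> CC R), Cc f -> induced p (adj f) = adj (induced p f).
Hypothesis N_induced : forall (G H : twisted_groupoid R) (p : partial_morphism G H)
  (f : H -> CC R), Cc f -> (N (induced p f) <= N f)%E.

Lemma association_inhabited (A : twisted_groupoid R -> cstar_algebra R)
    (j : forall G : twisted_groupoid R, (G -> CC R) -> A G) :
  (forall G : twisted_groupoid R, is_completion (@N G) (@adj G) (@j G)) ->
  inhabited (association N adj).
Proof.
move=> jP.
pose ext (G H : twisted_groupoid R) (p : partial_morphism G H) :=
  cid2 (extension_exists (N_induced p) (jP H) (jP G)).
constructor; apply: (@Association R N adj A j jP (fun G H p => projT1 (ext G H p))).
- by move=> G H p; rewrite /ext; case: cid2.
- move=> G H p f cf; split; first exact: Cc_induced.
  by rewrite /ext; case: cid2 => phi /= _; exact.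
Qed.

Section Functor.
Variable Gam : association N adj.

Let gamP (G : twisted_groupoid R) := assoc_completion Gam G.
Let gam_induced (G H : twisted_groupoid R) (p : partial_morphism G H) (f : H -> CC R) (cf : Cc f) :=
  (assoc_induced Gam p cf).2.

Definition assoc_mor (G H : twisted_groupoid R) (p : partial_morphism G H) :
  star_morphism (assoc_ob Gam H) (assoc_ob Gam G) :=
  StarMorphism (extension_star_morphism (@adj_induced G H p) (gamP H) (gamP G)
    (@assoc_continuous _ _ _ Gam G H p) (@gam_induced G H p)).

Lemma assoc_mor_id (G : Gsigma R) : assoc_mor (idm G) = star_id (assoc_ob Gam G).
Proof.
apply: star_morphism_eq; apply: (completion_eq (gamP G)).
- exact: assoc_continuous.
- by move=> x; exact: cvg_id.
by move=> f cf; rewrite /= gam_induced.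
Qed.

Lemma assoc_mor_comp (G H K : Gsigma R) (q : hom H K) (p : hom G H) :
  assoc_mor (compm q p) = star_comp (assoc_mor p) (assoc_mor q).
Proof.
apply: star_morphism_eq; apply: (completion_eq (gamP K)).
- exact: assoc_continuous.
- move=> x; apply: (@continuous_comp _ _ _ (assoc_map Gam q) (assoc_map Gam p)); exact: assoc_continuous.
move=> f cf; rewrite /= !gam_induced//; last exact: Cc_induced.
by congr assoc_emb; apply/funext => x; rewrite /induced /=; case: (p : partial_morphism G H) => /= p' _; case: (p' x).
Qed.

Definition assoc_functor : @contrafunctor_on (Gsigma R) (Cstar R) (assoc_ob Gam) :=
  @Contrafunctor (Gsigma R) (Cstar R) (assoc_ob Gam) assoc_mor assoc_mor_id assoc_mor_comp.

End Functor.
End AssociationFunctor.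

(** * Spaces *)

Section SpaceAlgebra.
Variables (R : realType) (X : lchspace).
Local Notation SX := (space_groupoid R X).
Implicit Types (f g : Ccfun SX) (x y : X).

Lemma space_conv (f g : X -> CC R) : continuous g -> @conv R SX f g = fun x => f x * g x.
Proof.
move=> cg; apply/funext => x; rewrite /conv /=.
change (cintegral (point_mass R x) [set x] (fun y => f x * g y * 1) = f x * g x).
have c : continuous (fun y : X => f x * g y * 1 : CC R).
  move=> y; apply: cvgM; last exact: cvg_cst.
  by apply: cvgM; [exact: cvg_cst|exact: cg].
by rewrite (@cintegral_point_mass R X x [set x] _ erefl (@closed_point X x) c) mulr1.
Qed.

Lemma space_star (f : X -> CC R) : @star R SX f = fun x => (f x)^*%C.
Proof. by apply/funext => x; rewrite /star /= mulr1. Qed.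

Lemma space_star_red (f : X -> CC R) : @star_red R SX f = fun x => (f x)^*%C.
Proof. by rewrite star_redE// space_star. Qed.

Lemma space_fnorm1 (f : X -> CC R) x : continuous f -> @fnorm1 R SX x f = nrm (f x).
Proof.
move=> cf; rewrite /fnorm1.
have c : continuous (fun y : X => nrm (f y)).
  by move=> y; apply: (continuous_comp (cf y)); exact: nrm_continuous.
exact: (@Rintegral_point_mass R X x [set x] _ erefl (@closed_point X x) c).
Qed.

Lemma Cc_C0 (T : topologicalType) (f : T -> CC R) : Cc f -> C0 f.
Proof.
move=> [cf cs]; split => // e e0; apply: subclosed_compact cs _.
  apply: (@closed_comp T R (fun t => nrm (f t)) [set r | e <= r]); last exact: closed_ge.
  by move=> t _; apply: (continuous_comp (cf t)); exact: nrm_continuous.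
move=> t /= ex; apply: subset_closure; apply/eqP => fx.
by move: ex; rewrite fx nrm0 leNgt e0.
Qed.

Definition C0_incl (f : X -> CC R) : C0_algebra R X :=
  if pselect (C0 f) is left cf then C0Fun cf else 0.

Lemma C0_inclE (f : X -> CC R) x : C0 f -> C0_incl f x = f x.
Proof. by move=> cf; rewrite /C0_incl; case: pselect. Qed.

Definition supf f : R := supnorm (C0_incl f).

Lemma supf_ub f x : nrm (f x) <= supf f.
Proof. by have := supnorm_ub (C0_incl f) x; rewrite C0_inclE//; exact: Cc_C0 (ccP f). Qed.

Lemma supf_le f (M : R) : 0 <= M -> (forall x, nrm (f x) <= M) -> supf f <= M.
Proof.
move=> M0 fM; apply: supnorm_le => // x; rewrite C0_inclE//; exact: Cc_C0 (ccP f).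
Qed.

Lemma supf_ge0 f : 0 <= supf f. Proof. exact: supnorm_ge0. Qed.

Lemma nI_space f : nI f <= supf f.
Proof.
apply: nI_le; [exact: ccP|exact: supf_ge0| |] => u _.
  by rewrite space_fnorm1; [exact: supf_ub|exact: (ccP f).1].
rewrite (@space_fnorm1 (fun x => f (@inv SX x))); first exact: supf_ub.
exact: (Cc_inv (ccP f)).1.
Qed.

Definition scaling (a : CC R) (v : complex_hilbert R) : complex_hilbert R := (a : R[i]) *: v.

Lemma scaling_linear a : linear (scaling a).
Proof. by move=> b v w; rewrite /scaling scalerDr !scalerA mulrC. Qed.

HB.instance Definition _ a := GRing.isLinear.Build R[i] (complex_hilbert R) (complex_hilbert R)
  *:%R (scaling a) (scaling_linear a).

Definition point_evaluation x (f : SX -> CC R) : {linear complex_hilbert R -> complex_hilbert R} :=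
  scaling (f x).

Lemma point_evaluationP x : is_representation (point_evaluation x).
Proof.
split => /=.
- by move=> f cf; apply: scaler_continuous.
- by move=> a f g v cf cg; rewrite /scaling scalerDl scalerA.
- by move=> f g v cf cg; rewrite /scaling space_conv ?scalerA//; exact: cg.1.
- move=> f v w cf; rewrite space_star /scaling.
  change (((f x)^*%C * (v : CC R)) * ((w : R[i])^*)%C = v * ((f x * (w : CC R))^*)%C :> CC R).
  have E (a b c : R[i]) : (a^*)%C * b * (c^*)%C = b * ((a * c)^*)%C.
    by rewrite rmorphM mulrCA mulrA.
  exact: E.
exists 1 => f cf; rewrite mul1e normIE//; apply: ge_ereal_sup => _ [v /= v1 <-].
rewrite lee_fin /scaling nrmZ.
have [h _] := nI_ub (erefl x : units (x : SX)) cf.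
rewrite (@space_fnorm1 f x cf.1) in h.
apply: le_trans h; rewrite -[leRHS]mulr1 ler_wpM2l ?nrm_ge0//.
Qed.

(** The Haar measures are point masses, so [normI] is at most the supremum norm and bounds every
    representation; the point evaluations attain the value at each point. *)
Lemma norm_max_space f : norm_max f = (supf f)%:E.
Proof.
rewrite norm_maxE; congr EFin; apply/eqP; rewrite eq_le; apply/andP; split.
  apply: sup_seminorm_le; first exact: supf_ge0.
  move=> nu [H [pi [piP ->]]]; apply: le_trans (nI_space f); exact: rep_seminorm_le.
apply: supf_le => [|x]; first exact: csn_ge0 (max_seminormP SX) _.
rewrite -lee_fin -norm_maxE.
apply: (@le_trans _ _ (opnorm (point_evaluation x f))); last first.
  apply: ereal_sup_ubound; exists (complex_hilbert R), (point_evaluation x).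
  by split => //; exact: point_evaluationP.
apply: ereal_sup_ubound; exists ((1 : CC R) : cplane R) => /=; first by rewrite nrm1.
rewrite /scaling; congr (nrm _)%:E; exact: mulr1.
Qed.

(** The upper bound is [normI] again. For the lower one, L^2 of the fibre over [x] is
    one-dimensional with norm [nrm (g x)], and [f] serves as its own test vector. *)
Lemma norm_red_space f : norm_red f = (supf f)%:E.
Proof.
rewrite norm_redE; congr EFin; apply/eqP; rewrite eq_le; apply/andP; split.
  exact: le_trans (red_seminorm_le_nI f) (nI_space f).
have r0 : 0 <= red_seminorm f by exact: csn_ge0 (red_seminormP SX) _.
apply: supf_le => // x.
have ux : units (x : SX) by [].
have semiE g : semi (fun f g : Ccfun SX => pairing (x : SX) f g) g = nrm (g x).
  apply/eqP; rewrite -(@eqrXn2 _ 2)// ?semi_ge0 ?nrm_ge0// semi_sqrE//; apply/eqP.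
  have cg := (Cc_inv (ccP g)).1.
  have c : continuous (fun y : X => nrm (g y) ^+ 2).
    move=> y; apply: (@continuous_comp X R R (fun y => nrm (g y)) (fun r => r ^+ 2)).
      by apply: (continuous_comp (cg y)); exact: nrm_continuous.
    exact: exprn_continuous.
  exact: (@Rintegral_point_mass R X x [set x] _ erefl (@closed_point X x) c).
have := regular_seminorm_ub ux f f; rewrite !semiE /= space_conv; last exact: (ccP f).1.
rewrite nrmM; have [->//|fx] := eqVneq (nrm (f x)) 0.
rewrite ler_pM2r; last by rewrite lt_def fx nrm_ge0.
by move=> h; apply: le_trans h _; exact: red_seminorm_ub.
Qed.

Section Completion.
Variables (N : (SX -> CC R) -> \bar R) (adj : (SX -> CC R) -> SX -> CC R).
Hypothesis NE : forall f, N f = (supf f)%:E.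
Hypothesis adjE : forall f : SX -> CC R, adj f = fun x => (f x)^*%C.

(** For density, [F] is multiplied by a cutoff that is 1 on the compact set where [nrm (F x)] is at
    least [e / 2]; elsewhere the change is at most [nrm (F x)]. *)
Lemma C0_completion : @is_completion R SX N adj (C0_algebra R X) C0_incl.
Proof.
split.
- move=> a f g cf cg; apply: C0fun_eq => x.
  have clin : Cc ((a : R[i]) *: f + g) := Cc_lin a cf cg.
  rewrite C0_inclE ?[RHS]/= ?C0_inclE//; exact: Cc_C0.
- move=> f g cf cg; have cc := Cc_conv cf cg; split => //; apply: C0fun_eq => x.
  rewrite C0_inclE ?[RHS]/= ?C0_inclE//; try exact: Cc_C0.
  by rewrite space_conv//; exact: cg.1.
- move=> f cf; rewrite adjE; have cc : Cc (fun x : SX => (f x)^*%C : CC R) by exact: Cc_conj.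
  split => //; apply: C0fun_eq => x.
  rewrite C0_inclE ?[RHS]/= ?C0_inclE//; exact: Cc_C0.
- by move=> f cf; rewrite -[f]/(ccval (CcFun cf)) NE.
move=> O [F OF] oO.
have [e e0 eO] : exists2 e : R, 0 < e & forall g : C0fun R X, supnorm (F - g) < e -> O g.
  move: oO => /(_ F OF) /nbhs_ballP[e' /= /pos_complexE[e0 e'E] eO].
  exists (complex.Re e') => // g Fg; apply: eO; rewrite -ball_normE /= nrmE e'E ltcR.
  exact: Fg.
have e2 : 0 < e / 2 by rewrite divr_gt0.
have cK := (C0P F).2 _ e2.
have [k [ck k01 kK ckc _]] := @compact_cutoff R X (@pt_lc X) (@pt_hausdorff X) _ setT cK (@openT X) (@subsetT _ _).
have ckC : continuous (fun x : X => (k x)%:C : CC R).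
  by move=> x; apply: (@continuous_comp X R (CC R) k); [exact: ck|exact: real_complex_continuous].
have cc : @Cc R X (fun x => F x * (k x)%:C).
  apply: (@Cc_intro R SX); first by move=> x; apply: cvgM; [exact: (C0P F).1|exact: ckC].
  exists (closure [set x | k x != 0]) => // x nx.
  have -> : k x = 0 by apply/eqP; apply: contra_notT nx => ?; exact: subset_closure.
  by rewrite mulr0.
exists (C0_incl (fun x => F x * (k x)%:C)); split; last by exists (fun x => F x * (k x)%:C).
apply: eO; apply: (@le_lt_trans _ _ (e / 2)); last by lra.
apply: supnorm_le => [|x]; first exact: ltW.
change (nrm (F x - C0_incl (fun x => F x * (k x)%:C) x) <= e / 2).
rewrite C0_inclE; last exact: Cc_C0.
have /andP[k0 k1] := k01 x.
have -> : F x - F x * (k x)%:C = F x * (1 - k x)%:C by rewrite rmorphB rmorph1 mulrBr mulr1.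
rewrite nrmM nrm_real ger0_norm ?subr_ge0//.
have [/kK ->|/ltW Fx] := lerP (e / 2) (nrm (F x)).
  by rewrite subrr mulr0 ltW.
apply: le_trans Fx; rewrite -[leRHS]mulr1 ler_wpM2l ?nrm_ge0//.
by rewrite gerBl.
Qed.

End Completion.
End SpaceAlgebra.

(** * Comparison with Gelfand duality *)

Section Gelfand.
Variable R : realType.
Variables (N : forall G : twisted_groupoid R, (G -> CC R) -> \bar R).
Variables (adj : forall G : twisted_groupoid R, (G -> CC R) -> (G -> CC R)).
Hypothesis adj_induced : forall (G H : twisted_groupoid R) (p : partial_morphism G H)
  (f : H -> CC R), Cc f -> induced p (adj f) = adj (induced p f).
Hypothesis N_induced : forall (G H : twisted_groupoid R) (p : partial_morphism G H)
  (f : H -> CC R), Cc f -> (N (induced p f) <= N f)%E.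
Hypothesis N_space : forall (X : lchspace) (f : Ccfun (space_groupoid R X)),
  N f = (supf f)%:E.
Hypothesis adj_space : forall (X : lchspace) (f : space_groupoid R X -> CC R),
  adj f = fun x => (f x)^*%C.
Variable Gam : association N adj.
Implicit Types X Y : lchspace.

Let A X := assoc_ob Gam (space_groupoid R X).
Let B X := C0_algebra R X.
Let emb X (f : X -> CC R) : A X := @assoc_emb R N adj Gam (space_groupoid R X) f.
Let incl X (f : X -> CC R) : B X := C0_incl f.
Let AP X : is_completion (@N (space_groupoid R X)) (@adj (space_groupoid R X)) (@emb X) :=
  assoc_completion Gam (space_groupoid R X).
Let BP X : is_completion (@N (space_groupoid R X)) (@adj (space_groupoid R X)) (@incl X) :=
  C0_completion (@N_space X) (@adj_space X).
(** [A X] and [B X] are two completions of C_c(X) for the same norm. Extending the map induced by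
    the identity partial morphism, in each direction, yields the mutually inverse comparison
    maps. *)
Let id_ X := pid (space_groupoid R X).

Let ext X := extension_exists (@N_induced _ _ (id_ X)) (AP X) (BP X).
Let ext' X := extension_exists (@N_induced _ _ (id_ X)) (BP X) (AP X).
Let phi X : A X -> B X := projT1 (cid2 (ext X)).
Let phi_cont X : continuous (@phi X). Proof. by rewrite /phi; case: cid2. Qed.
Let phiE X f : Cc f -> phi (emb f) = incl f :> B X.
Proof. by rewrite /phi; case: cid2 => /= h _ hE /hE. Qed.
Let psi X : B X -> A X := projT1 (cid2 (ext' X)).
Let psi_cont X : continuous (@psi X). Proof. by rewrite /psi; case: cid2. Qed.
Let psiE X f : Cc f -> psi (incl f) = emb f :> A X.
Proof. by rewrite /psi; case: cid2 => /= h _ hE /hE. Qed.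

Let theta X : star_morphism (A X) (B X) := StarMorphism
  (extension_star_morphism (@adj_induced _ _ (id_ X)) (AP X) (BP X) (@phi_cont X) (@phiE X)).
Let theta' X : star_morphism (B X) (A X) := StarMorphism
  (extension_star_morphism (@adj_induced _ _ (id_ X)) (BP X) (AP X) (@psi_cont X) (@psiE X)).

Let theta_iso X : isomorphism (theta X : @hom (Cstar R) (A X) (B X)).
Proof.
exists (theta' X); split; apply: star_morphism_eq.
  apply: (completion_eq (AP X)) => [x|x|f cf] /=.
  - by apply: (@continuous_comp _ _ _ (@phi X) (@psi X)); [exact: phi_cont|exact: psi_cont].
  - exact: cvg_id.
  - by rewrite phiE// psiE.
apply: (completion_eq (BP X)) => [x|x|f cf] /=.
- by apply: (@continuous_comp _ _ _ (@psi X) (@phi X)); [exact: psi_cont|exact: phi_cont].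
- exact: cvg_id.
- by rewrite psiE// phiE.
Qed.

Lemma C0_pullback_continuous X Y (h : proper_map X Y) :
  continuous (C0_pullback h : C0fun R Y -> C0fun R X).
Proof.
apply: (@lipschitz_continuous_nrm R (C0fun R Y) (C0fun R X) _ 1) => f g; rewrite mul1r.
by apply: supnorm_le => [|x]; [exact: supnorm_ge0|exact: (supnorm_ub (f - g) (h x))].
Qed.

Lemma functor_extending_gelfand : is_functor_extending_gelfand Gam.
Proof.
exists (assoc_functor adj_induced Gam); split => //.
exists theta; split; last first.
  by move=> X f cf x; rewrite /= (phiE cf) C0_inclE//; exact: Cc_C0.
split; first exact: theta_iso.
move=> X Y h; apply: star_morphism_eq; apply: (completion_eq (AP Y)) => [x|x|f cf].
- apply: (@continuous_comp _ _ _ (assoc_map Gam (space_mor R h)) (@phi X)); last exact: phi_cont.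
  exact: assoc_continuous.
- apply: (@continuous_comp _ _ _ (@phi Y) (C0_pullback h)); first exact: phi_cont.
  exact: C0_pullback_continuous.
have [ci e] := assoc_induced Gam (space_mor R h) cf.
transitivity (@phi X (assoc_map Gam (space_mor R h) (emb f))); first by [].
rewrite /emb e (phiE ci).
apply: C0fun_eq => x; rewrite C0_inclE; last exact: Cc_C0.
transitivity ((C0_pullback h (phi (emb f)) : C0fun R X) x); last by [].
by rewrite phiE//= C0_inclE//; exact: Cc_C0.
Qed.

End Gelfand.

Theorem theorem3p22 (R : realType) :
  (inhabited (Gamma_max R) /\
   forall Gam : Gamma_max R, is_functor_extending_gelfand Gam) /\
  (inhabited (Gamma_min R) /\
   forall Gam : Gamma_min R, is_functor_extending_gelfand Gam).
Proof.
have smax (G H : twisted_groupoid R) (p : partial_morphism G H) (f : H -> CC R) :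
    Cc f -> induced p (star f) = star (induced p f) by move=> _; exact: induced_star.
have smin (G H : twisted_groupoid R) (p : partial_morphism G H) (f : H -> CC R) :
    Cc f -> induced p (star_red f) = star_red (induced p f) by move=> _; exact: induced_star_red.
have nmax (G H : twisted_groupoid R) (p : partial_morphism G H) (f : H -> CC R) :
    Cc f -> (norm_max (induced p f) <= norm_max f)%E by move=> _; exact: norm_max_induced.
have nmin := @norm_red_induced R.
split; split.
- exact: (association_inhabited nmax (@max_completion R)).
- move=> Gam; apply: (functor_extending_gelfand smax nmax) => X f.
    exact: norm_max_space.
  exact: space_star.
- exact: (association_inhabited nmin (@red_completion R)).
- move=> Gam; apply: (functor_extending_gelfand smin nmin) => X f.
    exact: norm_red_space.
  exact: space_star_red.
Qed.
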